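(* Let $((F,\nu,N),[\,,]_{F,h},(\rho,\eta))$ be a generalized Lie algebroid and let $(E,\pi,M)$ be an interior differential system (IDS) of it. Then $(E,\pi,M)$ is involutive if and only if the ideal (of the exterior differential algebra $\Lambda(h^*F,h^*\nu,M)$) generated by the $\mathcal F(M)$-submodule $(\Gamma(E^0,\pi^0,M),+,\cdot)$ is an exterior differential system (EDS) of the same generalized Lie algebroid.
   Context: Manifolds are smooth and finite-dimensional, vector bundles are real of finite rank; $\mathcal F(N)=C^\infty(N,\mathbb R)$, $\Gamma(F,\nu,N)$ is the module of smooth sections. For a vector bundle morphism $(\varphi,\varphi_0)$ with $\varphi_0$ a diffeomorphism, $\Gamma(\varphi,\varphi_0)u=\varphi\circ u\circ\varphi_0^{-1}$ on sections. Generalized Lie algebroid $((F,\nu,N),[\,,]_{F,h},(\rho,\eta))$: manifolds $M,N$, diffeomorphisms $h:M\to N$, $\eta:N\to M$, a vector bundle $(F,\nu,N)$, a vector bundle morphism $\rho:F\to TM$ covering $\eta$, and an $\mathbb R$-bilinear Lie bracket $[\,,]_{F,h}$ on $\Gamma(F,\nu,N)$ with $[u,fv]_{F,h}=f[u,v]_{F,h}+(\Gamma(Th\circ\rho,h\circ\eta)(u)f)v$ and with $\Gamma(Th\circ\rho,h\circ\eta):\Gamma(F,\nu,N)\to\Gamma(TN,\tau_N,N)$ a Lie algebra morphism. Pull-back Lie algebroid: $(h^*F,h^*\nu,M)$ is the pull-back bundle; each of its sections is $Z=z\circ h$ (that is, $Z(x)=z(h(x))$) for a unique $z\in\Gamma(F,\nu,N)$.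 The bracket is $[z\circ h,w\circ h]_{h^*F}=[z,w]_{F,h}\circ h$, and the anchor $\overset{h^*F}{\rho}:h^*F\to TM$ (over $\mathrm{Id}_M$) sends $z\circ h$ to the vector field on $M$ that is $h$-related to $\Gamma(Th\circ\rho,h\circ\eta)z$; in local frames $T_\alpha=t_\alpha\circ h$ with $\rho(t_\alpha)=\sum_i\rho^i_\alpha\frac{\partial}{\partial x^i}$ and $[t_\alpha,t_\beta]_{F,h}=L^\gamma_{\alpha\beta}t_\gamma$, this reads $Z^\alpha T_\alpha\mapsto Z^\alpha(\rho^i_\alpha\circ h)\frac{\partial}{\partial x^i}$ and $[T_\alpha,T_\beta]_{h^*F}=(L^\gamma_{\alpha\beta}\circ h)T_\gamma$, extended by the Leibniz rule. This is a Lie algebroid over $M$. Forms: $\Lambda^q(h^*F,h^*\nu,M)$ is the set of alternating $\mathcal F(M)$-$q$-linear maps $\Gamma(h^*F,h^*\nu,M)^q\to\mathcal F(M)$, $\Lambda^0=\mathcal F(M)$, $\Lambda(h^*F,h^*\nu,M)=\bigoplus_{q\ge0}\Lambda^q(h^*F,h^*\nu,M)$; $(\omega\wedge\theta)(z_1,\dots,z_{q+r})=\frac1{q!r!}\sum_{\sigma}\mathrm{sgn}(\sigma)\omega(z_{\sigma(1)},\dots,z_{\sigma(q)})\theta(z_{\sigma(q+1)},\dots,z_{\sigma(q+r)})$; and $d^{h^*F}\omega(z_0,\dots,z_q)=\sum_i(-1)^i\,\Gamma(\overset{h^*F}{\rho},\mathrm{Id}_M)z_i(\omega(z_0,\dots,\hat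 z_i,\dots,z_q))+\sum_{i<j}(-1)^{i+j}\omega([z_i,z_j]_{h^*F},z_0,\dots,\hat z_i,\dots,\hat z_j,\dots,z_q)$. An interior differential system (IDS) of the generalized Lie algebroid is any vector subbundle $(E,\pi,M)$ of $(h^*F,h^*\nu,M)$. It is involutive if $[S,T]_{h^*F}\in\Gamma(E,\pi,M)$ for all $S,T\in\Gamma(E,\pi,M)$. Its annihilator subbundle $(E^0,\pi^0,M)$ of the dual bundle $\overset{*}{h^*F}$ has sections $\Gamma(E^0,\pi^0,M)=\{\Omega\in\Gamma(\overset{*}{h^*F},\overset{*}{h^*\nu},M):\Omega(S)=0\ \ \forall S\in\Gamma(E,\pi,M)\}$. A differential ideal of the generalized Lie algebroid is an ideal $\mathcal I$ of $(\Lambda(h^*F,h^*\nu,M),+,\cdot,\wedge)$ with $d^{h^*F}\mathcal I\subseteq\mathcal I$. A differential ideal $\mathcal I$ is an exterior differential system (EDS) of the generalized Lie algebroid if there exists an IDS $(E,\pi,M)$ such that for all $k\ge1$ and $\omega\in\mathcal I\cap\Lambda^k(h^*F,h^*\nu,M)$ one has $\omega(u_1,\dots,u_k)=0$ for all $u_1,\dots,u_k\in\Gamma(E,\pi,M)$. *)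

(* Defs.v *)
From HB Require Import structures.
From mathcomp Require Import all_boot all_order all_algebra all_fingroup.
From mathcomp Require Import all_classical all_reals.
From mathcomp Require Import interval_inference topology normedtype landau derive.

Set Implicit Arguments.
Unset Strict Implicit.
Unset Printing Implicit Defensive.

Import Order.TTheory GRing.Theory Num.Theory.
Import numFieldNormedType.Exports.

Local Open Scope classical_set_scope.
Local Open Scope ring_scope.

Section Calculus.
Context {R : realType}.

Definition partial n (f : 'rV[R]_n -> R) (i : 'I_n) : 'rV[R]_n -> R :=
  fun x => 'D_(delta_mx 0 i) f x.

(* To be used with [U] open: all iterated partial derivatives of [f] exist and
   are (Frechet) differentiable, hence continuous, at every point of [U]. *)
Definition smooth_on n (U : set 'rV[R]_n) (f : 'rV[R]_n -> R) : Prop :=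
  forall x, U x -> forall s : seq 'I_n, differentiable (foldl (@partial n) f s) x.

Let Ck n (k : nat) (U : set 'rV[R]_n) (f : 'rV[R]_n -> R) : Prop :=
  forall x, U x -> forall s : seq 'I_n, (size s <= k)%N ->
    differentiable (foldl (@partial n) f s) x.

Let CkP n (U : set 'rV[R]_n) f : smooth_on U f <-> forall k, Ck k U f.
Proof.
by split=> [h k x Ux s _|h x Ux s]; [exact: h|exact: (h (size s) x Ux s)].
Qed.

Let Ck0 n (U : set 'rV[R]_n) f :
  (forall x, U x -> differentiable f x) -> Ck 0 U f.
Proof. by move=> h x Ux [|//] _; exact: h. Qed.

Let CkS n k (U : set 'rV[R]_n) f : Ck k.+1 U f <->
  (forall x, U x -> differentiable f x) /\ forall i, Ck k U (partial f i).
Proof.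
split=> [h|[h1 h2] x Ux [|i s] sk]; last 2 first.
- exact: h1.
- exact: h2.
by split=> [x Ux|i x Ux s sk]; [exact: (h x Ux [::])|exact: (h x Ux (i :: s))].
Qed.

Let Ck_diff n k (U : set 'rV[R]_n) f : Ck k U f ->
  forall x, U x -> differentiable f x.
Proof. by move=> h x Ux; exact: (h x Ux [::]). Qed.

Let CkW n k (U : set 'rV[R]_n) f : Ck k.+1 U f -> Ck k U f.
Proof. by move=> h x Ux s sk; apply: h => //; exact: leqW. Qed.

Lemma near_eq_differentiable (V W : normedModType R) (f g : V -> W) (x : V) :
  (\forall y \near x, f y = g y) -> differentiable f x -> differentiable g x.
Proof.
move=> fg /diff_locallyP[dfc dfo].
have fgx : f x = g x by exact: nbhs_singleton fg.
have dgo : g \o shift x = cst (g x) + 'd f x +o_ 0 id.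
  apply: eqaddoE; apply/eqaddoP => _/posnumP[e].
  have /eqaddoP/(_ _ [gt0 of e%:num]) := dfo.
  have : \forall h \near 0, f (h + x) = g (h + x).
    by move: fg; rewrite (near_shift 0) /= subr0.
  by apply: filterS2 => h /= fgh; rewrite -fgx !fctE /= fgh.
have dE := diff_unique dfc dgo.
by apply/diff_locallyP; rewrite dE.
Qed.

Lemma partial_near_eq n (U : set 'rV[R]_n) f g i : open U ->
  {in U, f =1 g} -> {in U, partial f i =1 partial g i}.
Proof.
move=> oU fg x /set_mem Ux; apply: near_eq_derive.
by apply: filterS (open_nbhs_nbhs (conj oU Ux)) => y /mem_set; exact: fg.
Qed.

Lemma smooth_on_ext n (U : set 'rV[R]_n) f g : open U ->
  {in U, f =1 g} -> smooth_on U f -> smooth_on U g.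
Proof.
move=> oU fg sf x Ux s; move: (sf x Ux s) => {sf}.
elim: s f g fg => [|i s ih] f g fg /=; last exact/ih/partial_near_eq.
apply: near_eq_differentiable.
by apply: filterS (open_nbhs_nbhs (conj oU Ux)) => y /mem_set; exact: fg.
Qed.

Let Ck_ext n k (U : set 'rV[R]_n) f g : open U ->
  {in U, f =1 g} -> Ck k U f -> Ck k U g.
Proof.
move=> oU fg sf x Ux s sk; move: (sf x Ux s sk) => {sf sk}.
elim: s f g fg => [|i s ih] f g fg /=; last exact/ih/partial_near_eq.
apply: near_eq_differentiable.
by apply: filterS (open_nbhs_nbhs (conj oU Ux)) => y /mem_set; exact: fg.
Qed.

Lemma smooth_onW n (U V : set 'rV[R]_n) f :
  U `<=` V -> smooth_on V f -> smooth_on U f.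
Proof. by move=> UV h x /UV; exact: h. Qed.

Lemma smooth_on_local n (U : set 'rV[R]_n) f :
  (forall x, U x -> exists2 W, W x & smooth_on W f) -> smooth_on U f.
Proof. by move=> h x /h[W Wx]; exact. Qed.

Lemma smooth_on_diff n (U : set 'rV[R]_n) f x :
  smooth_on U f -> U x -> differentiable f x.
Proof. by move=> h Ux; exact: (h x Ux [::]). Qed.

Lemma smooth_on_partial n (U : set 'rV[R]_n) f i :
  smooth_on U f -> smooth_on U (partial f i).
Proof. by move=> h x Ux s; exact: (h x Ux (i :: s)). Qed.

Let Ck_cst n k (U : set 'rV[R]_n) (c : R) : Ck k U (cst c).
Proof.
elim: k c => [|k ih] c; first by apply: Ck0 => x _; exact: differentiable_cst.
apply/CkS; split=> [x _|i]; first exact: differentiable_cst.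
have -> : partial (cst c : 'rV[R]_n -> R) i = cst 0; last exact: ih.
by apply/funext => x; exact: derive_cst.
Qed.

Lemma smooth_on_cst n (U : set 'rV[R]_n) (c : R) : smooth_on U (cst c).
Proof. by apply/CkP => k; exact: Ck_cst. Qed.

Let Ck_add n k (U : set 'rV[R]_n) f g : open U ->
  Ck k U f -> Ck k U g -> Ck k U (f \+ g).
Proof.
move=> oU; elim: k f g => [|k ih] f g sf sg.
  by apply: Ck0 => x Ux; apply: differentiableD; [exact: (Ck_diff sf)|exact: (Ck_diff sg)].
apply/CkS; split=> [x Ux|i].
  by apply: differentiableD; [exact: (Ck_diff sf)|exact: (Ck_diff sg)].
move: (sf) (sg) => /CkS[df /(_ i) pf] /CkS[dg /(_ i) pg].
apply: Ck_ext (ih _ _ pf pg) => // x /set_mem Ux.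
by rewrite /partial /= deriveD//; apply: diff_derivable; [exact: df|exact: dg].
Qed.

Lemma smooth_onD n (U : set 'rV[R]_n) f g : open U ->
  smooth_on U f -> smooth_on U g -> smooth_on U (f \+ g).
Proof. by move=> oU /CkP sf /CkP sg; apply/CkP => k; exact: Ck_add. Qed.

Let Ck_sum n k (U : set 'rV[R]_n) m (f : 'I_m -> 'rV[R]_n -> R) : open U ->
  (forall i, Ck k U (f i)) -> Ck k U (fun x => \sum_i f i x).
Proof.
move=> oU; elim: m f => [|m ih] f sf.
  rewrite (_ : (fun _ => _) = cst 0); first exact: Ck_cst.
  by apply/funext => x; rewrite big_ord0.
rewrite (_ : (fun _ => _) = f ord0 \+ (fun x => \sum_i f (lift ord0 i) x)).
  by apply: Ck_add => //; exact: ih.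
by apply/funext => x; rewrite big_ord_recl.
Qed.

Lemma smooth_on_sum n (U : set 'rV[R]_n) m (f : 'I_m -> 'rV[R]_n -> R) :
  open U -> (forall i, smooth_on U (f i)) ->
  smooth_on U (fun x => \sum_i f i x).
Proof. by move=> oU sf; apply/CkP => k; apply: Ck_sum => // i; by have /CkP := sf i. Qed.

Let Ck_mul n k (U : set 'rV[R]_n) f g : open U ->
  Ck k U f -> Ck k U g -> Ck k U (f \* g).
Proof.
move=> oU; elim: k f g => [|k ih] f g sf sg.
  by apply: Ck0 => x Ux; apply: differentiableM; [exact: (Ck_diff sf)|exact: (Ck_diff sg)].
apply/CkS; split=> [x Ux|i].
  by apply: differentiableM; [exact: (Ck_diff sf)|exact: (Ck_diff sg)].
move: (sf) (sg) => /CkS[df /(_ i) pf] /CkS[dg /(_ i) pg].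
have := Ck_add oU (ih _ _ (CkW sf) pg) (ih _ _ (CkW sg) pf).
apply: Ck_ext => // x /set_mem Ux.
by rewrite /partial /= deriveM//; apply: diff_derivable; [exact: df|exact: dg].
Qed.

Lemma smooth_onM n (U : set 'rV[R]_n) f g : open U ->
  smooth_on U f -> smooth_on U g -> smooth_on U (f \* g).
Proof. by move=> oU /CkP sf /CkP sg; apply/CkP => k; exact: Ck_mul. Qed.

Lemma differentiable_row n m (g : 'rV[R]_n -> 'rV[R]_m) x :
  (forall l, differentiable (fun y => g y 0 l) x) -> differentiable g x.
Proof.
move=> dg; rewrite (_ : g = \sum_l (fun y => g y 0 l *: delta_mx 0 l)).
  by apply: differentiable_sum => l; exact: differentiableZl.
by apply/funext => y; rewrite fct_sumE; exact: row_sum_delta.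
Qed.

Lemma derive_row n m (g : 'rV[R]_n -> 'rV[R]_m) x v l :
  differentiable g x -> 'D_v g x 0 l = 'D_v (fun y => g y 0 l) x.
Proof.
move=> dg; rewrite derive_mx ?mxE//.
by apply: diff_derivable.
Qed.

Lemma deriveE_partial n (f : 'rV[R]_n -> R) x v : differentiable f x ->
  'D_v f x = \sum_l v 0 l * partial f l x.
Proof.
move=> df; rewrite deriveE// [v in LHS]row_sum_delta linear_sum /=.
by apply: eq_bigr => l _; rewrite linearZ /partial deriveE.
Qed.

Lemma derive_chain n m p (f : 'rV[R]_m -> 'rV[R]_p) (g : 'rV[R]_n -> 'rV[R]_m)
    x v : differentiable g x -> differentiable f (g x) ->
  'D_v (f \o g) x = 'D_('D_v g x) f (g x).
Proof.
move=> dg df; rewrite deriveE; last exact: differentiable_comp.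
by rewrite diff_comp// [RHS]deriveE// [in RHS]deriveE.
Qed.

Lemma derive_chain1 n m (f : 'rV[R]_m -> R) (g : 'rV[R]_n -> 'rV[R]_m)
    x v : differentiable g x -> differentiable f (g x) ->
  'D_v (f \o g) x = 'D_('D_v g x) f (g x).
Proof.
move=> dg df; rewrite deriveE; last exact: differentiable_comp.
by rewrite diff_comp// [RHS]deriveE// [in RHS]deriveE.
Qed.

Let Ck_comp n m k (U : set 'rV[R]_n) (V : set 'rV[R]_m) f
    (g : 'rV[R]_n -> 'rV[R]_m) : open U -> U `<=` g @^-1` V ->
  Ck k V f -> (forall l, Ck k U (fun y => g y 0 l)) -> Ck k U (f \o g).
Proof.
move=> oU UV; elim: k f => [|k ih] f sf sg.
  apply: Ck0 => x Ux; apply: differentiable_comp.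
    by apply: differentiable_row => l; exact: (Ck_diff (sg l)).
  exact/(Ck_diff sf)/UV.
have dg x : U x -> differentiable g x.
  by move=> Ux; apply: differentiable_row => l; exact: (Ck_diff (sg l)).
apply/CkS; split=> [x Ux|i].
  by apply: differentiable_comp; [exact: dg|exact/(Ck_diff sf)/UV].
have /CkS[df pf] := sf.
suff: Ck k U (fun x => \sum_l (partial (fun y => g y 0 l) i \*
                             (partial f l \o g)) x).
  apply: Ck_ext => // x /set_mem Ux.
  rewrite [RHS]/partial derive_chain1; [|exact: dg|exact/df/UV].
  rewrite deriveE_partial; last exact/df/UV.
  by apply: eq_bigr => l _; rewrite derive_row//; exact: dg.
apply: Ck_sum => // l; apply: Ck_mul => //.
  by have /CkS[_] := sg l.
by apply: ih => // l'; exact/CkW.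
Qed.

Lemma smooth_on_comp n m (U : set 'rV[R]_n) (V : set 'rV[R]_m) f
    (g : 'rV[R]_n -> 'rV[R]_m) : open U -> U `<=` g @^-1` V ->
  smooth_on V f -> (forall l, smooth_on U (fun y => g y 0 l)) ->
  smooth_on U (f \o g).
Proof.
move=> oU UV /CkP sf sg; apply/CkP => k; apply: Ck_comp UV (sf k) _ => // l.
by have /CkP := sg l.
Qed.

Lemma smooth_on_coord n (U : set 'rV[R]_n) l :
  smooth_on U (fun y : 'rV[R]_n => y 0 l).
Proof.
have d x : differentiable (fun y : 'rV[R]_n => y 0 l) x.
  exact: differentiable_coord.
apply/CkP; case=> [|k]; first by apply: Ck0 => x _; exact: d.
apply/CkS; split=> [x _|i]; first exact: d.
rewrite (_ : partial _ i = cst ((delta_mx 0 i : 'rV_n) 0 l)).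
  exact: Ck_cst.
apply/funext => x; rewrite /partial -(@derive_row _ _ id).
  by rewrite derive_id.
by apply: differentiable_row => l'; exact: differentiable_coord.
Qed.

End Calculus.

(* A smooth manifold without boundary (Hausdorff, second countable), given by a
   smooth atlas; [chart_at x] is a preferred chart around [x]. The values of
   [chart i] outside [chart_dom i] and of [chart_inv i] outside its image are
   irrelevant. *)
Record manifold (R : realType) := Manifold {
  mcarrier :> topologicalType;
  mdim : nat;
  chart_index : Type;
  chart_dom : chart_index -> set mcarrier;
  chart : chart_index -> mcarrier -> 'rV[R]_mdim;
  chart_inv : chart_index -> 'rV[R]_mdim -> mcarrier;
  chart_at : mcarrier -> chart_index;
  manifold_hausdorff : hausdorff_space mcarrier;
  manifold_second_countable : @second_countable mcarrier;
  chart_atP : forall x, chart_dom (chart_at x) x;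
  open_chart_dom : forall i, open (chart_dom i);
  open_chart_im : forall i, open (chart i @` chart_dom i);
  chartK : forall i, {in chart_dom i, cancel (chart i) (chart_inv i)};
  chart_continuous : forall i, {in chart_dom i, continuous (chart i)};
  chart_inv_continuous :
    forall i, {in chart i @` chart_dom i, continuous (chart_inv i)};
  chart_compat : forall i j k,
    smooth_on (chart i @` (chart_dom i `&` chart_dom j))
              (fun y => chart j (chart_inv i y) 0 k) }.
Arguments chart_index {R} m.
Arguments chart_dom {R m} i.
Arguments chart {R m} i x.
Arguments chart_inv {R m} i y.
Arguments chart_at {R m} x.
Arguments chart_atP {R m} x.
Arguments open_chart_dom {R m} i.
Arguments open_chart_im {R m} i.
Arguments chartK {R m} i.
Arguments chart_continuous {R m} i.
Arguments chart_inv_continuous {R m} i.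
Arguments chart_compat {R m} i j k.

Section SmoothFunctions.
Context {R : realType}.

Definition chart_im (M : manifold R) (i : chart_index M) (V : set M) :=
  chart i @` (chart_dom i `&` V).

(* Smoothness over the open set [V] of [f], in every chart. *)
Definition smooth_in (M : manifold R) (V : set M) (f : M -> R) : Prop :=
  forall i, smooth_on (chart_im i V) (f \o chart_inv i).

Definition smooth_map (M N : manifold R) (h : M -> N) : Prop :=
  continuous h /\
  forall j k, smooth_in (h @^-1` chart_dom j) (fun x => chart j (h x) 0 k).

Lemma chart_imP (M : manifold R) (i : chart_index M) (V : set M) :
  chart_im i V =
  [set y | (chart i @` chart_dom i) y /\ V (chart_inv i y)].
Proof.
apply/seteqP; split=> [_ [x [ix Vx] <-]|_ [[x ix <-]]] /=.
  by split; [exists x|rewrite chartK ?inE].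
by rewrite chartK ?inE// => Vx; exists x.
Qed.

Lemma open_chart_imV (M : manifold R) (i : chart_index M) (V : set M) :
  open V -> open (chart_im i V).
Proof.
move=> oV; rewrite chart_imP openE => y [iy Vy] /=; rewrite /interior.
apply: (@filterI _ _ _ (chart i @` chart_dom i) (chart_inv i @^-1` V)).
  by apply: open_nbhs_nbhs; split=> //; exact: open_chart_im.
apply: (chart_inv_continuous i _ (mem_set iy)).
exact: open_nbhs_nbhs.
Qed.

Lemma chart_im_sub (M : manifold R) (i : chart_index M) (V W : set M) :
  V `<=` W -> chart_im i V `<=` chart_im i W.
Proof. by move=> VW _ [x [ix Vx] <-]; exists x => //; split=> //; exact: VW. Qed.

Lemma mem_chart_im (M : manifold R) (i : chart_index M) (V : set M) x :
  chart_dom i x -> V x -> chart_im i V (chart i x).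
Proof. by move=> ix Vx; exists x. Qed.

Lemma smooth_inW (M : manifold R) (V W : set M) f :
  V `<=` W -> smooth_in W f -> smooth_in V f.
Proof. by move=> VW h i; apply: smooth_onW (h i); exact: chart_im_sub. Qed.

Lemma smooth_in_ext (M : manifold R) (V : set M) f g : open V ->
  (forall x, V x -> f x = g x) -> smooth_in V f -> smooth_in V g.
Proof.
move=> oV fg h i; apply: smooth_on_ext (h i); first exact: open_chart_imV.
by move=> y /set_mem; rewrite chart_imP => -[_ /fg].
Qed.

Lemma smooth_in_cst (M : manifold R) (V : set M) (c : R) : smooth_in V (cst c).
Proof. by move=> i; exact: smooth_on_cst. Qed.

Lemma smooth_inD (M : manifold R) (V : set M) f g : open V ->
  smooth_in V f -> smooth_in V g -> smooth_in V (f \+ g).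
Proof.
by move=> oV sf sg i; apply: (smooth_onD _ (sf i) (sg i)); exact: open_chart_imV.
Qed.

Lemma smooth_inM (M : manifold R) (V : set M) f g : open V ->
  smooth_in V f -> smooth_in V g -> smooth_in V (f \* g).
Proof.
by move=> oV sf sg i; apply: (smooth_onM _ (sf i) (sg i)); exact: open_chart_imV.
Qed.

Lemma smooth_in_sum (M : manifold R) (V : set M) m (f : 'I_m -> M -> R) :
  open V -> (forall k, smooth_in V (f k)) ->
  smooth_in V (fun x => \sum_k f k x).
Proof.
move=> oV sf i; apply: (smooth_on_sum (f := fun k => f k \o chart_inv i)).
  exact: open_chart_imV.
by move=> k; exact: sf.
Qed.

Lemma smooth_in_local (M : manifold R) (V : set M) f :
  (forall x, V x -> exists2 W, open W /\ W x & smooth_in W f) -> smooth_in V f.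
Proof.
move=> h i; apply: smooth_on_local => _ [x [ix Vx] <-].
have [W [oW Wx] sW] := h _ Vx.
by exists (chart_im i W); [exact: mem_chart_im|exact: sW].
Qed.

Lemma smooth_in_chart (M : manifold R) (V : set M) i f : open V ->
  V `<=` chart_dom i -> smooth_on (chart_im i V) (f \o chart_inv i) ->
  smooth_in V f.
Proof.
move=> oV Vi sf j.
have sc k : smooth_on (chart_im j V) (fun y => chart i (chart_inv j y) 0 k).
  by apply: smooth_onW (chart_compat j i k); exact: chart_im_sub.
have oj : open (chart_im j V) by exact: open_chart_imV.
have ji : chart_im j V `<=` (fun y => chart i (chart_inv j y)) @^-1` chart_im i V.
  by move=> y; rewrite chart_imP => -[_ Vy]; apply: mem_chart_im => //; exact: Vi.
apply: smooth_on_ext (smooth_on_comp oj ji sf sc) => //.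
move=> y /set_mem; rewrite chart_imP => -[_ Vy] /=.
by rewrite chartK// inE; exact: Vi.
Qed.

Lemma smooth_in_comp (M N : manifold R) (h : M -> N) (V : set N) f : open V ->
  smooth_map h -> smooth_in V f -> smooth_in (h @^-1` V) (f \o h).
Proof.
move=> oV [ch sh] sf i; apply: smooth_on_local => _ [x [ix Vx] <-].
pose j := chart_at (h x); pose W := h @^-1` (V `&` chart_dom j).
have oW : open W.
  apply: open_comp; first by move=> ? _; exact: ch.
  by apply: openI => //; exact: open_chart_dom.
have oiW : open (chart_im i W) by exact: open_chart_imV.
exists (chart_im i W).
  by apply: mem_chart_im => //; split=> //; exact: chart_atP.
have sc k : smooth_on (chart_im i W) (fun y => chart j (h (chart_inv i y)) 0 k).
  by apply: smooth_onW (sh j k i); apply: chart_im_sub => ? [].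
have ij : chart_im i W `<=`
    (fun y => chart j (h (chart_inv i y))) @^-1` chart_im j V.
  by move=> y; rewrite chart_imP => -[_ [Vy jy]]; exact: mem_chart_im.
apply: smooth_on_ext (smooth_on_comp oiW ij (sf j) sc) => //.
move=> y /set_mem; rewrite chart_imP => -[_ [Vy jy]] /=.
by rewrite chartK// inE.
Qed.

End SmoothFunctions.

Section SmoothFun.
Context {R : realType} {M : manifold R}.

Definition smooth_pred : {pred M -> R} := mem [set f | smooth_in setT f].

Record smooth_fun := SmoothFun {
  smooth_fun_val :> M -> R; _ : smooth_fun_val \in smooth_pred }.

HB.instance Definition _ := [isSub for smooth_fun_val].
HB.instance Definition _ := [Choice of smooth_fun by <:].

Lemma smooth_funP (f : smooth_fun) : smooth_in setT f.
Proof. by case: f => f /=; rewrite inE. Qed.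

Lemma smooth_subring_closed : subring_closed smooth_pred.
Proof.
have oT := @openT M.
have smM : {in smooth_pred &, forall f g, f * g \in smooth_pred}.
  by move=> f g; rewrite !inE; exact: smooth_inM.
have smC c : cst c \in smooth_pred by rewrite inE; exact: smooth_in_cst.
split=> //; first exact: smC.
move=> f g; rewrite !inE => sf sg.
suff -> : f - g = f + cst (-1) * g.
  by apply: smooth_inD => //; apply: smooth_inM => //; exact: smooth_in_cst.
by apply/funext => x; rewrite !fctE mulN1r.
Qed.

HB.instance Definition _ := GRing.SubChoice_isSubComPzRing.Build
  (M -> R) smooth_pred smooth_fun smooth_subring_closed.

End SmoothFun.
Arguments smooth_fun {R} M.

Section SmoothMaps.
Context {R : realType}.

Record smap (M N : manifold R) := SMap {
  smap_fun :> M -> N; smapP : smooth_map smap_fun }.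

Lemma smooth_map_id (M : manifold R) : smooth_map (@id M).
Proof.
split=> [x //|j k i]; apply: smooth_onW (chart_compat i j k).
exact: chart_im_sub.
Qed.

Definition smap_id (M : manifold R) := SMap (@smooth_map_id M).

Lemma smooth_map_comp (M N P : manifold R) (g : N -> P) (h : M -> N) :
  smooth_map g -> smooth_map h -> smooth_map (g \o h).
Proof.
move=> sg sh; split.
  by move=> x; apply: continuous_comp; [exact: sh.1|exact: sg.1].
move=> j k; apply: (smooth_in_comp _ sh (sg.2 j k)).
by apply: open_comp (open_chart_dom j) => x _; exact: sg.1.
Qed.

Definition smap_comp (M N P : manifold R) (g : smap N P) (h : smap M N) :=
  SMap (smooth_map_comp (smapP g) (smapP h)).

Record diffeo (M N : manifold R) := Diffeo {
  dmap :> smap M N;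
  dinv : smap N M;
  dmapK : cancel dmap dinv;
  dinvK : cancel dinv dmap }.

Definition diffeo_inv (M N : manifold R) (h : diffeo M N) : diffeo N M :=
  Diffeo (@dinvK _ _ h) (@dmapK _ _ h).

Definition diffeo_comp (M N P : manifold R) (g : diffeo N P) (h : diffeo M N) :
    diffeo M P :=
  @Diffeo M P (smap_comp g h) (smap_comp (dinv h) (dinv g))
    (can_comp (@dmapK _ _ g) (@dmapK _ _ h))
    (can_comp (@dinvK _ _ h) (@dinvK _ _ g)).

(* Coordinate expression of [h] in the charts [i] and [j]. *)
Definition chart_rep (M N : manifold R) (h : M -> N) (i : chart_index M)
    (j : chart_index N) : 'rV[R]_(mdim M) -> 'rV[R]_(mdim N) :=
  fun y => chart j (h (chart_inv i y)).

Lemma smooth_chart_rep (M N : manifold R) (h : M -> N) i j k :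
  smooth_map h -> smooth_on (chart_im i (h @^-1` chart_dom j))
    (fun y => chart_rep h i j y 0 k).
Proof. by move=> sh; exact: sh.2. Qed.

Lemma open_smap_preimage (M N : manifold R) (h : M -> N) (V : set N) :
  smooth_map h -> open V -> open (h @^-1` V).
Proof. by move=> sh oV; apply: open_comp oV => x _; exact: sh.1. Qed.

Lemma differentiable_chart_rep (M N : manifold R) (h : M -> N) i j x :
  smooth_map h -> chart_dom i x -> chart_dom j (h x) ->
  differentiable (chart_rep h i j) (chart i x).
Proof.
move=> sh ix jx; apply: differentiable_row => k.
apply: (smooth_on_diff (smooth_chart_rep k sh)).
exact: mem_chart_im.
Qed.

Lemma near_eq_diff n m (f g : 'rV[R]_n -> 'rV[R]_m) x v :
  differentiable f x -> (\forall y \near x, f y = g y) -> 'd f x v = 'd g x v.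
Proof.
move=> df fg; have dg := near_eq_differentiable fg df.
transitivity ('D_v f x); first by rewrite (deriveE v df).
by transitivity ('D_v g x); [exact: near_eq_derive|rewrite (deriveE v dg)].
Qed.

Lemma diff_comp_at n m p (f : 'rV[R]_m -> 'rV[R]_p) (g : 'rV[R]_n -> 'rV[R]_m)
    y z v : differentiable g y -> g y = z -> differentiable f z ->
  'd f z ('d g y v) = 'd (f \o g) y v.
Proof. by move=> dg <- df; exact/esym/(congr1 (fun u => u v) (diff_comp dg df)). Qed.

Lemma near_chart (M : manifold R) (i : chart_index M) (W : set M) x :
  chart_dom i x -> open W -> W x ->
  \forall y \near chart i x, W (chart_inv i y).
Proof.
move=> ix oW Wx.
have : nbhs (chart i x) (chart_im i W).
  by apply: open_nbhs_nbhs; split; [exact: open_chart_imV|exact: mem_chart_im].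
by apply: filterS => y; rewrite chart_imP => -[].
Qed.

Lemma diff_chart_rep_comp (M N P : manifold R) (g : N -> P) (h : M -> N)
    i j k x v : smooth_map g -> smooth_map h ->
  chart_dom i x -> chart_dom j (h x) -> chart_dom k (g (h x)) ->
  'd (chart_rep g j k) (chart j (h x)) ('d (chart_rep h i j) (chart i x) v) =
  'd (chart_rep (g \o h) i k) (chart i x) v.
Proof.
move=> sg sh ix jx kx.
have dh := differentiable_chart_rep sh ix jx.
have E : chart_rep h i j (chart i x) = chart j (h x).
  by rewrite /chart_rep chartK// inE.
have dg := differentiable_chart_rep sg jx kx.
transitivity ('d (chart_rep g j k \o chart_rep h i j) (chart i x) v).
  exact: diff_comp_at.
apply: near_eq_diff; first by apply: differentiable_comp; rewrite ?E.
have := near_chart ix (open_smap_preimage sh (open_chart_dom j)) jx.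
by apply: filterS => y jy; rewrite /chart_rep /= chartK// inE.
Qed.

Lemma diff_chart_rep_id (M : manifold R) (i : chart_index M) x v :
  chart_dom i x -> 'd (chart_rep (@id M) i i) (chart i x) v = v.
Proof.
move=> ix.
have did : differentiable (@id 'rV[R]_(mdim M)) (chart i x).
  by apply: differentiable_row => l; exact: differentiable_coord.
transitivity ('D_v (@id 'rV[R]_(mdim M)) (chart i x)); last exact: derive_id.
rewrite (deriveE v did); apply: near_eq_diff.
  exact: (differentiable_chart_rep (smooth_map_id M) ix ix).
have : nbhs (chart i x) (chart i @` chart_dom i).
  by apply: open_nbhs_nbhs; split; [exact: open_chart_im|exists x].
by apply: filterS => _ [z iz <-]; rewrite /chart_rep chartK// inE.
Qed.

End SmoothMaps.

(* A real vector bundle, given by its fibres together with linear local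
   trivializations whose transition functions are smooth. Values of [triv i x]
   and [triv_inv i x] for [x] outside [triv_dom i] are irrelevant. *)
Record vbundle (R : realType) (B : manifold R) := VBundle {
  vfib :> B -> lmodType R;
  vrank : nat;
  triv_index : Type;
  triv_dom : triv_index -> set B;
  triv : triv_index -> forall x, {linear vfib x -> 'rV[R]_vrank};
  triv_inv : triv_index -> forall x, 'rV[R]_vrank -> vfib x;
  triv_cover : forall x, exists i, triv_dom i x;
  open_triv_dom : forall i, open (triv_dom i);
  trivK : forall i x, triv_dom i x -> cancel (triv i x) (triv_inv i x);
  triv_invK : forall i x, triv_dom i x -> cancel (triv_inv i x) (triv i x);
  triv_compat : forall i j k l,
    smooth_in (triv_dom i `&` triv_dom j)
      (fun x => triv j x (triv_inv i x (delta_mx 0 k)) 0 l) }.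
Arguments vrank {R B} v.
Arguments triv_index {R B} v.
Arguments triv_dom {R B v} i.
Arguments triv {R B v} i x.
Arguments triv_inv {R B v} i x r.
Arguments triv_cover {R B} v x.
Arguments open_triv_dom {R B v} i.
Arguments trivK {R B v} i {x}.
Arguments triv_invK {R B v} i {x}.
Arguments triv_compat {R B v} i j k l.

Section Sections.
Context {R : realType} {B : manifold R}.
Implicit Type F : vbundle B.

Lemma triv_inv_sum F (i : triv_index F) x (r : 'rV[R]_(vrank F)) :
  triv_dom i x ->
  triv_inv i x r = \sum_k r 0 k *: triv_inv i x (delta_mx 0 k).
Proof.
move=> ix; apply: (can_inj (trivK i ix)).
rewrite triv_invK// linear_sum [LHS]row_sum_delta.
by apply: eq_bigr => k _; rewrite linearZ /= triv_invK.
Qed.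

Lemma triv_expand F (i : triv_index F) x (v : F x) :
  triv_dom i x ->
  v = \sum_k triv i x v 0 k *: triv_inv i x (delta_mx 0 k).
Proof. by move=> ix; rewrite -triv_inv_sum// trivK. Qed.

(* Smoothness over the open set [V] of a section of the bundle. *)
Definition smooth_section F (V : set B) (s : forall x, F x) : Prop :=
  forall (i : triv_index F) l,
    smooth_in (V `&` triv_dom i) (fun x => triv i x (s x) 0 l).

Record section F := Section_ {
  section_val :> forall x, F x;
  sectionP : smooth_section setT section_val }.

Arguments sectionP {F} s i l.

Lemma section_ext F (s t : section F) : (forall x, s x = t x) -> s = t.
Proof.
case: s t => [s sP] [t tP] /= st.
have E : s = t by exact: functional_extensionality_dep.
by case: _ / E in tP *; congr Section_; exact: Prop_irrelevance.
Qed.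

HB.instance Definition _ F := gen_eqMixin (section F).
HB.instance Definition _ F := gen_choiceMixin (section F).

Lemma smooth_section0 F V : smooth_section V (fun x => 0 : F x).
Proof.
move=> i l; rewrite (_ : (fun _ => _) = cst 0); first exact: smooth_in_cst.
by apply/funext => x; rewrite linear0 mxE.
Qed.

Lemma smooth_sectionD F V (s t : forall x, F x) : open V ->
  smooth_section V s -> smooth_section V t ->
  smooth_section V (fun x => s x + t x).
Proof.
move=> oV ss st i l; have oVi := openI oV (open_triv_dom i).
apply: smooth_in_ext (smooth_inD oVi (ss i l) (st i l)) => // x _ /=.
by rewrite linearD mxE.
Qed.

Lemma smooth_sectionZ F V (f : B -> R) (s : forall x, F x) : open V ->
  smooth_in V f -> smooth_section V s -> smooth_section V (fun x => f x *: s x).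
Proof.
move=> oV sf ss i l; have oVi := openI oV (open_triv_dom i).
have sfi : smooth_in (V `&` triv_dom i) f by apply: smooth_inW sf => ? [].
apply: smooth_in_ext (smooth_inM oVi sfi (ss i l)) => // x _ /=.
by rewrite linearZ mxE.
Qed.

Definition section0 F : section F := Section_ (@smooth_section0 F setT).
Definition sectionD F (s t : section F) : section F :=
  Section_ (smooth_sectionD openT (sectionP s) (sectionP t)).
Definition sectionZ F (f : smooth_fun B) (s : section F) : section F :=
  Section_ (smooth_sectionZ openT (smooth_funP f) (sectionP s)).
Definition sectionN F (s : section F) : section F := sectionZ (-1) s.

Let sectionDA F : associative (@sectionD F).
Proof. by move=> s t u; apply: section_ext => x; exact: addrA. Qed.
Let sectionDC F : commutative (@sectionD F).
Proof. by move=> s t; apply: section_ext => x; exact: addrC. Qed.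
Let section0D F : left_id (section0 F) (@sectionD F).
Proof. by move=> s; apply: section_ext => x; exact: add0r. Qed.
Let sectionND F : left_inverse (section0 F) (@sectionN F) (@sectionD F).
Proof.
by move=> s; apply: section_ext => x /=; rewrite [X in X *: _](_ : _ = -1)// scaleN1r addNr.
Qed.

HB.instance Definition _ F := GRing.isZmodule.Build (section F)
  (@sectionDA F) (@sectionDC F) (@section0D F) (@sectionND F).

Let sectionZA F (f g : smooth_fun B) (s : section F) :
  sectionZ f (sectionZ g s) = sectionZ (f * g) s.
Proof. by apply: section_ext => x; exact: scalerA. Qed.
Let section1Z F : left_id 1 (@sectionZ F).
Proof. by move=> s; apply: section_ext => x; exact: scale1r. Qed.
Let sectionZDr F : right_distributive (@sectionZ F) +%R.
Proof. by move=> f s t; apply: section_ext => x; exact: scalerDr. Qed.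
Let sectionZDl F (s : section F) : {morph (@sectionZ F)^~ s : f g / f + g}.
Proof. by move=> f g; apply: section_ext => x; exact: scalerDl. Qed.

HB.instance Definition _ F := GRing.Zmodule_isLmodule.Build (smooth_fun B)
  (section F) (@sectionZA F) (@section1Z F) (@sectionZDr F) (@sectionZDl F).

End Sections.
Arguments sectionP {R B F} s i l.

Section PullBack.
Context {R : realType} {M N : manifold R} (h : smap M N) (F : vbundle N).

Let pb_cover x : exists i : triv_index F, (h @^-1` triv_dom i) x.
Proof. exact: triv_cover. Qed.

Let pb_open (i : triv_index F) : open (h @^-1` triv_dom i).
Proof. exact/open_smap_preimage/open_triv_dom/smapP. Qed.

Let pb_compat (i j : triv_index F) k l :
  smooth_in (h @^-1` triv_dom i `&` h @^-1` triv_dom j)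
    (fun x => triv j (h x) (triv_inv i (h x) (delta_mx 0 k)) 0 l).
Proof.
apply: (smooth_in_comp _ (smapP h) (triv_compat i j k l)).
by apply: openI; exact: open_triv_dom.
Qed.

Definition pullback : vbundle M :=
  @VBundle R M (fun x => F (h x)) (vrank F) (triv_index F)
    (fun i => h @^-1` triv_dom i) (fun i x => triv i (h x))
    (fun i x => triv_inv i (h x)) pb_cover pb_open
    (fun i x => @trivK _ _ F i (h x)) (fun i x => @triv_invK _ _ F i (h x))
    pb_compat.

Lemma smooth_pull_section (z : section F) :
  smooth_section (F := pullback) setT (fun x => z (h x)).
Proof.
move=> i l; rewrite setTI; pose i' : triv_index F := i.
have := sectionP z i' l; rewrite setTI => sz.
exact: (smooth_in_comp (open_triv_dom i') (smapP h) sz).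
Qed.

(* [z \o h] *)
Definition pull_section (z : section F) : section pullback :=
  Section_ (smooth_pull_section z).

End PullBack.

Section DualSpace.
Context {R : realType} {V : lmodType R}.

Definition linear_pred : {pred V -> R} := mem [set f : V -> R | linear f].

Record dual_space := DualSpace {
  dual_val :> V -> R; _ : dual_val \in linear_pred }.

HB.instance Definition _ := [isSub for dual_val].
HB.instance Definition _ := [Choice of dual_space by <:].

Lemma dualP (f : dual_space) : linear f.
Proof. by case: f => f /=; rewrite inE. Qed.

Lemma linear_submod_closed : submod_closed linear_pred.
Proof.
split; first by rewrite inE => a u v; change (0 = a * 0 + 0 :> R); rewrite mulr0 addr0.
move=> a f g; rewrite !inE => lf lg b u v.
change (a * f (b *: u + v) + g (b *: u + v) =
        b * (a * f u + g u) + (a * f v + g v)).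
rewrite lf lg -[b *: f u]/(b * f u) -[b *: g u]/(b * g u).
by rewrite !mulrDr addrACA !mulrA (mulrC a).
Qed.

HB.instance Definition _ :=
  GRing.SubChoice_isSubLmodule.Build R (V -> R) linear_pred dual_space
    (GRing.submod_closed_semi linear_submod_closed).

Lemma dual_linear (f : dual_space) m (c : 'I_m -> R) (v : 'I_m -> V) :
  f (\sum_k c k *: v k) = \sum_k c k * f (v k).
Proof.
pose g : {linear V -> R} := HB.pack (f : V -> R)
  (GRing.isLinear.Build _ _ _ _ f (dualP f)).
rewrite -[LHS]/(g _) linear_sum; apply: eq_bigr => k _.
by rewrite linearZ.
Qed.

End DualSpace.
Arguments dual_space {R} V.

Section DualBundle.
Context {R : realType} {B : manifold R} (F : vbundle B).

Definition dual_triv_fun (i : triv_index F) x (f : dual_space (F x)) :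
  'rV[R]_(vrank F) := \row_k f (triv_inv i x (delta_mx 0 k)).
Arguments dual_triv_fun : clear implicits.

Let dual_triv_linear i x : linear (dual_triv_fun i x).
Proof. by move=> a f g; apply/rowP => k; rewrite !mxE. Qed.

HB.instance Definition _ i x :=
  GRing.isLinear.Build R (dual_space (F x)) 'rV[R]_(vrank F) _ (dual_triv_fun i x)
    (@dual_triv_linear i x).

Let dual_triv_inv_linear (i : triv_index F) x (r : 'rV[R]_(vrank F)) :
  (fun v : F x => \sum_k r 0 k * triv i x v 0 k) \in linear_pred.
Proof.
rewrite inE => a u v; rewrite /GRing.scale /= mulr_sumr -big_split /=.
apply: eq_bigr => k _.
by rewrite linearP !mxE mulrDr !mulrA (mulrC a).
Qed.

Definition dual_triv_inv (i : triv_index F) x (r : 'rV[R]_(vrank F)) :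
  dual_space (F x) := DualSpace (@dual_triv_inv_linear i x r).
Arguments dual_triv_inv : clear implicits.

Let dual_trivK i x : triv_dom i x ->
  cancel (dual_triv_fun i x) (dual_triv_inv i x).
Proof.
move=> ix f; apply: val_inj; apply/funext => v /=.
rewrite [in RHS](triv_expand v ix) dual_linear; apply: eq_bigr => k _.
by rewrite mxE mulrC.
Qed.

Lemma dual_triv_invE (i : triv_index F) x r k : triv_dom i x ->
  dual_triv_inv i x r (triv_inv i x (delta_mx 0 k)) = r 0 k.
Proof.
move=> ix /=; rewrite triv_invK// (bigD1 k)//= mxE !eqxx mulr1.
rewrite big1 ?addr0// => l lk.
by rewrite mxE eqxx (negbTE lk) mulr0.
Qed.

Let dual_triv_invK i x : triv_dom i x ->
  cancel (dual_triv_inv i x) (dual_triv_fun i x).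
Proof. by move=> ix r; apply/rowP => k; rewrite mxE dual_triv_invE. Qed.

Let dual_compat (i j : triv_index F) k l :
  smooth_in (triv_dom i `&` triv_dom j)
    (fun x => dual_triv_fun j x (dual_triv_inv i x (delta_mx 0 k)) 0 l).
Proof.
have oij := openI (open_triv_dom i) (open_triv_dom j).
have := triv_compat j i l k; rewrite setIC; apply: smooth_in_ext => // x _.
rewrite mxE /= (bigD1 k)//= mxE !eqxx mul1r big1 ?addr0// => m mk.
by rewrite mxE eqxx (negbTE mk) mul0r.
Qed.

Definition dual_bundle : vbundle B :=
  @VBundle R B (fun x => dual_space (F x)) (vrank F) (triv_index F) (@triv_dom _ _ F)
    (fun i x => dual_triv_fun i x) dual_triv_inv (triv_cover F)
    open_triv_dom dual_trivK dual_triv_invK dual_compat.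

End DualBundle.

(* A tangent vector at [x] is represented by its coordinates in the preferred
   chart [chart_at x]; the trivialization over another chart is the
   differential of the change of coordinates. *)
Section TangentBundle.
Context {R : realType} (M : manifold R).

Let tfib (x : M) : lmodType R := 'rV[R]_(mdim M).

Definition tangent_triv (i : chart_index M) (x : M) :
    {linear tfib x -> 'rV[R]_(mdim M)} :=
  'd (chart_rep (@id M) (chart_at x) i) (chart (chart_at x) x).

Definition tangent_triv_inv (i : chart_index M) (x : M) (r : 'rV[R]_(mdim M)) :
    tfib x :=
  'd (chart_rep (@id M) i (chart_at x)) (chart i x) r.

Let tangent_cover x : exists i : chart_index M, chart_dom i x.
Proof. by exists (chart_at x); exact: chart_atP. Qed.

Let tangent_trivK i x : chart_dom i x ->
  cancel (tangent_triv i x) (tangent_triv_inv i x).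
Proof.
move=> ix v; have sid := smooth_map_id M; have cx := chart_atP x.
transitivity
  ('d (chart_rep (@id M) (chart_at x) (chart_at x)) (chart (chart_at x) x) v).
  exact: (diff_chart_rep_comp v sid sid cx ix cx).
exact: diff_chart_rep_id.
Qed.

Let tangent_triv_invK i x : chart_dom i x ->
  cancel (tangent_triv_inv i x) (tangent_triv i x).
Proof.
move=> ix v; have sid := smooth_map_id M; have cx := chart_atP x.
transitivity ('d (chart_rep (@id M) i i) (chart i x) v).
  exact: (diff_chart_rep_comp v sid sid ix cx ix).
exact: diff_chart_rep_id.
Qed.

Lemma diff_partial m (f : 'rV[R]_m -> 'rV[R]_(mdim M)) y k l :
  differentiable f y ->
  'd f y (delta_mx 0 k) 0 l = partial (fun z => f z 0 l) k y.
Proof.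
move=> df; transitivity ('D_(delta_mx 0 k) f y 0 l).
  by rewrite (deriveE (delta_mx 0 k) df).
exact: derive_row.
Qed.

Let tangent_compat i j k l :
  smooth_in (chart_dom i `&` chart_dom j)
    (fun x => tangent_triv j x (tangent_triv_inv i x (delta_mx 0 k)) 0 l).
Proof.
have oij := openI (open_chart_dom i) (open_chart_dom j).
have sid := smooth_map_id M.
apply: (@smooth_in_chart _ _ _ i) => //.
have := smooth_on_partial k (chart_compat i j l).
rewrite -/(chart_im i (chart_dom j)) => sp.
have {}sp := smooth_onW (@chart_im_sub _ _ i _ _ (@subIsetr _ (chart_dom i) _)) sp.
apply: smooth_on_ext sp; first exact: open_chart_imV.
move=> _ /set_mem [x [_ [ix jx]] <-] /=.
rewrite chartK ?inE//.
transitivity ('d (chart_rep (@id M) i j) (chart i x) (delta_mx 0 k) 0 l).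
  rewrite diff_partial//.
  exact: (differentiable_chart_rep sid ix jx).
congr (fun_of_matrix _ 0 l); apply/esym.
exact: (diff_chart_rep_comp (delta_mx 0 k) sid sid ix (chart_atP x) jx).
Qed.

Definition tangent : vbundle M :=
  VBundle tangent_cover (@open_chart_dom R M) tangent_trivK tangent_triv_invK
    tangent_compat.

End TangentBundle.

Section VbMorphisms.
Context {R : realType}.

(* A morphism of vector bundles covering [p]: fibrewise linear, with smooth
   matrix entries in local trivializations. *)
Record vbmor (B B' : manifold R) (F : vbundle B) (F' : vbundle B')
    (p : smap B B') := Vbmor {
  vbmor_fun :> forall x, {linear F x -> F' (p x)};
  vbmorP : forall (i : triv_index F) (j : triv_index F') k l,
    smooth_in (triv_dom i `&` p @^-1` triv_dom j)
      (fun x => triv j (p x) (vbmor_fun x (triv_inv i x (delta_mx 0 k))) 0 l) }.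
Arguments vbmorP {B B' F F' p} _ i j k l.

(* Smoothness of the coordinates of [phi \o u]. *)
Lemma smooth_vbmor_section (B B' : manifold R) (F : vbundle B)
    (F' : vbundle B') (p : smap B B') (phi : vbmor F F' p) (V : set B)
    (u : forall x, F x) (j : triv_index F') l : open V ->
  smooth_section V u ->
  smooth_in (V `&` p @^-1` triv_dom j) (fun x => triv j (p x) (phi x (u x)) 0 l).
Proof.
move=> oV su; apply: smooth_in_local => x [Vx jx].
have [i ix] := triv_cover F x.
pose W := (V `&` triv_dom i) `&` (p @^-1` triv_dom j).
have oW : open W.
  apply: openI; first by apply: openI => //; exact: open_triv_dom.
  exact/open_smap_preimage/open_triv_dom/smapP.
exists W; first by split.
have sW : smooth_in W (fun x => \sum_k (triv i x (u x) 0 k *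
    triv j (p x) (phi x (triv_inv i x (delta_mx 0 k))) 0 l)).
  apply: smooth_in_sum => // k; apply: smooth_inM => //.
    by apply: smooth_inW (su i k) => ? [].
  by apply: smooth_inW (vbmorP phi i j k l) => ? [[]].
apply: smooth_in_ext sW => // y [[_ iy] _].
rewrite [in RHS](triv_expand (u y) iy) !linear_sum summxE.
by apply: eq_bigr => k _; rewrite !linearZ !mxE.
Qed.

Section Comp.
Context {B B' B'' : manifold R} {F : vbundle B} {F' : vbundle B'}
  {F'' : vbundle B''} {q : smap B' B''} {p : smap B B'}.
Variables (psi : vbmor F' F'' q) (phi : vbmor F F' p).

Let comp_fun x : {linear F x -> F'' (smap_comp q p x)} := psi (p x) \o phi x.

Let comp_smooth i j k l :
  smooth_in (triv_dom i `&` smap_comp q p @^-1` triv_dom j)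
    (fun x => triv j (smap_comp q p x)
                (comp_fun x (triv_inv i x (delta_mx 0 k))) 0 l).
Proof.
apply: smooth_in_local => x [ix jx].
have [m mx] := triv_cover F' (p x).
pose W := (triv_dom i `&` p @^-1` triv_dom m)
  `&` (p @^-1` (triv_dom m `&` q @^-1` triv_dom j)).
have omj : open (triv_dom m `&` q @^-1` triv_dom j).
  apply: openI; first exact: open_triv_dom.
  exact/open_smap_preimage/open_triv_dom/smapP.
have oW : open W.
  apply: openI; last exact/open_smap_preimage/omj/smapP.
  apply: openI; first exact: open_triv_dom.
  exact/open_smap_preimage/open_triv_dom/smapP.
exists W; first by split.
have sW : smooth_in W (fun x => \sum_n
    (triv m (p x) (phi x (triv_inv i x (delta_mx 0 k))) 0 n *
     triv j (q (p x)) (psi (p x) (triv_inv m (p x) (delta_mx 0 n))) 0 l)).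
  apply: smooth_in_sum => // n; apply: smooth_inM => //.
    by apply: smooth_inW (vbmorP phi i m k n) => ? [].
  have := smooth_in_comp omj (smapP p) (vbmorP psi m j n l).
  by apply: smooth_inW => ? [].
apply: smooth_in_ext sW => // y [[iy my] _] /=.
rewrite [in RHS](triv_expand (phi y (triv_inv i y (delta_mx 0 k))) my).
rewrite !linear_sum summxE.
by apply: eq_bigr => n _; rewrite !linearZ !mxE.
Qed.

Definition vbmor_comp : vbmor F F'' (smap_comp q p) := Vbmor comp_smooth.

End Comp.

(* [Gamma(phi, p) u = phi \o u \o p^-1]; the cast identifies the fibres at
   [p (p^-1 y)] and at [y]. *)
Section Push.
Context {B B' : manifold R} {F : vbundle B} {F' : vbundle B'}
  {p : diffeo B B'} (phi : vbmor F F' p).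

Definition push_fun (u : forall x, F x) (y : B') : F' y :=
  ecast z (F' z) (dinvK p y) (phi (dinv p y) (u (dinv p y))).

Let triv_cast (j : triv_index F') x y (e : x = y) (v : F' x) :
  triv j y (ecast z (F' z) e v) = triv j x v.
Proof. by case: _ / e. Qed.

Let push_smooth (u : section F) : smooth_section setT (push_fun u).
Proof.
move=> j l; rewrite setTI.
have := @smooth_vbmor_section _ _ _ _ p phi setT u j l openT (sectionP u); rewrite setTI.
have oj := open_smap_preimage (smapP p) (open_triv_dom j).
move=> /(smooth_in_comp oj (smapP (dinv p))).
rewrite (_ : _ @^-1` _ = triv_dom j).
  apply: smooth_in_ext; first exact: open_triv_dom.
  by move=> y _; rewrite /push_fun triv_cast.
by apply/seteqP; split=> y /=; rewrite dinvK.
Qed.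

Definition push (u : section F) : section F' := Section_ (push_smooth u).

Lemma pushE (u : section F) x : push u (p x) = phi x (u x).
Proof.
rewrite /= /push_fun; move: (dinvK p (p x)); rewrite dmapK => e.
by rewrite (Prop_irrelevance e erefl).
Qed.

End Push.

End VbMorphisms.
Arguments vbmorP {R B B' F F' p} _ i j k l.

Section TangentMap.
Context {R : realType} {M N : manifold R} (h : smap M N).

Definition tmap_fun (x : M) : {linear tangent M x -> tangent N (h x)} :=
  'd (chart_rep h (chart_at x) (chart_at (h x))) (chart (chart_at x) x).

Let tmap_smooth (i : triv_index (tangent M)) (j : triv_index (tangent N)) k l :
  smooth_in (triv_dom i `&` h @^-1` triv_dom j)
    (fun x => triv j (h x) (tmap_fun x (triv_inv i x (delta_mx 0 k))) 0 l).
Proof.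
move: i j k l; rewrite /= => i j k l.
have sh := smapP h.
have oij := openI (open_chart_dom i) (open_smap_preimage sh (open_chart_dom j)).
apply: (@smooth_in_chart _ _ _ i) => //.
have sp := smooth_on_partial k (sh.2 j l i).
have {}sp := smooth_onW (@chart_im_sub _ _ i _ _ (@subIsetr _ (chart_dom i) _)) sp.
apply: smooth_on_ext sp; first exact: open_chart_imV.
move=> _ /set_mem [x [_ [ix jx]] <-] /=.
rewrite chartK ?inE//.
transitivity ('d (chart_rep h i j) (chart i x) (delta_mx 0 k) 0 l).
  rewrite diff_partial//.
  exact: (differentiable_chart_rep sh ix jx).
congr (fun_of_matrix _ 0 l); apply/esym.
have cx := chart_atP x; have chx := chart_atP (h x).
transitivity ('d (chart_rep h (chart_at x) j) (chart (chart_at x) x)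
   ('d (chart_rep (@id M) i (chart_at x)) (chart i x) (delta_mx 0 k))).
  exact: (diff_chart_rep_comp _ (smooth_map_id N) sh cx chx jx).
exact: (diff_chart_rep_comp _ sh (smooth_map_id M) ix cx jx).
Qed.

Definition tmap : vbmor (tangent M) (tangent N) h := Vbmor tmap_smooth.

End TangentMap.

Section VectorFields.
Context {R : realType} {M : manifold R}.

Definition smooth_cst (c : R) : smooth_fun M :=
  SmoothFun (mem_set (@smooth_in_cst R M setT c)).

(* [X f], the derivative of [f] along the vector field [X]. *)
Definition vf_act_fun (X : section (tangent M)) (f : smooth_fun M) (x : M) : R :=
  'D_(X x) (f \o chart_inv (chart_at x)) (chart (chart_at x) x).

Let vf_act_chart X (f : smooth_fun M) (i : chart_index M) x : chart_dom i x ->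
  vf_act_fun X f x = \sum_l (triv (v := tangent M) i x (X x) 0 l *
    partial (f \o chart_inv i) l (chart i x)).
Proof.
move=> ix; have sid := smooth_map_id M; have cx := chart_atP x.
have df : differentiable (f \o chart_inv i) (chart i x).
  have sf : smooth_in setT f := smooth_funP f.
  exact: (smooth_on_diff (sf i) (mem_chart_im ix I)).
have dr := differentiable_chart_rep sid cx ix.
have E : chart_rep (@id M) (chart_at x) i (chart (chart_at x) x) = chart i x.
  by rewrite /chart_rep chartK// inE.
transitivity ('D_(X x) ((f \o chart_inv i) \o chart_rep (@id M) (chart_at x) i)
                (chart (chart_at x) x)).
  apply: near_eq_derive.
  have := near_chart cx (open_chart_dom i) ix.
  by apply: filterS => y iy; rewrite /chart_rep /= chartK// inE.
rewrite derive_chain1//; last by rewrite E.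
rewrite E deriveE_partial//; apply: eq_bigr => l _; congr (_ * _).
by rewrite (deriveE (X x) dr).
Qed.

Let vf_act_smooth X (f : smooth_fun M) : vf_act_fun X f \in smooth_pred.
Proof.
rewrite inE; apply: smooth_in_local => x _; pose i := chart_at x.
have oi := open_chart_dom i.
exists (chart_dom i); first by split=> //; exact: chart_atP.
have sX l := sectionP X i l.
suff : smooth_in (chart_dom i) (fun x =>
    \sum_l (triv (v := tangent M) i x (X x) 0 l *
            partial (f \o chart_inv i) l (chart i x))).
  by apply: smooth_in_ext => // y iy; rewrite -vf_act_chart.
apply: smooth_in_sum => // l; apply: smooth_inM => //.
  by have := sX l; rewrite setTI.
apply: (@smooth_in_chart _ _ _ i) => //.
have sf : smooth_in setT f := smooth_funP f.
have := smooth_on_partial l (sf i).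
move=> /(smooth_onW (@chart_im_sub _ _ i (chart_dom i) setT (@subsetT _ _))).
apply: smooth_on_ext; first exact: open_chart_imV.
by move=> _ /set_mem [y [iy _] <-] /=; rewrite chartK// inE.
Qed.

Definition vf_act X f : smooth_fun M := SmoothFun (vf_act_smooth X f).

(* [Z] is the Lie bracket [X, Y]; a vector field is determined by its action
   on smooth functions. *)
Definition is_vf_bracket (X Y Z : section (tangent M)) : Prop :=
  forall f, vf_act Z f = vf_act X (vf_act Y f) - vf_act Y (vf_act X f).

End VectorFields.

Section PullBackMorphism.
Context {R : realType} {M N : manifold R} (h : diffeo M N) (F : vbundle N).

Let pb_id (x : M) : {linear pullback h F x -> F (h x)} := idfun.

Let pb_id_smooth (i : triv_index (pullback h F)) (j : triv_index F) k l :
  smooth_in (triv_dom i `&` h @^-1` triv_dom j)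
    (fun x => triv j (h x) (pb_id x (triv_inv i x (delta_mx 0 k))) 0 l).
Proof. exact: (@triv_compat _ _ (pullback h F) i j k l). Qed.

Definition pullback_mor : vbmor (pullback h F) F h := Vbmor pb_id_smooth.

(* The section [z] of [F] with [Z = z \o h]. *)
Definition unpull_section (Z : section (pullback h F)) : section F :=
  push pullback_mor Z.

Lemma pull_sectionK : cancel (@pull_section _ _ _ h F) unpull_section.
Proof.
move=> z; apply: section_ext => y; rewrite -(dinvK h y).
exact: pushE.
Qed.

Lemma unpull_sectionK : cancel unpull_section (@pull_section _ _ _ h F).
Proof. by move=> Z; apply: section_ext => x; exact: pushE. Qed.

End PullBackMorphism.

Section GeneralizedLieAlgebroid.
Context {R : realType}.

(* [Gamma(Th \o rho, h \o eta) : Gamma(F) -> Gamma(TN)] *)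
Definition anchor_field (M N : manifold R) (h : diffeo M N) (eta : diffeo N M)
    (F : vbundle N) (rho : vbmor F (tangent M) eta) (u : section F) :
    section (tangent N) :=
  push (p := diffeo_comp h eta) (vbmor_comp (tmap h) rho) u.

Record gen_lie_algebroid (M N : manifold R) := GenLieAlgebroid {
  gla_h : diffeo M N;
  gla_eta : diffeo N M;
  gla_bundle : vbundle N;
  gla_rho : vbmor gla_bundle (tangent M) gla_eta;
  gla_bracket : section gla_bundle -> section gla_bundle -> section gla_bundle;
  gla_bracket_linearl : forall (c : R) u v w,
    gla_bracket (smooth_cst c *: u + v) w =
    smooth_cst c *: gla_bracket u w + gla_bracket v w;
  gla_bracket_linearr : forall (c : R) u v w,
    gla_bracket u (smooth_cst c *: v + w) =
    smooth_cst c *: gla_bracket u v + gla_bracket u w;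
  gla_bracketxx : forall u, gla_bracket u u = 0;
  gla_jacobi : forall u v w,
    gla_bracket u (gla_bracket v w) + gla_bracket v (gla_bracket w u)
      + gla_bracket w (gla_bracket u v) = 0;
  gla_leibniz : forall u (f : smooth_fun N) v,
    gla_bracket u (f *: v) =
    f *: gla_bracket u v + vf_act (anchor_field gla_h gla_rho u) f *: v;
  gla_anchor_bracket : forall u v,
    is_vf_bracket (anchor_field gla_h gla_rho u) (anchor_field gla_h gla_rho v)
      (anchor_field gla_h gla_rho (gla_bracket u v)) }.

Context {M N : manifold R} (A : gen_lie_algebroid M N).

(* [h^*F] *)
Definition pb_bundle : vbundle M := pullback (gla_h A) (gla_bundle A).

Definition pb_bracket (Z W : section pb_bundle) : section pb_bundle :=
  pull_section (gla_h A)
    (gla_bracket (unpull_section Z) (unpull_section W)).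

Lemma pb_bracketE z w :
  pb_bracket (pull_section (gla_h A) z) (pull_section (gla_h A) w) =
  pull_section (gla_h A) (gla_bracket z w).
Proof. by rewrite /pb_bracket !pull_sectionK. Qed.

(* The vector field on [M] that is [h]-related to
   [Gamma(Th \o rho, h \o eta) z], where [Z = z \o h]; see [pb_anchorP]. *)
Definition pb_anchor (Z : section pb_bundle) : section (tangent M) :=
  push (p := diffeo_inv (gla_h A)) (tmap (dinv (gla_h A)))
    (anchor_field (gla_h A) (gla_rho A) (unpull_section Z)).

Lemma pb_anchorP Z x :
  tmap (gla_h A) x (pb_anchor Z x) =
  anchor_field (gla_h A) (gla_rho A) (unpull_section Z) (gla_h A x).
Proof.
have sh := smapP (gla_h A); have shi := smapP (dinv (gla_h A)).
set v := anchor_field _ _ _; move: (gla_h A x) (dmapK (gla_h A) x) => y <-.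
rewrite (pushE (p := diffeo_inv (gla_h A))).
have cy : chart_dom (chart_at (gla_h A (dinv (gla_h A) y))) y.
  by rewrite dinvK; exact: chart_atP.
transitivity ('d (chart_rep (gla_h A \o dinv (gla_h A)) (chart_at y)
    (chart_at (gla_h A (dinv (gla_h A) y)))) (chart (chart_at y) y) (v y)).
  apply: (diff_chart_rep_comp _ sh shi (chart_atP y) (chart_atP _)).
  exact: chart_atP.
have -> : gla_h A \o dinv (gla_h A) = id.
  by apply/funext => z /=; rewrite dinvK.
rewrite dinvK; exact/diff_chart_rep_id/chart_atP.
Qed.

End GeneralizedLieAlgebroid.

Section ExteriorAlgebra.
Context {R : realType} {B : manifold R} (V : vbundle B).

(* Arbitrary maps [Gamma(V)^q -> F(B)]; [is_form] singles out [Lambda^q]. In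
   degree 0 there is only one argument ['I_0 -> section V], so that
   [Lambda^0 = F(B)]. *)
Definition premap (q : nat) := ('I_q -> section V) -> smooth_fun B.

Definition is_form q (w : premap q) : Prop :=
  (forall (z : 'I_q -> section V) i (f : smooth_fun B) (s t : section V),
     w [eta z with i |-> f *: s + t] =
     f * w [eta z with i |-> s] + w [eta z with i |-> t]) /\
  (forall (z : 'I_q -> section V) i j, i != j -> z i = z j -> w z = 0).

(* The wedge product of homogeneous elements, its degree [n] being given up to
   the equation [q + r = n]. *)
Definition wedge_hom q r n (e : (q + r)%N = n) (w : premap q) (t : premap r) :
    premap n := fun z =>
  smooth_cst (q`! * r`!)%N%:R^-1 *
  \sum_(s : 'S_n) (-1) ^+ s *
    w (fun i => z (s (cast_ord e (lshift r i)))) *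
    t (fun j => z (s (cast_ord e (rshift q j)))).

(* Elements of the direct sum are the families of forms [w q], [q : nat], with
   finitely many nonzero members. *)
Definition graded := forall q, premap q.

Definition Lambda : set graded :=
  [set w | (forall q, is_form (w q)) /\
           exists m, forall q, (m <= q)%N -> w q = fun=> 0].

Definition homogeneous (k : nat) (w : graded) : Prop :=
  forall q, q <> k -> w q = fun=> 0.

Definition ext0 : graded := fun q z => 0.
Definition ext_add (w t : graded) : graded := fun q z => w q z + t q z.
Definition ext_scale (f : smooth_fun B) (w : graded) : graded :=
  fun q z => f * w q z.
Definition wedge (w t : graded) : graded := fun n z =>
  \sum_(q < n.+1)
    wedge_hom (subnKC (ltn_ord q : (q <= n)%N)) (w q) (t (n - q)%N) z.

Definition is_ideal (I : set graded) : Prop :=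
  [/\ I `<=` Lambda, I ext0,
      forall w t, I w -> I t -> I (ext_add w t),
      forall f w, I w -> I (ext_scale f w) &
      forall w t, I w -> Lambda t -> I (wedge w t) /\ I (wedge t w)].

Definition ideal_gen (S : set graded) : set graded :=
  [set w | forall I, is_ideal I -> S `<=` I -> I w].

Lemma pairing_subproof (Om : section (dual_bundle V)) (S : section V) :
  (fun x => Om x (S x)) \in smooth_pred.
Proof.
rewrite inE; apply: smooth_in_local => x _; have [i ix] := triv_cover V x.
have oi := open_triv_dom i; exists (triv_dom i) => //.
have sE : smooth_in (triv_dom i) (fun y => \sum_k
    (triv i y (S y) 0 k * triv (v := dual_bundle V) i y (Om y) 0 k)).
  apply: smooth_in_sum => // k; apply: smooth_inM => //.
    by have := sectionP S i k; rewrite setTI.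
  by have := @sectionP _ _ _ Om i k; rewrite setTI.
apply: smooth_in_ext sE => // y iy.
rewrite [in RHS](triv_expand (S y) iy) dual_linear.
by apply: eq_bigr => k _; rewrite mxE.
Qed.

Definition pairing (Om : section (dual_bundle V)) (S : section V) :
  smooth_fun B := SmoothFun (pairing_subproof Om S).

(* A section of the dual bundle, as an element of degree 1. *)
Definition one_form (Om : section (dual_bundle V)) : graded := fun q =>
  match q with
  | 1%N => fun z => pairing Om (z ord0)
  | _ => fun=> 0
  end.

(* A field of subspaces [sub_fib x] with a smooth local frame around every
   point. *)
Record subbundle := Subbundle {
  sub_fib : forall x, set (V x);
  sub_rank : nat;
  sub_frame : forall x0, exists (U : set B) (s : 'I_sub_rank -> forall x, V x),
    [/\ open U, U x0, (forall k, smooth_section U (s k)) &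
        forall x, U x ->
          injective (fun c : 'rV[R]_sub_rank => \sum_k c 0 k *: s k x) /\
          @sub_fib x = range (fun c : 'rV[R]_sub_rank => \sum_k c 0 k *: s k x)]
}.

Arguments sub_fib : clear implicits.

Definition sub_section (E : subbundle) : set (section V) :=
  [set s | forall x, sub_fib E x (s x)].

Definition annihilator (E : subbundle) : set (section (dual_bundle V)) :=
  [set Om | forall S, sub_section E S -> pairing Om S = 0].

End ExteriorAlgebra.
Arguments Lambda {R B V}.
Arguments one_form {R B V} Om q _.
Arguments sub_fib {R B V} s x _.

Section ExteriorDifferentialSystems.
Context {R : realType} {M N : manifold R} (A : gen_lie_algebroid M N).

Local Notation V := (pb_bundle A).

(* In the second sum, [bump j (bump i m)], [m = 0, 1, ...], enumerates the
   indices different from [i] and [j]. *)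
Definition diff_hom q (w : premap V q) : premap V q.+1 := fun z =>
  \sum_(i < q.+1)
    (-1) ^+ i * vf_act (pb_anchor (z i)) (w (fun k => z (lift i k))) +
  \sum_(i < q.+1) \sum_(j < q.+1 | (i < j)%N)
    (-1) ^+ (i + j) *
    w (fun k : 'I_q => if k == 0%N :> nat then pb_bracket (z i) (z j)
                       else z (inord (bump j (bump i k.-1)))).

Definition ext_diff (w : graded V) : graded V := fun q =>
  match q with
  | 0%N => fun=> 0
  | q'.+1 => diff_hom (w q')
  end.

Definition differential_ideal (I : set (graded V)) : Prop :=
  is_ideal I /\ forall w, I w -> I (ext_diff w).

Definition interior_differential_system := subbundle V.

Definition ids_involutive (E : interior_differential_system) : Prop :=
  forall S T, sub_section E S -> sub_section E T ->
    sub_section E (pb_bracket S T).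

Definition exterior_differential_system (I : set (graded V)) : Prop :=
  differential_ideal I /\
  exists E : interior_differential_system,
    forall k w, (1 <= k)%N -> I w -> homogeneous k w ->
      forall u : 'I_k -> section V, (forall i, sub_section E (u i)) -> w k u = 0.

Definition annihilator_ideal (E : interior_differential_system) :
    set (graded V) :=
  ideal_gen [set one_form Om | Om in annihilator E].

End ExteriorDifferentialSystems.
Arguments ids_involutive {R M N} A E.
Arguments differential_ideal {R M N} A I.
Arguments exterior_differential_system {R M N} A I.
Arguments annihilator_ideal {R M N} A E.

(* Main.v *)
(* Let J be the ideal of the forms, of all degrees, which vanish on sections of
   E. Everything rests on the fact that Gamma(h^*F)/Gamma(E) is a finitely
   generated projective module: there are finitely many sigma_j annihilating E
   and sections w_j such that a - sum_j sigma_j(a) w_j is in Gamma(E) for every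
   section a.

   Given this, J is the ideal generated by the annihilator: if w vanishes as
   soon as at most k arguments are transverse to E, then the sum of the
   sigma_j /\ i_(w_j) w agrees with (k + 1) w on k + 1 transverse arguments, and
   one subtracts. When E is involutive the formula for d shows d J <= J.
   Conversely d Omega (S, T) = - Omega [S, T] for Omega in the annihilator and S,
   T in Gamma(E), so d J <= J makes every sigma_j vanish on [S, T].

   To find the sigma_j one glues local defining forms of E with a locally finite
   family of bump functions into a sequence T_m of covector fields with common
   kernel E, and takes n + r + 1 combinations sum_m a_m T_m with generic
   coefficients a_m, where n is the dimension and r the rank: the a_m must avoid
   the values of smooth maps defined on open sets of R^(n + r), which by Baire's
   theorem do not cover R^(n + r + 1). The w_j are obtained locally from a Gram
   matrix, and globally by a partition of unity. *)
From HB Require Import structures.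
From mathcomp Require Import all_boot all_order all_algebra all_fingroup.
From mathcomp Require Import all_classical all_reals.
From mathcomp Require Import interval_inference topology normedtype sequences landau.
From mathcomp Require Import derive realfun exp.
From mathcomp Require Import zify ring lra.
Require Import Defs.

Set Implicit Arguments.
Unset Strict Implicit.
Unset Printing Implicit Defensive.

Import Order.TTheory GRing.Theory Num.Theory.
Import numFieldNormedType.Exports.

Local Open Scope classical_set_scope.
Local Open Scope ring_scope.

(** * Smooth functions: composition, inverse, a flat function *)

Section SmoothClosure.
Context {R : realType} {n : nat}.
Implicit Types (U : set 'rV[R]_n) (f g : 'rV[R]_n -> R).

(** Iterated partial derivatives never leave [C]. This serves when the derivatives of a function
    involve other functions of the same kind. *)
Lemma smooth_on_class U (C : set ('rV[R]_n -> R)) :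
  (forall f, C f -> forall x, U x -> differentiable f x) ->
  (forall f i, C f -> C (partial f i)) ->
  forall f, C f -> smooth_on U f.
Proof.
move=> dC pC f Cf x Ux s; elim: s f Cf => [|i s ih] f Cf /=; first exact: dC Cf _ Ux.
by apply: ih; exact: pC.
Qed.

Lemma differentiable_real_comp (phi : R -> R) f x d :
  is_derive (f x) 1 phi d -> differentiable f x -> differentiable (phi \o f) x.
Proof.
move=> [dphi _] df; apply: differentiable_comp => //.
exact/derivable1_diffP.
Qed.

Lemma partial_real_comp (phi : R -> R) f x d i :
  is_derive (f x) 1 phi d -> differentiable f x ->
  partial (phi \o f) i x = d * partial f i x.
Proof.
move=> dd df; have dp := dd; case: dp => dphi dE.
rewrite /partial deriveE; last exact: differentiable_real_comp dd df.
rewrite diff_comp//; last exact/derivable1_diffP.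
rewrite /=; transitivity ('d phi (f x) ('D_(delta_mx 0 i) f x *: (1 : R))).
  by rewrite [in RHS]deriveE// /GRing.scale /= mulr1.
rewrite linearZ /= -deriveE; last exact/derivable1_diffP.
by rewrite dE mulrC.
Qed.

Section Comp.
Variables (phi : nat -> R -> R) (a b : nat -> R) (D : set R).
Hypothesis dphi : forall k t, D t ->
  is_derive t 1 (phi k) (a k * phi k.+1 t + b k * phi k.+2 t).

(** Combinations of the [phi k \o f] with smooth coefficients, taken up to equality on [U] because
    the chain and product rules are available only there. *)
Inductive comp_class U f : set ('rV[R]_n -> R) :=
| CompMul k g : smooth_on U g -> comp_class U f (fun x => phi k (f x) * g x)
| CompAdd g h : comp_class U f g -> comp_class U f h -> comp_class U f (g \+ h)
| CompExt g h : {in U, g =1 h} -> comp_class U f g -> comp_class U f h.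

(** By [dphi] and the product rule, [comp_class] is stable under partial derivatives. A derivative
    involving the next two members of the family covers both the negative powers and the functions
    [flat k]. *)
Lemma smooth_on_real_comp U f k : open U -> U `<=` f @^-1` D ->
  smooth_on U f -> smooth_on U (phi k \o f).
Proof.
move=> oU UD sf.
have df x : U x -> differentiable f x by exact: smooth_on_diff.
have dc g : comp_class U f g -> forall x, U x -> differentiable g x.
  elim=> {g} [m g sg x Ux|g h _ ihg _ ihh x Ux|g h gh _ ih x Ux].
  - apply: differentiableM; last exact: smooth_on_diff Ux.
    apply: differentiable_real_comp (df _ Ux).
    exact/dphi/UD.
  - by apply: differentiableD; [exact: ihg|exact: ihh].
  - apply: near_eq_differentiable (ih _ Ux).
    by apply: filterS (open_nbhs_nbhs (conj oU Ux)) => y /mem_set; exact: gh.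
apply: (smooth_on_class (C := comp_class U f)) => //; last first.
  apply: (@CompExt U f (fun x => phi k (f x) * cst 1 x)).
    by move=> x _ /=; rewrite mulr1.
  exact: (CompMul f k (@smooth_on_cst R n U 1)).
move=> g i; elim=> {g} [m g sg|g h cg ihg ch ihh|g h gh cg ih].
- pose u c g' x := (c : R) * partial f i x * g x.
  have su (c : R) : smooth_on U (fun x => c * partial f i x * g x).
    apply: smooth_onM => //; apply: smooth_onM; [exact: oU|exact: smooth_on_cst|].
    exact: smooth_on_partial.
  have c1 := CompMul f m.+1 (su (a m)); have c2 := CompMul f m.+2 (su (b m)).
  have c3 := CompMul f m (smooth_on_partial i sg).
  apply: (@CompExt U f _ _ _ (CompAdd (CompAdd c1 c2) c3)).
  move=> x /set_mem Ux /=; have dm := dphi m (UD _ Ux).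
  transitivity ('D_(delta_mx 0 i) ((phi m \o f) * g) x); last by [].
  rewrite deriveM; first last.
  - exact/diff_derivable/(smooth_on_diff sg).
  - by apply/diff_derivable/(differentiable_real_comp dm)/df.
  rewrite -!/(partial _ i x).
  rewrite (partial_real_comp i dm (df _ Ux)) /GRing.scale /=.
  ring.
- apply: (@CompExt U f _ _ _ (CompAdd ihg ihh)) => x /set_mem Ux /=.
  by rewrite /partial deriveD//; apply: diff_derivable; exact: dc.
- by apply: (@CompExt U f _ _ _ ih); exact: partial_near_eq.
Qed.

End Comp.

Lemma smooth_onV U f : open U -> (forall x, U x -> f x != 0) ->
  smooth_on U f -> smooth_on U (fun x => (f x)^-1).
Proof.
move=> oU f0 sf.
pose phi k (t : R) := t ^- k.+1.
apply: (@smooth_on_real_comp phi (fun k => - k.+1%:R) (fun=> 0)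
  [set t | t != 0] _ U f 0%N oU f0 sf).
move=> k t /= t0; rewrite mul0r addr0.
have d1 := is_deriveX k.+1 (is_derive_id t (1 : R)).
have t0k : (id ^+ k.+1 : R -> R) t != 0.
  by rewrite exprfctE expf_neq0.
have := is_deriveV t0k d1; rewrite !exprfctE /= => d2.
apply: is_derive_eq d2 _.
rewrite /GRing.scale /= mulr1 -exprM /phi.
rewrite (_ : (k.+1 * 2 = k.+2 + k)%N); last by rewrite muln2 -addnn addSnnS addnC.
rewrite exprD; have := expf_neq0 k t0; have := expf_neq0 k.+2 t0.
by move: (t ^+ k.+2) (t ^+ k) => c d c0 d0; field; rewrite c0.
Qed.

End SmoothClosure.

Section FlatFunction.
Context {R : realType}.

(** [flat 0] is the function e^(-1/t) extended by 0. The factors [t ^- k] make the family stable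
    under differentiation, see [is_derive_flat]. *)
Definition flat (k : nat) (t : R) : R := if 0 < t then t ^- k * expR (- t^-1) else 0.

(** The term of degree k + 1 of the exponential series at 1/t bounds e^(-1/t) by (k + 1)! t^(k +
    1). *)
Lemma flat_le k t : 0 < t -> flat k t <= k.+1`!%:R * t.
Proof.
move=> t0; rewrite /flat t0 expRN -invfM.
have tV0 : 0 < t^-1 by rewrite invr_gt0.
have e0 : 0 < t ^+ k * expR t^-1 by rewrite mulr_gt0 ?exprn_gt0 ?expR_gt0.
have f0 : 0 < k.+1`!%:R * t ^+ k.+1 by rewrite mulr_gt0 ?exprn_gt0 ?ltr0n ?fact_gt0.
rewrite -[leLHS]div1r ler_pdivrMr// mulrA -[_ * t * _]mulrA -exprS -ler_pdivrMl//.
apply: le_trans (expR_ge1Dxn k (ltW tV0)).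
rewrite mulr1 invfM exprVn mulrC.
lra.
Qed.

Lemma flat_gt0 k t : 0 < t -> 0 < flat k t.
Proof.
by move=> t0; rewrite /flat t0 mulr_gt0 ?expR_gt0// invr_gt0 exprn_gt0.
Qed.

Lemma flat_le0 k t : t <= 0 -> flat k t = 0.
Proof. by rewrite leNgt /flat => /negbTE ->. Qed.

Lemma is_derive0_quadratic (f : R -> R) c : f 0 = 0 ->
  (forall t, `|f t| <= c * t ^+ 2) -> is_derive (0 : R) (1 : R) f 0.
Proof.
move=> f0 fc.
have c0 : 0 <= c by have := fc 1; rewrite expr1n mulr1; exact: le_trans.
have E : (fun h => h^-1 *: (f (h *: 1 + 0) - f 0)) @ (0 : R)^' --> (0 : R).
  apply/cvgrPdist_le => e e0; near=> h.
  have h0 : h != 0 by near: h; exact: nbhs_dnbhs_neq.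
  rewrite sub0r normrN addr0 f0 subr0 normrM normfV ler_pdivrMl ?normr_gt0//.
  rewrite {1}/GRing.scale /= mulr1 (le_trans (fc h))// -real_normK ?num_real//.
  rewrite expr2 mulrA mulrC ler_wpM2l//.
  have c1 : 0 < c + 1 by lra.
  apply: (@le_trans _ _ ((c + 1) * `|h|)).
    by rewrite ler_wpM2r//; lra.
  rewrite -ler_pdivlMl//; near: h; apply: dnbhs0_le.
  by rewrite mulr_gt0 ?invr_gt0//; lra.
apply: DeriveDef; first by apply/cvg_ex; exists 0.
exact: cvg_lim E.
Unshelve. all: by end_near. Qed.

Lemma is_derive_flat k t :
  is_derive t (1 : R) (flat k) (- k%:R * flat k.+1 t + 1 * flat k.+2 t).
Proof.
have [t0|t0|->] := ltgtP t 0.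
- rewrite !flat_le0 ?ltW// !mulr0 addr0.
  apply: near_eq_is_derive (is_derive_cst (0 : R) t (1 : R)).
  by near=> s; rewrite flat_le0//; near: s; exact: lt_le_nbhsl.
- pose g (s : R) := (s ^+ k)^-1 * expR (- s^-1).
  have dg : is_derive t 1 g (- k%:R * flat k.+1 t + 1 * flat k.+2 t).
    have tn0 : t != 0 by rewrite gt_eqF.
    have d1 := is_deriveX k (is_derive_id t (1 : R)).
    have tk0 : (id ^+ k : R -> R) t != 0 by rewrite exprfctE expf_neq0.
    have d2 := is_deriveV tk0 d1.
    have d3 := is_deriveN (is_deriveV tn0 (is_derive_id t (1 : R))).
    have d4 := @is_derive1_comp R expR (fun s => - s^-1) t _ _ (is_derive_expR _) d3.
    have -> : g = (fun y : R => ((id ^+ k : R -> R) y)^-1) * (expR \o (fun s => - s^-1)).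
      by apply/funext => y; rewrite /g !fctE.
    apply: is_derive_eq (is_deriveM d2 d4) _.
    rewrite /flat t0 /GRing.scale /= !exprfctE !mulr1.
    case: (k) => [|m] /=.
      by field.
    rewrite !exprS; have := expf_neq0 m tn0; move: (t ^+ m) (expR _) => a b a0.
    by field; rewrite a0.
  apply: near_eq_is_derive dg.
  near=> s; rewrite /flat; case: ifPn => //.
  case/negP; near: s; apply: open_nbhs_nbhs; split=> //; exact: open_gt.
- rewrite !flat_le0 // !mulr0 addr0.
  (* Writing [flat k s = flat k.+1 s * s] and applying [flat_le] to the first factor gives a
     quadratic bound, with constant (k + 2)!. *)
  apply: (@is_derive0_quadratic _ k.+2`!%:R); first by rewrite flat_le0.
  move=> s; have [s0|s0] := leP s 0.
    by rewrite flat_le0// normr0 mulr_ge0 ?sqr_ge0.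
  rewrite gtr0_norm ?flat_gt0// (_ : flat k s = flat k.+1 s * s).
    by rewrite expr2 mulrA ler_wpM2r ?flat_le// ltW.
  rewrite /flat s0 exprS; have s1 := lt0r_neq0 s0; have := expf_neq0 k s1.
  by move: (s ^+ k) (expR _) => a b a0; field; rewrite a0 s1.
Unshelve. all: by end_near. Qed.

Lemma smooth_on_flat n (U : set 'rV[R]_n) f : open U -> smooth_on U f ->
  smooth_on U (flat 0 \o f).
Proof.
by move=> oU sf; apply: (smooth_on_real_comp (D := setT) _ 0 oU _ sf) => // k t _;
  exact: is_derive_flat.
Qed.

End FlatFunction.

(** * Bump functions *)

Section Bump.
Context {R : realType}.

(** Smoothness is local: near a point of [K] it comes from [U], and the complement of [K] is an open
    set on which [f] is 0. *)
Lemma smooth_in_extend (M : manifold R) (U K V : set M) (f : M -> R) :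
  open V -> open U -> closed K -> K `<=` U -> smooth_in (V `&` U) f ->
  (forall x, ~ K x -> f x = 0) -> smooth_in V f.
Proof.
move=> oV oU cK KU sf f0; apply: smooth_in_local => x Vx.
have [Kx|nKx] := pselect (K x).
  by exists (V `&` U) => //; split; [exact: openI|split=> //; exact: KU].
exists (~` K); first by split=> //; exact: closed_openC.
apply: (smooth_in_ext _ _ (@smooth_in_cst _ _ _ 0)); first exact: closed_openC.
by move=> y /f0.
Qed.

Lemma smooth_section_extend (M : manifold R) (F : vbundle M) (U K : set M)
  (s : forall x, F x) : open U -> closed K -> K `<=` U -> smooth_section U s ->
  (forall x, ~ K x -> s x = 0) -> smooth_section setT s.
Proof.
move=> oU cK KU ss s0 i l; apply: (smooth_in_extend _ oU cK KU).
- by apply: openI; [exact: openT|exact: open_triv_dom].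
- by apply: smooth_inW (ss i l) => y [[_ ?] ?].
- by move=> x /s0 ->; rewrite linear0 mxE.
Qed.

Lemma smooth_in_chart_fun (M : manifold R) (i : chart_index M) f :
  smooth_on setT f -> smooth_in (chart_dom i) (f \o chart i).
Proof.
move=> sf; apply: (smooth_in_chart (i := i)) => //; first exact: open_chart_dom.
apply: smooth_on_ext (smooth_onW _ sf) => //.
  exact/open_chart_imV/open_chart_dom.
by move=> _ /set_mem[x [ix _] <-] /=; rewrite chartK// inE.
Qed.

(** The norm of row vectors is the sup norm, which is not smooth. The squared Euclidean distance is,
    and its balls lie in those of the norm by [sqdist_le]. *)
Definition sqdist n (c y : 'rV[R]_n) : R := \sum_k (y 0 k - c 0 k) ^+ 2.

Lemma smooth_on_bump n (c : 'rV[R]_n) r :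
  smooth_on setT (fun y => flat 0 (r - sqdist c y)).
Proof.
have oT := @openT 'rV[R]_n.
apply: (smooth_on_flat oT (f := fun y => r - sqdist c y)).
have sd : smooth_on setT (sqdist c).
  apply: smooth_on_sum => // k.
  have s1 : smooth_on setT (fun y : 'rV[R]_n => y 0 k - c 0 k).
    by apply: smooth_onD => //; [exact: smooth_on_coord|exact: smooth_on_cst].
  exact: (smooth_onM oT s1 s1).
rewrite (_ : (fun _ => _) = cst r \+ (cst (-1) \* sqdist c)); last first.
  by apply/funext => y /=; rewrite mulN1r.
apply: smooth_onD => //; first exact: smooth_on_cst.
by apply: smooth_onM => //; exact: smooth_on_cst.
Qed.

Lemma closed_ball_rV_compact n (c : 'rV[R]_n) r : compact (closed_ball c r).
Proof.
have [r0|r0] := ltP 0 r; last by rewrite closed_ball0 //; exact: compact0.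
apply: bounded_closed_compact; last exact: closed_ball_closed.
rewrite closed_ballE//; exists (`|c| + r); split; first by rewrite num_real.
move=> e /ltW re y; rewrite /closed_ball_ /= => cy.
apply: le_trans re; rewrite -[y](subrK c) addrC (le_trans (ler_normD _ _))//.
by rewrite lerD2l distrC.
Qed.

Lemma rV_norm_le n (x : 'rV[R]_n) r : 0 <= r ->
  (forall k, `|x 0 k| <= r) -> `|x| <= r.
Proof.
move=> r0 xr; rewrite [leLHS]/Num.norm /= mx_normrE; apply/bigmax_leP; split=> //.
by move=> [i k] _ /=; rewrite ord1.
Qed.

Lemma rV_coord_le n (x : 'rV[R]_n) k : `|x 0 k| <= `|x|.
Proof.
rewrite [leRHS]/Num.norm /= mx_normrE.
by apply/bigmax_geP; right; exists (0, k).
Qed.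

Lemma sqdist_le n (c y : 'rV[R]_n) r : 0 < r -> sqdist c y < r ^+ 2 ->
  closed_ball c r y.
Proof.
move=> r0 yr; rewrite closed_ballE//= /closed_ball_ /=.
apply/rV_norm_le => [|k]; first exact: ltW.
rewrite !mxE -(ler_pXn2r (n := 2)) ?nnegrE ?(ltW r0)//.
rewrite real_normK ?num_real// -sqrrN opprB; apply: le_trans (ltW yr).
by rewrite /sqdist (bigD1 k)//= lerDl sumr_ge0// => l _; rewrite sqr_ge0.
Qed.

(** In a chart one takes [flat 0] of r^2 minus the squared distance to the centre, extended by 0 off
    the preimage [K] of a closed ball. [K] is compact, hence closed because the manifold is
    Hausdorff. *)
Lemma bump_fun (M : manifold R) (W : set M) x0 : open W -> W x0 ->
  exists (chi : smooth_fun M) (K : set M),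
    [/\ closed K, K `<=` W, (forall x, 0 <= chi x), 0 < chi x0 &
        forall x, ~ K x -> chi x = 0].
Proof.
move=> oW Wx0; pose i := chart_at x0; have ix0 : chart_dom i x0 := chart_atP x0.
have : nbhs (chart i x0) (chart_im i W).
  by apply: open_nbhs_nbhs; split; [exact: open_chart_imV|exact: mem_chart_im].
move=> /nbhs_closedballP[r rW].
pose K := chart_inv i @` closed_ball (chart i x0) r%:num.
have KE x : K x -> [/\ chart_dom i x, W x & closed_ball (chart i x0) r%:num (chart i x)].
  move=> [y By <-]; have := rW _ By => -[z [iz Wz] zy].
  by rewrite -zy chartK ?inE// zy.
have cK : closed K.
  apply: compact_closed; first exact: manifold_hausdorff.
  apply: continuous_compact; last exact: closed_ball_rV_compact.
  apply: continuous_in_subspaceT => y /set_mem By.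
  apply: chart_inv_continuous; rewrite inE.
  by have [z [iz _] <-] := rW _ By; exists z.
pose f := fun y => flat 0 (r%:num ^+ 2 - sqdist (chart i x0) y).
pose chi x := if `[< K x >] then f (chart i x) else 0.
have chi0 x : ~ K x -> chi x = 0 by rewrite /chi; case: asboolP.
have chiE x : chart_dom i x -> chi x = f (chart i x).
  move=> ix; rewrite /chi; case: asboolP => // nK; rewrite /f flat_le0//.
  rewrite subr_le0 leNgt; apply: contra_notN nK => lr.
  exists (chart i x); last by rewrite chartK// inE.
  exact: sqdist_le.
have schi : chi \in smooth_pred.
  rewrite inE; apply: (smooth_in_extend openT (open_chart_dom i) cK) => //.
    by move=> x /KE[].
  have := @smooth_in_chart_fun M i _ (smooth_on_bump (chart i x0) (r%:num ^+ 2)).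
  rewrite setTI; apply: smooth_in_ext; first exact: open_chart_dom.
  by move=> x /chiE.
exists (SmoothFun schi), K; split=> //.
- by move=> x /KE[].
- move=> x /=; rewrite /chi; case: asboolP => // _.
  by rewrite /f; case: (ltP 0 (r%:num ^+ 2 - sqdist (chart i x0) (chart i x)))
    => [/(flat_gt0 0)/ltW|/(flat_le0 0) ->].
- rewrite /= chiE// /f flat_gt0// subr_gt0 /sqdist big1 ?exprn_gt0// => k _.
  by rewrite subrr expr0n.
Qed.

(** A section constant in a trivialization is cut off by a bump function. The bump is only known to
    be positive at [x], whence the factor [c]. *)
Lemma section_through (M : manifold R) (F : vbundle M) x (v : F x) :
  exists (s : section F) (c : R), c != 0 /\ s x = c *: v.
Proof.
have [i ix] := triv_cover F x.
have [chi [K [cK Ki _ chix chi0]]] := bump_fun (open_triv_dom i) ix.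
pose s y : F y := chi y *: triv_inv i y (triv i x v).
have ss : smooth_section setT s.
  apply: (smooth_section_extend (open_triv_dom i) cK Ki); last first.
    by move=> y /chi0; rewrite /s => ->; rewrite scale0r.
  apply: smooth_sectionZ; first exact: open_triv_dom.
    by apply: smooth_inW (smooth_funP chi).
  move=> j l.
  have sE : smooth_in (triv_dom i `&` triv_dom j) (fun y => \sum_k
      (cst (triv i x v 0 k) y * triv j y (triv_inv i y (delta_mx 0 k)) 0 l)).
    apply: smooth_in_sum => [|k]; first by apply: openI; exact: open_triv_dom.
    apply: smooth_inM; first by apply: openI; exact: open_triv_dom.
      exact: smooth_in_cst.
    exact: triv_compat.
  apply: smooth_in_ext sE; first by apply: openI; exact: open_triv_dom.
  move=> y [iy jy] /=; rewrite (triv_inv_sum _ iy) linear_sum summxE.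
  by apply: eq_bigr => k _; rewrite linearZ mxE.
exists (Section_ ss), (chi x); split; first by rewrite gt_eqF.
by rewrite /= /s trivK.
Qed.

End Bump.

(** * Images of differentiable maps into higher dimension *)

Section SmallImage.
Context {R : realType}.

Lemma truncn_eq_dist (a b : R) : 0 <= a -> 0 <= b ->
  Num.truncn a = Num.truncn b -> `|a - b| < 1.
Proof.
move=> /truncn_itv/andP[la ua] /truncn_itv/andP[lb ub] ab.
rewrite -ab in lb ub; rewrite ltr_norml -natr1 in ua ub *.
by apply/andP; split; lra.
Qed.

Variables (p q : nat) (pq : (p < q)%N) (g : 'rV[R]_p -> 'rV[R]_q).

(** A quantitative consequence of differentiability with one integer parameter: countably many of
    these sets contain all points of differentiability. *)
Definition lip_set (k : nat) : set 'rV[R]_p :=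
  [set x | `|x| <= k.+1%:R /\
    forall y, `|y - x| < k.+1%:R^-1 -> `|g y - g x| <= k.+1%:R * `|y - x|].

(* Pigeonhole: there are L^q grid points near [a0], while [lip_set k] is covered
   by O(L^p) cells of side 1/L, and the image of a cell, being of size O(1/L), is
   close to a bounded number of grid points. *)
Lemma lip_set_nowhere_dense k (a0 : 'rV[R]_q) (d : R) : 0 < d ->
  exists a (e : R), [/\ 0 < e, `|a - a0| < d &
    forall x, lip_set k x -> e <= `|g x - a|].
Proof.
move=> d0; apply: contrapT => /forallNP noa.
have [d1 d10 d1d] : exists2 d1, 0 < d1 & d1 < d by exists (d / 2); lra.
pose m := (Num.truncn (3 * k.+1%:R / d1)).+1.
have m_gt : 3 * k.+1%:R < m%:R * d1.
  by rewrite -ltr_pdivrMr// /m truncnS_gt.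
(* [L > c0] and p < q give c0 L^p < L^q, the final contradiction. [L > k + 1] puts two points of one
   cell within the range of the Lipschitz estimate. *)
pose c0 := ((3 * k.+1) ^ p * m ^ q)%N; pose L := (c0 + k.+2)%N.
have L0 : (0 < L)%N by rewrite /L addnS.
have L0R : 0 < L%:R :> R by rewrite ltr0n.
pose n := (2 * k.+1 * L)%N.
pose pt (t : {ffun 'I_q -> 'I_L}) : 'rV[R]_q := a0 + \row_i (d1 * (t i)%:R / L%:R).
have bad t : exists x, lip_set k x /\ `|g x - pt t| < k.+1%:R / L%:R.
  apply: contrapT => /forallNP nox; apply: (noa (pt t)).
  exists (k.+1%:R / L%:R); split.
  - by rewrite divr_gt0.
  - rewrite addrAC subrr add0r; apply: (@le_lt_trans _ _ d1) => //.
    apply: rV_norm_le => [|i]; first exact: (ltW d10).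
    rewrite mxE ger0_norm ?divr_ge0 ?mulr_ge0 ?ler0n ?(ltW d10)//.
    by rewrite ler_pdivrMr// ler_wpM2l ?ler_nat ?(ltW d10)// ltnW.
  - by move=> x lx; rewrite leNgt; apply/negP => h; apply: (nox x).
have [xi xiP] := choice bad.
pose cell (x : 'rV[R]_p) : {ffun 'I_p -> 'I_n.+1} :=
  [ffun i => inord (Num.truncn ((x 0 i + k.+1%:R) * L%:R))].
(* The cell of [xi t] determines each coordinate of [t] up to fewer than [m] steps; the residues
   modulo [m] settle the rest. *)
pose code (t : {ffun 'I_q -> 'I_L}) : {ffun 'I_p -> 'I_n.+1} * {ffun 'I_q -> 'I_m} :=
  (cell (xi t), [ffun i => inord (t i %% m)]).
have cellP x y : lip_set k x -> lip_set k y -> cell x = cell y -> `|x - y| <= L%:R^-1.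
  move=> [xk _] [yk _] /ffunP exy; apply: rV_norm_le => [|i].
    by rewrite invr_ge0 ltW.
  have xik : `|x 0 i| <= k.+1%:R := le_trans (rV_coord_le x i) xk.
  have yik : `|y 0 i| <= k.+1%:R := le_trans (rV_coord_le y i) yk.
  have b (z : R) : `|z| <= k.+1%:R ->
      0 <= (z + k.+1%:R) * L%:R /\ (Num.truncn ((z + k.+1%:R) * L%:R) < n.+1)%N.
    rewrite ler_norml => /andP[z1 z2].
    have z0 : 0 <= (z + k.+1%:R) * L%:R by rewrite mulr_ge0// -lerBlDr sub0r.
    have /truncn_itv/andP[zt _] := z0.
    split=> //; rewrite ltnS -(ler_nat R) (le_trans zt)//.
    rewrite /n natrM ler_wpM2r ?ler0n// natrM mulr_natl mulr2n lerD2r//.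
  have [x0 xn] := b _ xik; have [y0 yn] := b _ yik.
  have := exy i; rewrite !ffunE => /(congr1 (@nat_of_ord _)).
  rewrite !inordK// => /(truncn_eq_dist x0 y0).
  rewrite -mulrBl opprD addrACA subrr addr0 normrM [X in _ * X]ger0_norm ?ler0n//.
  by rewrite -ltr_pdivlMr// div1r !mxE => /ltW.
have code_inj : injective code.
  move=> t u [ecell] /ffunP emod; apply/ffunP => i; apply/val_inj => /=.
  have [lt gt] := xiP t; have [lu gu] := xiP u.
  have xtu := cellP _ _ lt lu ecell.
  have gtu : `|g (xi t) - g (xi u)| <= k.+1%:R / L%:R.
    apply: (le_trans (lu.2 _ _)).
      apply: le_lt_trans xtu _; rewrite ltf_pV2 ?posrE// ltr_nat.
      by rewrite /L addnS ltnS leq_addl.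
    by rewrite ler_wpM2l.
  have ptu : `|pt t - pt u| < 3 * k.+1%:R / L%:R.
    rewrite -[pt t](subrK (g (xi t))) -[pt t - _ + _ - _]addrA.
    rewrite -[g (xi t)](subrK (g (xi u))) -[g (xi t) - _ + _ - _]addrA.
    rewrite (le_lt_trans (ler_normD _ _))// -[3]/(1 + (1 + 1)) !mulrDl !mul1r.
    rewrite ltr_leD//; first by rewrite subrK distrC.
    by rewrite (le_trans (ler_normD _ _))// lerD// ltW.
  have : `|(pt t - pt u) 0 i| < 3 * k.+1%:R / L%:R.
    exact: le_lt_trans (rV_coord_le _ _) ptu.
  rewrite !mxE opprD addrACA subrr add0r -mulrBl -mulrBr normrM.
  rewrite [X in _ * X]gtr0_norm ?invr_gt0// ltr_pM2r ?invr_gt0// normrM gtr0_norm//.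
  move=> /lt_trans/(_ m_gt); rewrite mulrC ltr_pM2r// => dtu.
  have := emod i; rewrite !ffunE => /(congr1 (@nat_of_ord _)).
  rewrite !inordK ?ltn_mod// => mod_tu.
  move: dtu mod_tu; move: (nat_of_ord (t i)) (nat_of_ord (u i)) => a b.
  clear; wlog ab : a b / (a <= b)%N => [h|].
    case/orP: (leq_total a b) => ab; first exact: h.
    by rewrite distrC => dab /esym mab; apply/esym/h.
  rewrite distrC -natrB// normr_nat ltr_nat => dab /eqP.
  rewrite eq_sym eqn_mod_dvd// => /dvdnP[[|c] E].
    by apply/eqP; rewrite eqn_leq ab -subn_eq0 E.
  by move: dab; rewrite E mulSn ltnNge leq_addr.
have := leq_card _ code_inj.
rewrite card_prod !card_ffun !card_ord leqNgt => /negP; apply.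
apply: (@leq_ltn_trans ((3 * k.+1 * L) ^ p * m ^ q)%N).
  rewrite leq_mul2r; apply/orP; right; case: (p) => // p'.
  rewrite leq_exp2r// /n -[3%N]/(1 + 2)%N !mulnDl -addn1 addnC leq_add2r.
  by rewrite mul1n muln_gt0 L0.
rewrite expnMn -mulnA [(L ^ p * _)%N]mulnC mulnA -/c0.
have -> : (L ^ q = L ^ (q - p).-1.+1 * L ^ p)%N.
  by rewrite -expnD prednK ?subn_gt0// subnK// ltnW.
rewrite ltn_pmul2r ?expn_gt0 ?L0// expnS.
by rewrite (@leq_trans L)// ?leq_pmulr ?expn_gt0 ?L0// /L -addn1 leq_add2l.
Qed.

Lemma differentiable_lip_set x : differentiable g x -> exists k, lip_set k x.
Proof.
move=> dg; have /diff_locallyP[dc dE] := dg.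
have [c c0 dle] : exists2 c : R, 0 < c & forall y, `|'d g x y| <= c * `|y|.
  have /linear_boundedP[r [_ rP]] := continuous_linear_bounded 0 (dc 0).
  have rr : r < `|r| + 1 by rewrite ltr_pwDr// ler_norm.
  by exists (`|r| + 1); [rewrite ltr_pwDr|exact: rP].
have /eqaddoP/(_ 1 ltr01) := dE; rewrite near_simpl => /nbhs_ballP[e /= e0 eg].
(* [k.+1] has to exceed [|x|], the Lipschitz constant [c + 1], and the inverse of the radius [e]
   within which the remainder is at most [|y - x|]. *)
pose k := Num.truncn (`|x| + (c + 1) + e^-1); exists k.
have kgt : `|x| + (c + 1) + e^-1 < k.+1%:R by exact: truncnS_gt.
have eV0 : 0 < e^-1 by rewrite invr_gt0.
have x0 : 0 <= `|x| by [].
split=> [|y yx]; first by lra.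
have ye : ball 0 e (y - x).
  rewrite -ball_normE /= sub0r normrN (lt_le_trans yx)//.
  by rewrite invf_ple ?posrE//; lra.
have := eg _ ye; rewrite /= !fctE /= subrK mul1r => gyx.
rewrite -[g y - g x](subrK ('d g x (y - x))) (le_trans (ler_normD _ _))//.
apply: (@le_trans _ _ ((c + 1) * `|y - x|)).
  rewrite mulrDl mul1r addrC lerD//.
  by move: gyx; rewrite opprD addrA.
by rewrite ler_wpM2r//; lra.
Qed.

(** By [lip_set_nowhere_dense] the complement of the image of each [lip_set k] has dense interior,
    and Baire's theorem provides a point common to these interiors. *)
Lemma image_avoid (O : set 'rV[R]_p) :
  (forall x, O x -> differentiable g x) -> exists a, forall x, O x -> g x <> a.
Proof.
move=> dg.
pose F k : set 'rV[R]_q := (~` (g @` lip_set k))°.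
have odF : forall k, open (F k) /\ dense (F k).
  move=> k; split; first exact: open_interior.
  move=> D [a0 Da0] oD.
  have /nbhs_ballP[d /= d0 dD] : nbhs a0 D by exact: open_nbhs_nbhs.
  have [a [e [e0 ad ea]]] := lip_set_nowhere_dense k a0 d0.
  exists a; split; first by apply: dD; rewrite -ball_normE /= distrC.
  apply/nbhs_ballP; exists e => // b; rewrite -ball_normE /= => ab [x lx gx].
  by move: ab; rewrite -gx ltNge distrC ea.
pose U : completeNormedModType R := HB.pack 'rV[R]_q.
have [||a] := @Baire _ U F odF setT; [by exists 0|exact: openT|].
move=> [_ aF]; exists a => x /dg/differentiable_lip_set[k kx] gx.
by have /interior_subset := aF k I; apply; exists x.
Qed.

End SmallImage.

(** * Local splittings of a subbundle *)

Section SmoothMatrices.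
Context {R : realType} {M : manifold R}.
Implicit Types (V U : set M) (f : M -> R).

Lemma smooth_in_open V f (O : set R) : open V -> smooth_in V f -> open O ->
  open (V `&` f @^-1` O).
Proof.
move=> oV sf oO; rewrite openE => x [Vx Ox]; pose i := chart_at x.
have ix : chart_dom i x := chart_atP x.
have cf : {for chart i x, continuous (f \o chart_inv i)}.
  apply: differentiable_continuous.
  by apply: (smooth_on_diff (sf i)); exact: mem_chart_im.
have cc : {for x, continuous (chart i)} by apply: chart_continuous; rewrite inE.
have cfc : {for x, continuous ((f \o chart_inv i) \o chart i)}.
  exact: continuous_comp.
have : nbhs x (((f \o chart_inv i) \o chart i) @^-1` O).
  apply: cfc; apply: open_nbhs_nbhs; split=> //=.
  by rewrite chartK// inE.
have : nbhs x V by exact: open_nbhs_nbhs.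
have : nbhs x (chart_dom i).
  by apply: open_nbhs_nbhs; split=> //; exact: open_chart_dom.
by apply: filterS3 => y iy Vy /=; rewrite chartK ?inE.
Qed.

Lemma smooth_inV V f : open V -> (forall x, V x -> f x != 0) ->
  smooth_in V f -> smooth_in V (fun x => (f x)^-1).
Proof.
move=> oV f0 sf i; apply: (smooth_onV (f := f \o chart_inv i)) => //.
  exact: open_chart_imV.
by move=> y; rewrite chart_imP => -[_ /f0].
Qed.

Lemma smooth_in_bigsum V (I : Type) (r : seq I) (P : pred I) (F : I -> M -> R) :
  open V -> (forall i, smooth_in V (F i)) ->
  smooth_in V (fun x => \sum_(i <- r | P i) F i x).
Proof.
move=> oV sF; elim: r => [|i r ih].
  by apply: smooth_in_ext (smooth_in_cst 0) => // x _; rewrite big_nil.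
have [Pi|nPi] := boolP (P i); last first.
  by apply: smooth_in_ext ih => // x _; rewrite big_cons (negbTE nPi).
apply: smooth_in_ext (smooth_inD oV (sF i) ih) => // x _.
by rewrite big_cons Pi.
Qed.

Lemma smooth_in_bigprod V (I : Type) (r : seq I) (P : pred I) (F : I -> M -> R) :
  open V -> (forall i, smooth_in V (F i)) ->
  smooth_in V (fun x => \prod_(i <- r | P i) F i x).
Proof.
move=> oV sF; elim: r => [|i r ih].
  by apply: smooth_in_ext (smooth_in_cst 1) => // x _; rewrite big_nil.
have [Pi|nPi] := boolP (P i); last first.
  by apply: smooth_in_ext ih => // x _; rewrite big_cons (negbTE nPi).
apply: smooth_in_ext (smooth_inM oV (sF i) ih) => // x _.
by rewrite big_cons Pi.
Qed.

Definition smooth_mx V m n (A : M -> 'M[R]_(m, n)) : Prop :=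
  forall a b, smooth_in V (fun x => A x a b).

Lemma smooth_mxW V U m n (A : M -> 'M[R]_(m, n)) :
  V `<=` U -> smooth_mx U A -> smooth_mx V A.
Proof. by move=> VU sA a b; exact: smooth_inW (sA a b). Qed.

Lemma smooth_mx_cst V m n (A : 'M[R]_(m, n)) : smooth_mx V (fun=> A).
Proof. by move=> a b; exact: smooth_in_cst. Qed.

Lemma smooth_mxM V m n p (A : M -> 'M[R]_(m, n)) (B : M -> 'M[R]_(n, p)) :
  open V -> smooth_mx V A -> smooth_mx V B ->
  smooth_mx V (fun x => A x *m B x).
Proof.
move=> oV sA sB a b.
have sAB : smooth_in V (fun x => \sum_c A x a c * B x c b).
  by apply: smooth_in_sum => // c; exact: smooth_inM.
by apply: smooth_in_ext sAB => // x _; rewrite mxE.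
Qed.

Lemma smooth_mxD V m n (A B : M -> 'M[R]_(m, n)) :
  open V -> smooth_mx V A -> smooth_mx V B ->
  smooth_mx V (fun x => A x + B x).
Proof.
move=> oV sA sB a b; apply: smooth_in_ext (smooth_inD oV (sA a b) (sB a b)) => //.
by move=> x _; rewrite mxE.
Qed.

Lemma smooth_mxZ V m n (f : M -> R) (A : M -> 'M[R]_(m, n)) :
  open V -> smooth_in V f -> smooth_mx V A -> smooth_mx V (fun x => f x *: A x).
Proof.
move=> oV sf sA a b; apply: smooth_in_ext (smooth_inM oV sf (sA a b)) => //.
by move=> x _; rewrite mxE.
Qed.

Lemma smooth_mxB V m n (A B : M -> 'M[R]_(m, n)) :
  open V -> smooth_mx V A -> smooth_mx V B ->
  smooth_mx V (fun x => A x - B x).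
Proof.
move=> oV sA sB; have := smooth_mxD oV sA (smooth_mxZ oV (smooth_in_cst (-1)) sB).
by congr smooth_mx; apply/funext => x; rewrite scaleN1r.
Qed.

Lemma smooth_mx_tr V m n (A : M -> 'M[R]_(m, n)) :
  open V -> smooth_mx V A -> smooth_mx V (fun x => (A x)^T).
Proof.
by move=> oV sA a b; apply: smooth_in_ext (sA b a) => // x _; rewrite mxE.
Qed.

Lemma smooth_det V n (A : M -> 'M[R]_n) : open V -> smooth_mx V A ->
  smooth_in V (fun x => \det (A x)).
Proof.
move=> oV sA; apply: smooth_in_bigsum => // s.
apply: smooth_inM => //; first exact: smooth_in_cst.
exact: smooth_in_bigprod.
Qed.

Lemma smooth_invmx V n (A : M -> 'M[R]_n) : open V ->
  (forall x, V x -> \det (A x) != 0) -> smooth_mx V A ->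
  smooth_mx V (fun x => invmx (A x)).
Proof.
move=> oV A0 sA a b.
have sdV := smooth_inV oV A0 (smooth_det oV sA).
have sadj : smooth_in V (fun x => \adj (A x) a b).
  have sm : smooth_mx V (fun x => row' b (col' a (A x))).
    by move=> k l; apply: smooth_in_ext (sA (lift b k) (lift a l)) => // x _; rewrite !mxE.
  have := smooth_inM oV (smooth_in_cst ((-1) ^+ (b + a))) (smooth_det oV sm).
  by apply: smooth_in_ext => // x _; rewrite mxE.
apply: smooth_in_ext (smooth_inM oV sdV sadj) => // x Vx.
by rewrite /invmx unitmxE unitfE A0// mxE.
Qed.

End SmoothMatrices.

Section LocalProjection.
Context {R : realType} {M : manifold R} {F : vbundle M} (E : subbundle F).

Definition local_projection (i : triv_index F) (U : set M)
    (Q : M -> 'M[R]_(vrank F)) : Prop :=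
  [/\ open U, U `<=` triv_dom i, smooth_mx U Q,
      forall x, U x -> Q x *m Q x = Q x &
      forall x, U x -> forall v, sub_fib E x v <-> triv i x v *m Q x = 0].

Lemma local_projectionW i U Q W : open W -> W `<=` U ->
  local_projection i U Q -> local_projection i W Q.
Proof.
move=> oW WU [oU Ui sQ QQ EQ]; split=> //.
- exact: subset_trans WU Ui.
- exact: smooth_mxW sQ.
- by move=> x /WU/QQ.
- by move=> x /WU/EQ.
Qed.

(** The rows of [A x] span the fibre of [E] in coordinates. If [D] is a right inverse of [A x0],
    then [A x *m D] is invertible near [x0], and [P x] is an idempotent with the same row space as
    [A x]; the complement [1%:M - P x] has the fibre as kernel. *)
Lemma exists_local_projection x0 :
  exists i U Q, U x0 /\ local_projection i U Q.
Proof.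
have [U0 [s [oU0 U0x ss sP]]] := sub_frame E x0.
have [i ix] := triv_cover F x0; exists i.
have oW : open (U0 `&` triv_dom i) by apply: openI => //; exact: open_triv_dom.
pose A x : 'M[R]_(sub_rank E, vrank F) := \matrix_(k, l) triv i x (s k x) 0 l.
have sA : smooth_mx (U0 `&` triv_dom i) A.
  by move=> k l; apply: smooth_in_ext (ss k i l) => // x _; rewrite mxE.
have AE x (c : 'rV_(sub_rank E)) : c *m A x = triv i x (\sum_k c 0 k *: s k x).
  rewrite linear_sum; apply/rowP => l; rewrite mxE summxE.
  by apply: eq_bigr => k _; rewrite linearZ !mxE.
have [D AD] : exists D, A x0 *m D = 1%:M.
  apply/row_freeP; rewrite -kermx_eq0; apply/eqP/row_matrixP => k.
  rewrite row0; have [inj _] := sP _ U0x; apply: inj.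
  have : row k (kermx (A x0)) *m A x0 = 0 by rewrite -row_mul mulmx_ker row0.
  rewrite AE => /(congr1 (triv_inv i x0)); rewrite (trivK i ix) => ->.
  by rewrite -(linear0 (triv i x0)) (trivK i ix) big1// => j _; rewrite mxE scale0r.
pose N x := A x *m D.
have sN : smooth_mx (U0 `&` triv_dom i) N.
  by apply: smooth_mxM => //; exact: smooth_mx_cst.
pose U := (U0 `&` triv_dom i) `&` (fun x => \det (N x)) @^-1` [set t | t != 0].
have oU : open U.
  by apply: (smooth_in_open oW (smooth_det oW sN)); exact: open_neq.
have UW : U `<=` U0 `&` triv_dom i by move=> x [].
pose P x := D *m invmx (N x) *m A x.
exists U, (fun x => 1%:M - P x); split.
  by split=> //=; rewrite /N AD det1 oner_neq0.
have AP x : U x -> A x *m P x = A x.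
  move=> [_ /= N0]; rewrite /P 2!mulmxA -/(N x) mulmxV ?mul1mx//.
  by rewrite unitmxE unitfE.
split=> //.
- by move=> x /UW[].
- apply: smooth_mxB => //; first exact: smooth_mx_cst.
  apply: smooth_mxM => //; last exact: smooth_mxW sA.
  apply: smooth_mxM => //; first exact: smooth_mx_cst.
  by apply: smooth_invmx => // [x []//|]; exact: smooth_mxW sN.
- move=> x Ux; have PP : P x *m P x = P x by rewrite {1}/P -mulmxA AP.
  by rewrite mulmxBr mulmx1 mulmxBl mul1mx PP subrr subr0.
- move=> x Ux v; have [U0x' ix'] := UW _ Ux; have [_ EE] := sP _ U0x'.
  rewrite EE mulmxBr mulmx1; split=> [[c _ <-]|/subr0_eq vP].
    by rewrite -AE -mulmxA AP// subrr.
  exists (triv i x v *m (D *m invmx (N x))) => //.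
  by apply: (can_inj (trivK i ix')); rewrite -AE -mulmxA.
Qed.

End LocalProjection.

(** * Alternating multilinear maps *)

Section Forms.
Context {R : realType} {B : manifold R} (V : vbundle B).

Definition fcons (T : Type) q (x : T) (z : 'I_q -> T) : 'I_q.+1 -> T :=
  fun k => if unlift ord0 k is Some j then z j else x.

Lemma fcons0 (T : Type) q (x : T) (z : 'I_q -> T) : fcons x z ord0 = x.
Proof. by rewrite /fcons unlift_none. Qed.

Lemma fconsS (T : Type) q (x : T) (z : 'I_q -> T) j :
  fcons x z (lift ord0 j) = z j.
Proof. by rewrite /fcons liftK. Qed.

Lemma fcons_eta (T : Type) q (z : 'I_q.+1 -> T) :
  fcons (z ord0) (fun j => z (lift ord0 j)) = z.
Proof. by apply/funext => k; rewrite /fcons; case: unliftP => [j|] ->. Qed.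

Lemma smooth_fun2_eq0 (f : smooth_fun B) : f = - f -> f = 0.
Proof.
move=> /(congr1 (fun g : smooth_fun B => (g : B -> R))) fN.
apply/val_inj/funext => x /=.
have : (f x = - f x) by exact: (congr1 (@^~ x) fN).
by move/eqP; rewrite -addr_eq0 -mulr2n mulrn_eq0 /= => /eqP.
Qed.

Lemma form_swap q (w : premap V q) (z : 'I_q -> section V) i j : is_form w -> i != j ->
  w (z \o tperm i j) = - w z.
Proof.
move=> [wlin walt] ij.
pose u a b k := if k == i then a else if k == j then b else z k : section V.
have addi a a' b : w (u (a + a') b) = w (u a b) + w (u a' b).
  have := wlin (u a b) i 1 a a'; rewrite mul1r scale1r.
  have E c : [eta u a b with i |-> c] = u c b :> ('I_q -> section V).
    by apply/funext => k /=; rewrite /u; case: eqP.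
  by rewrite !E.
have addj a b b' : w (u a (b + b')) = w (u a b) + w (u a b').
  have := wlin (u a b) j 1 b b'; rewrite mul1r scale1r.
  have E c : [eta u a b with j |-> c] = u a c :> ('I_q -> section V).
    apply/funext => k /=; rewrite /u; have [->|//] := eqVneq k j.
    by rewrite eq_sym (negbTE ij).
  by rewrite !E.
have alt a : w (u a a) = 0.
  by rewrite (walt _ i j ij)// /u eqxx eq_sym (negbTE ij) eqxx.
have uz : z = u (z i) (z j).
  by apply/funext => k; rewrite /u; case: eqVneq => [->//|_]; case: eqVneq => [->|].
have uzt : z \o tperm i j = u (z j) (z i).
  apply/funext => k; rewrite /u /=; case: tpermP => [->|->|/eqP/negbTE-> /eqP/negbTE->//].
    by rewrite eqxx.
  by rewrite eq_sym (negbTE ij) eqxx.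
rewrite uzt [in RHS]uz; apply/eqP; rewrite -addr_eq0; apply/eqP.
by have := alt (z i + z j); rewrite addi !addj !alt addr0 add0r addrC.
Qed.

Lemma form_perm q (w : premap V q) (z : 'I_q -> section V) (s : 'S_q) : is_form w ->
  w (z \o s) = (-1) ^+ s * w z.
Proof.
move=> wf; have [ts -> dts] := prod_tpermP s.
elim: ts dts z => [_ z|[i j] ts ih /= /andP[ij dts] z].
  rewrite big_nil odd_perm1 mul1r; congr w.
  by apply/funext => k; rewrite /= perm1.
rewrite big_cons odd_permM odd_tperm ij signr_addb.
have -> : z \o (tperm i j * \prod_(t <- ts) tperm t.1 t.2)%g =
   (z \o (\prod_(t <- ts) tperm t.1 t.2)%g) \o tperm i j.
  by apply/funext => k; rewrite /= permM.
by rewrite form_swap// ih// expr1 mulN1r mulNr.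
Qed.

(** Moving the first argument to position [j] is the permutation [lift_perm ord0 j 1], of signature
    (-1)^j. *)
Lemma form_fcons_lift q (w : premap V q.+1) (z : 'I_q.+1 -> section V) j y :
  is_form w ->
  w (fcons y (fun k => z (lift j k))) = (-1) ^+ j * w [eta z with j |-> y].
Proof.
move=> wf.
have := form_perm [eta z with j |-> y] (lift_perm ord0 j 1%g) wf.
rewrite odd_lift_perm /= odd_perm1 addbF signr_odd => <-; congr w.
apply/funext => k; rewrite /fcons /=; case: unliftP => [l|] ->.
  by rewrite lift_perm_lift perm1 eq_sym (negbTE (neq_lift _ _)).
by rewrite lift_perm_id eqxx.
Qed.

End Forms.

(** * The pull-back Lie algebroid *)

Section VectorFieldAction.
Context {R : realType} {M : manifold R}.
Implicit Types (X Y : section (tangent M)) (f g : smooth_fun M).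

Lemma smooth_fun_ext f g : (forall x, f x = g x) -> f = g.
Proof. by move=> fg; apply/val_inj/funext. Qed.

Lemma smooth_fun1E x : (1 : smooth_fun M) x = 1. Proof. by []. Qed.
Lemma smooth_funNE f x : (- f) x = - f x. Proof. by []. Qed.
Lemma smooth_funDE f g x : (f + g) x = f x + g x. Proof. by []. Qed.
Lemma smooth_funME f g x : (f * g) x = f x * g x. Proof. by []. Qed.
Lemma sectionDE (V : vbundle M) (s t : section V) x : (s + t) x = s x + t x.
Proof. by []. Qed.
Lemma sectionZE (V : vbundle M) f (s : section V) x : (f *: s) x = f x *: s x.
Proof. by []. Qed.

Lemma smooth_fun_differentiable f x :
  differentiable (f \o chart_inv (chart_at x)) (chart (chart_at x) x).
Proof.
have sf : smooth_in setT f := smooth_funP f.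
exact: (smooth_on_diff (sf _) (mem_chart_im (chart_atP x) I)).
Qed.

Lemma vf_actE X f x : vf_act X f x =
  'd (f \o chart_inv (chart_at x)) (chart (chart_at x) x) (X x).
Proof. by rewrite -(deriveE (X x) (smooth_fun_differentiable f x)). Qed.

Lemma vf_actDl X Y f : vf_act (X + Y) f = vf_act X f + vf_act Y f.
Proof.
apply: smooth_fun_ext => x; rewrite smooth_funDE !vf_actE sectionDE.
exact: linearD.
Qed.

Let vf_act_derive X f x : vf_act X f x =
  'D_(X x) (f \o chart_inv (chart_at x)) (chart (chart_at x) x).
Proof. by []. Qed.

Lemma vf_actD X f g : vf_act X (f + g) = vf_act X f + vf_act X g.
Proof.
apply: smooth_fun_ext => x; rewrite smooth_funDE !vf_act_derive.
by apply: deriveD; apply/diff_derivable/smooth_fun_differentiable.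
Qed.

Lemma vf_actM X f g : vf_act X (f * g) = f * vf_act X g + g * vf_act X f.
Proof.
apply: smooth_fun_ext => x; rewrite smooth_funDE !smooth_funME !vf_act_derive.
transitivity ('D_(X x) ((f \o chart_inv (chart_at x)) * (g \o chart_inv (chart_at x)))
   (chart (chart_at x) x)); first by [].
rewrite deriveM; try exact/diff_derivable/smooth_fun_differentiable.
by rewrite /= chartK// inE; exact: chart_atP.
Qed.

Lemma vf_act0 X : vf_act X 0 = 0.
Proof. by apply: (@addrI _ (vf_act X 0)); rewrite -vf_actD !addr0. Qed.

End VectorFieldAction.

Section PushLinear.
Context {R : realType} {B B' : manifold R} {F : vbundle B} {F' : vbundle B'}
  {p : diffeo B B'} (phi : vbmor F F' p).

Lemma pushD (u v : section F) : push phi (u + v) = push phi u + push phi v.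
Proof.
apply: section_ext => y; rewrite -(dinvK p y) sectionDE !pushE sectionDE.
exact: linearD.
Qed.

Lemma pushZ (f : smooth_fun B) (u : section F) y :
  push phi (f *: u) y = f (dinv p y) *: push phi u y.
Proof.
rewrite -(dinvK p y) dmapK !pushE sectionZE; exact: linearZ.
Qed.

End PushLinear.

Section PullBackLieAlgebroid.
Context {R : realType} {M N : manifold R} (A : gen_lie_algebroid M N).
Local Notation V := (pb_bundle A).
Local Notation h := (gla_h A).
Implicit Types (X Y Z : section V) (f g : smooth_fun M).

Let ffun_smooth f : (fun y => f (dinv h y)) \in smooth_pred.
Proof.
rewrite inE; exact: (smooth_in_comp openT (smapP (dinv h)) (smooth_funP f)).
Qed.

Definition push_fun f : smooth_fun N := SmoothFun (ffun_smooth f).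

Lemma unpullD X Y :
  unpull_section (X + Y) = unpull_section X + unpull_section Y.
Proof. exact: pushD. Qed.

Lemma unpullZ f X : unpull_section (f *: X) = push_fun f *: unpull_section X.
Proof. by apply: section_ext => y; exact: pushZ. Qed.

Lemma pull_sectionD (s t : section (gla_bundle A)) :
  pull_section h (s + t) = pull_section h s + pull_section h t.
Proof. exact: section_ext. Qed.

Lemma pull_sectionZ f (s : section (gla_bundle A)) :
  pull_section h (push_fun f *: s) = f *: pull_section h s.
Proof.
apply: section_ext => x; rewrite -[LHS]/(f (dinv h (h x)) *: s (h x)).
by rewrite dmapK.
Qed.

(** The two vector fields are [h]-related by [pb_anchorP], so this is the chain rule in charts. It
    carries the Leibniz rule over to the pull-back in [pb_bracketZr]. *)
Lemma vf_act_pb_anchor X f x : vf_act (pb_anchor X) f x =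
  vf_act (anchor_field h (gla_rho A) (unpull_section X)) (push_fun f) (h x).
Proof.
rewrite [in RHS]vf_actE -pb_anchorP.
have sh := smapP h; have cx := chart_atP x; have chx := chart_atP (h x).
have dr := differentiable_chart_rep sh cx chx.
have E : chart_rep h (chart_at x) (chart_at (h x)) (chart (chart_at x) x) =
         chart (chart_at (h x)) (h x) by rewrite /chart_rep chartK// inE.
rewrite -[LHS]/('D_(pb_anchor X x) (f \o chart_inv (chart_at x)) (chart (chart_at x) x)).
transitivity ('D_(pb_anchor X x) ((push_fun f \o chart_inv (chart_at (h x)))
   \o chart_rep h (chart_at x) (chart_at (h x))) (chart (chart_at x) x)).
  apply: near_eq_derive.
  have := near_chart cx (open_smap_preimage sh (open_chart_dom _)) chx.
  by apply: filterS => y iy; rewrite /chart_rep /= chartK ?inE// dmapK.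
have df := smooth_fun_differentiable (push_fun f) (h x).
rewrite derive_chain1//; last by rewrite E.
by rewrite E !deriveE.
Qed.

Lemma pb_anchorD X Y : pb_anchor (X + Y) = pb_anchor X + pb_anchor Y.
Proof. by rewrite /pb_anchor /anchor_field unpullD !pushD. Qed.

(* Since [rho] covers [eta], scaling is transported along the diffeomorphism
   [(h \o eta)^-1], conjugated by [h], which a priori is not the identity. *)
Lemma pb_anchorZ_twist f X x : pb_anchor (f *: X) x =
  f (dinv h (dinv (diffeo_comp h (gla_eta A)) (h x))) *: pb_anchor X x.
Proof.
have pE W y : pb_anchor W (dinv h y) =
    tmap (dinv h) y (anchor_field h (gla_rho A) (unpull_section W) y).
  exact: (pushE (p := diffeo_inv h)).
rewrite -(dmapK h x); move: (h x) => y; rewrite dinvK !pE unpullZ.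
rewrite /anchor_field pushZ; exact: linearZ.
Qed.

Lemma pb_bracketDl X Y Z : pb_bracket (X + Y) Z = pb_bracket X Z + pb_bracket Y Z.
Proof.
rewrite /pb_bracket unpullD -pull_sectionD; congr pull_section.
rewrite -{1}[unpull_section X]scale1r.
have -> : (1 : smooth_fun N) = smooth_cst 1 by apply: smooth_fun_ext.
by rewrite gla_bracket_linearl (_ : smooth_cst 1 = 1) ?scale1r//; exact: smooth_fun_ext.
Qed.

Lemma pb_bracketDr X Y Z : pb_bracket X (Y + Z) = pb_bracket X Y + pb_bracket X Z.
Proof.
rewrite /pb_bracket unpullD -pull_sectionD; congr pull_section.
rewrite -{1}[unpull_section Y]scale1r.
have -> : (1 : smooth_fun N) = smooth_cst 1 by apply: smooth_fun_ext.
by rewrite gla_bracket_linearr (_ : smooth_cst 1 = 1) ?scale1r//; exact: smooth_fun_ext.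
Qed.

Lemma pb_bracketxx X : pb_bracket X X = 0.
Proof. by rewrite /pb_bracket gla_bracketxx; exact: section_ext. Qed.

Lemma pb_bracketZr X f Y :
  pb_bracket X (f *: Y) = f *: pb_bracket X Y + vf_act (pb_anchor X) f *: Y.
Proof.
rewrite /pb_bracket unpullZ gla_leibniz pull_sectionD pull_sectionZ.
congr (_ + _); apply: section_ext => x.
rewrite [RHS](_ : _ = vf_act (pb_anchor X) f x *: Y x)// vf_act_pb_anchor.
rewrite -[in RHS](unpull_sectionK Y); exact: erefl.
Qed.

End PullBackLieAlgebroid.

(** * Locally finite families *)

Section LocallyFinite.
Context {R : realType} {M : manifold R}.
Implicit Types (f chi : smooth_fun M).

Lemma smooth_fun_mulrnE f n x : (f *+ n) x = f x *+ n.
Proof. by elim: n => // n ih; rewrite !mulrS -ih. Qed.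

Lemma smooth_fun_prodE (I : Type) (r : seq I) (P : pred I) (F : I -> smooth_fun M) x :
  (\prod_(i <- r | P i) F i) x = \prod_(i <- r | P i) F i x.
Proof. exact: (big_morph (fun f => f x)). Qed.

Lemma smooth_flat_subproof f : (fun x => flat 0 (f x)) \in smooth_pred.
Proof.
rewrite inE => i; apply: (smooth_on_flat (f := f \o chart_inv i)).
  exact/open_chart_imV/openT.
exact: (smooth_funP f).
Qed.

Definition smooth_flat f : smooth_fun M := SmoothFun (smooth_flat_subproof f).

Definition locally_finite (phi : nat -> smooth_fun M) : Prop :=
  forall x, exists (W : set M) (N : nat),
    [/\ open W, W x & forall y n, W y -> (N <= n)%N -> phi n y = 0].

(** Each member of a countable basis receives, if possible, a good function positive on it, and the
    other indices receive 0. Around [x], some basis set fits into the open set where a good function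
    is positive. *)
Lemma countable_positive_family (good : smooth_fun M -> Prop) : good 0 ->
  (forall x, exists chi, [/\ good chi, forall y, 0 <= chi y & 0 < chi x]) ->
  exists chi : nat -> smooth_fun M,
    [/\ forall n, good (chi n), forall n y, 0 <= chi n y &
        forall x, exists n, 0 < chi n x].
Proof.
move=> good0 ex; have [B cB [oB bB]] := @manifold_second_countable R M.
have [i iinj] : exists i : set M -> nat, {in B &, injective i}.
  by have /countable_injP[i /= iinj] := cB; exists i.
pose P (O : set M) chi :=
  [/\ good chi, forall y, 0 <= chi y & forall y, O y -> 0 < chi y].
have exchi n : exists chi,
    (good chi /\ forall y, 0 <= chi y) /\
    forall O, B O -> i O = n -> (exists c, P O c) -> P O chi.
  have [[S [BS iS [c Pc]]]|nO] := pselect (exists O, [/\ B O, i O = n & (exists c, P O c)]).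
    exists c; split; first by case: Pc.
    move=> O' BO' iO' _; suff -> : O' = S by [].
    by apply: iinj; rewrite ?inE// iO'.
  exists 0; split; first by split.
  by move=> O BO iO cO; exfalso; apply: nO; exists O.
have [chi chiP] := choice exchi.
exists chi; split; [by move=> n; have [[]] := chiP n|by move=> n; have [[]] := chiP n|].
move=> x; have [c [gc c0 cx]] := ex x.
have oc : open (setT `&` c @^-1` [set t | 0 < t]).
  by apply: smooth_in_open; [exact: openT|exact: smooth_funP|exact: open_gt].
have [S [BO Ox] Oc] := bB x _ (open_nbhs_nbhs (conj oc (conj I cx))).
have Pc : P S c by split=> // y /Oc[].
have [_ chiS] := chiP (i S).
by exists (i S); have [_ _] := chiS S BO erefl (ex_intro _ c Pc); exact.
Qed.

(* [phi n] is positive where [chi n] is and [chi k < 1 / n] for all [k < n];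
   where [chi k] is positive, this fails for large [n]. *)
Lemma locally_finite_family (good : smooth_fun M -> Prop) : good 0 ->
  (forall chi f, good chi -> good (chi * f)) ->
  (forall x, exists chi, [/\ good chi, forall y, 0 <= chi y & 0 < chi x]) ->
  exists phi : nat -> smooth_fun M,
    [/\ forall n, good (phi n), forall n y, 0 <= phi n y, locally_finite phi &
        forall x, exists n, 0 < phi n x].
Proof.
move=> good0 goodM /(countable_positive_family good0)[chi [gchi chi0 chix]].
have flat_ge0 (t : R) : 0 <= flat 0 t.
  by have [/(flat_gt0 0)/ltW|/(flat_le0 0)->] := ltP 0 t.
pose phi n := chi n * \prod_(k < n) smooth_flat (1 - chi k *+ n).
have phiE n y : phi n y = chi n y * \prod_(k < n) flat 0 (1 - chi k y *+ n).
  rewrite smooth_funME smooth_fun_prodE; congr (_ * _); apply: eq_bigr => k _ /=.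
  by rewrite -smooth_fun_mulrnE.
exists phi; split.
- by move=> n; exact: goodM.
- by move=> n y; rewrite phiE mulr_ge0// prodr_ge0.
- move=> x; have [k kx] := chix x.
  pose W := setT `&` chi k @^-1` [set t | chi k x / 2 < t].
  (* On [W] the factor of index [k] in [phi n] vanishes as soon as [k < n] and [n > 2 / chi k x]. *)
  exists W, (maxn k.+1 (Num.truncn (2 / chi k x)).+1); split.
  + by apply: smooth_in_open; [exact: openT|exact: smooth_funP|exact: open_gt].
  + by split=> //=; lra.
  + move=> y n [_ cy]; rewrite geq_max => /andP[kn nn].
    rewrite phiE (bigD1 (Ordinal kn))//= flat_le0 ?mul0r ?mulr0// subr_le0.
    have n2 : 2 / chi k x < n%:R.
      by rewrite (lt_le_trans (truncnS_gt _))// ler_nat.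
    have : 1 < chi k y * n%:R.
      apply: (@le_lt_trans _ _ (chi k x / 2 * (2 / chi k x))).
        by rewrite mulrA divfK// divff// gt_eqF.
      by rewrite ltr_pM// ?divr_ge0// ltW.
    by rewrite mulr_natr => /ltW.
(* At the least [n] with [chi n x > 0], all [chi k x] with [k < n] are 0, so that every factor is
   [flat 0 1]. *)
- move=> x; pose n := ex_minn (chix x).
  exists n; rewrite phiE /n; case: ex_minnP => m mx mmin.
  rewrite mulr_gt0// prodr_gt0// => k _; rewrite flat_gt0// subr_gt0.
  have -> : chi k x = 0.
    apply/eqP; rewrite eq_le chi0 andbT leNgt; apply/negP => /mmin.
    by rewrite leqNgt ltn_ord.
  by rewrite mul0rn.
Qed.

End LocallyFinite.

(** * Finitely many covector fields with a prescribed common kernel *)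

Section LocallyFiniteSums.
Context {R : realType} {M : manifold R}.

Lemma sum_ord_trunc (V : zmodType) (f : nat -> V) m n :
  (forall k, (m <= k)%N -> f k = 0) -> (forall k, (n <= k)%N -> f k = 0) ->
  \sum_(k < m) f k = \sum_(k < n) f k.
Proof.
wlog mn : m n / (m <= n)%N => [h fm fn|fm _].
  have [mn|/ltnW nm] := leqP m n; first exact: h.
  by apply/esym/h.
rewrite -!(big_mkord xpredT f) [RHS](big_cat_nat (leq0n m) mn) /=.
by rewrite [X in _ + X]big_nat_cond [X in _ + X]big1 ?addr0// => k /andP[/andP[/fm]].
Qed.

(** The bound [N x] may depend on [x] in any way; near a given point the sum agrees with the one up
    to a constant [N0], by [sum_ord_trunc]. *)
Lemma smooth_in_lf_sum (V : set M) (f : nat -> M -> R) (N : M -> nat) : open V ->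
  (forall n, smooth_in V (f n)) ->
  (forall x, exists W N0, [/\ open W, W x &
     forall y n, W y -> (N0 <= n)%N -> f n y = 0]) ->
  (forall x n, (N x <= n)%N -> f n x = 0) ->
  smooth_in V (fun x => \sum_(n < N x) f n x).
Proof.
move=> oV sf lf fN; apply: smooth_in_local => x Vx.
have [W [N0 [oW Wx fW]]] := lf x.
have oVW := openI oV oW; exists (V `&` W); first by split.
have : smooth_in (V `&` W) (fun y => \sum_(n < N0) f n y).
  by apply: smooth_in_sum => // n; apply: smooth_inW (sf n) => ? [].
apply: smooth_in_ext => // y [_ Wy].
by apply: (sum_ord_trunc (f := f^~ y)) => n; [exact: fW|exact: fN].
Qed.

Lemma section_lf_sum (F : vbundle M) (s : nat -> section F) :
  (forall x, exists W N, [/\ open W, W x &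
     forall y n, W y -> (N <= n)%N -> s n y = 0]) ->
  exists S : section F, forall x N, (forall n, (N <= n)%N -> s n x = 0) ->
    S x = \sum_(n < N) s n x.
Proof.
move=> lf.
have exN x : exists N : nat, forall n, (N <= n)%N -> s n x = 0.
  by have [W [N [_ Wx sW]]] := lf x; exists N => n; exact: sW.
have [N NP] := choice exN.
have sS : smooth_section setT (fun x => \sum_(n < N x) s n x).
  move=> i l; rewrite setTI.
  have : smooth_in (triv_dom i) (fun x => \sum_(n < N x) triv i x (s n x) 0 l).
    apply: (@smooth_in_lf_sum _ (fun n x => triv i x (s n x) 0 l)).
    - exact: open_triv_dom.
    - by move=> n; have := sectionP (s n) i l; rewrite setTI.
    - move=> x; have [W [N0 [oW Wx sW]]] := lf x; exists W, N0; split=> // y n Wy nN.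
      by rewrite sW// linear0 mxE.
    - by move=> x n /NP ->; rewrite linear0 mxE.
  apply: smooth_in_ext; first exact: open_triv_dom.
  by move=> x _; rewrite linear_sum summxE.
exists (Section_ sS) => x N' N'P.
by apply: (sum_ord_trunc (f := s^~ x)) => n; [exact: NP|exact: N'P].
Qed.

Lemma smooth_section_triv (F : vbundle M) (i : triv_index F) (U : set M)
    (r : M -> 'rV[R]_(vrank F)) : open U -> U `<=` triv_dom i -> smooth_mx U r ->
  smooth_section U (fun x => triv_inv i x (r x)).
Proof.
move=> oU Ui sr j l.
have oUj : open (U `&` triv_dom j) by apply: openI => //; exact: open_triv_dom.
have sE : smooth_in (U `&` triv_dom j) (fun y => \sum_k
    (r y 0 k * triv j y (triv_inv i y (delta_mx 0 k)) 0 l)).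
  apply: smooth_in_sum => // k; apply: smooth_inM => //.
    by apply: smooth_inW (sr 0 k) => ? [].
  by apply: smooth_inW (triv_compat i j k l) => ? [] /Ui.
apply: smooth_in_ext sE => // y [/Ui iy jy].
rewrite (triv_inv_sum _ iy) linear_sum summxE.
by apply: eq_bigr => k _; rewrite linearZ mxE.
Qed.

Lemma cutoff_section (F : vbundle M) (i : triv_index F) (U K : set M)
    (chi : smooth_fun M) (r : M -> 'rV[R]_(vrank F)) :
  open U -> U `<=` triv_dom i -> smooth_mx U r -> closed K -> K `<=` U ->
  (forall x, ~ K x -> chi x = 0) ->
  exists s : section F, forall x, s x = chi x *: triv_inv i x (r x).
Proof.
move=> oU Ui sr cK KU chi0.
suff ss : smooth_section setT (fun x => chi x *: triv_inv i x (r x)).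
  by exists (Section_ ss).
apply: (smooth_section_extend oU cK KU); last by move=> x /chi0 ->; rewrite scale0r.
apply: smooth_sectionZ => //; first by apply: smooth_inW (smooth_funP chi).
exact: smooth_section_triv.
Qed.

End LocallyFiniteSums.

Section DualLinear.
Context {R : realType} {M : manifold R} {F : vbundle M}.

Lemma dual_linearZ x (f : dual_space (F x)) c v : f (c *: v) = c * f v.
Proof.
have := @dual_linear _ _ f 1 (fun=> c) (fun=> v); rewrite !big_ord1; exact.
Qed.

Lemma dual_linearD x (f : dual_space (F x)) u v : f (u + v) = f u + f v.
Proof. by have := dualP f 1 u v; rewrite !scale1r. Qed.


Lemma dual_sumE x m (f : 'I_m -> dual_space (F x)) v :
  (\sum_k f k) v = \sum_k f k v.
Proof. exact: (big_morph (fun g : dual_space (F x) => g v)). Qed.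

Lemma dual_scaleE x c (f : dual_space (F x)) v : (c *: f) v = c * f v.
Proof. by []. Qed.

End DualLinear.

Section GenericCombination.
Context {R : realType} {M : manifold R} {F : vbundle M}.
Local Notation n := (mdim M).
Local Notation d := (vrank F).
Local Notation K := (n + d).+1.
Variables (T : nat -> section (dual_bundle F)).

(** In coordinates for the point and the vector, these combinations form the image of an open subset
    of R^(n + d) under a smooth map into R^(n + d + 1), so [image_avoid] applies. *)
Lemma avoid_combination (c : chart_index M) (i : triv_index F) (U : set M)
    (m : nat) (a : nat -> 'rV[R]_K) :
  open U -> U `<=` chart_dom c -> U `<=` triv_dom i ->
  exists b : 'rV[R]_K, forall x, U x -> forall v : F x,
    \sum_(k < m) (T k x : dual_space (F x)) v *: a k <> b.
Proof.
move=> oU Uc Ui.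
pose tau k l x := (T k x : dual_space (F x)) (triv_inv i x (delta_mx 0 l)).
have stau k l : smooth_in U (tau k l).
  have := @sectionP _ _ (dual_bundle F) (T k) i l; rewrite setTI => st.
  apply: smooth_in_ext (smooth_inW Ui st) => // x _; exact: mxE.
pose g (w : 'rV[R]_(n + d)) : 'rV[R]_K := \sum_(k < m)
  (\sum_l rsubmx w 0 l * tau k l (chart_inv c (lsubmx w))) *: a k.
pose O : set 'rV[R]_(n + d) := lsubmx @^-1` chart_im c U.
have oUc : open (chart_im c U) by exact: open_chart_imV.
have sl (V : set 'rV[R]_(n + d)) l : smooth_on V (fun w => lsubmx w 0 l).
  have := @smooth_on_coord R _ V (lshift d l); congr smooth_on.
  by apply/funext => w; rewrite mxE.
have sr (V : set 'rV[R]_(n + d)) l : smooth_on V (fun w => rsubmx w 0 l).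
  have := @smooth_on_coord R _ V (rshift n l); congr smooth_on.
  by apply/funext => w; rewrite mxE.
have oO : open O.
  apply: open_comp => // w _; apply: differentiable_continuous.
  by apply: differentiable_row => l; exact: (smooth_on_diff (sl setT l)).
have [|b bP] := @image_avoid R _ _ (ltnSn (n + d)) g O.
  move=> w Ow; apply: differentiable_row => j.
  have -> : (fun w => g w 0 j) = (fun w => \sum_(k < m)
     (\sum_l rsubmx w 0 l * tau k l (chart_inv c (lsubmx w))) * cst (a k 0 j) w).
    by apply/funext => z; rewrite summxE; apply: eq_bigr => k _; rewrite mxE.
  apply: smooth_on_diff Ow.
  apply: smooth_on_sum => // k; apply: smooth_onM => //; last exact: smooth_on_cst.
  apply: smooth_on_sum => // l; apply: smooth_onM => //.
  exact: (smooth_on_comp oO _ (stau k l c)).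
exists b => x Ux v E; apply: (bP (row_mx (chart c x) (triv i x v))).
  by rewrite /O /= row_mxKl; apply: mem_chart_im => //; exact: Uc.
rewrite -E /g row_mxKl row_mxKr chartK; last by rewrite inE; exact: Uc.
apply: eq_bigr => k _; congr (_ *: _).
by rewrite [in RHS](triv_expand v (Ui _ Ux)) dual_linear.
Qed.

Hypothesis T_lf : forall x, exists W N, [/\ open W, W x &
     forall y k, W y -> (N <= k)%N -> T k y = 0].
Hypothesis T_chart : forall m, exists (c : chart_index M) (i : triv_index F)
    (U : set M), [/\ open U, U `<=` chart_dom c, U `<=` triv_dom i &
      forall x, ~ U x -> T m x = 0].

(* [a m] is chosen after [a 0, ..., a (m - 1)]. In a vanishing combination where
   [T m x v] is not [0], rescaling [v] would express [a m] by the previous ones. *)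
Lemma generic_coefficients : exists a : nat -> 'rV[R]_K, forall m x (v : F x),
  \sum_(k < m) (T k x : dual_space (F x)) v *: a k = 0 ->
  forall k, (k < m)%N -> (T k x : dual_space (F x)) v = 0.
Proof.
have exb (ma : nat * (nat -> 'rV[R]_K)) : exists b : 'rV[R]_K, forall x (v : F x),
    (T ma.1 x : dual_space (F x)) v != 0 ->
    \sum_(k < ma.1) (T k x : dual_space (F x)) v *: ma.2 k <> b.
  have [c [i [U [oU Uc Ui T0]]]] := T_chart ma.1.
  have [b bP] := @avoid_combination c i U ma.1 ma.2 oU Uc Ui.
  exists b => x v Tv; apply: bP; apply: contrapT => /T0 E.
  by move: Tv; rewrite E eqxx.
have [next nextP] := choice exb.
(* [A m] holds the coefficients chosen so far at the indices below [m], and 0 elsewhere; this lets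
   [next] depend on all of them. *)
pose A := fix A m : nat -> 'rV[R]_K :=
  if m is m'.+1 then fun k => if k == m' then next (m', A m') else A m' k else fun=> 0.
pose a k := A k.+1 k.
have aE m k : (k < m)%N -> A m k = a k.
  elim: m => // m ih; rewrite ltnS leq_eqVlt => /predU1P[->//|km].
  by rewrite /= ltn_eqF// ih.
exists a; elim=> // m ih x v; rewrite big_ord_recr /= => E.
have Tm : (T m x : dual_space (F x)) v = 0.
  apply/eqP/negPn/negP => Tv; set t := (T m x : dual_space (F x)) v in E Tv.
  have Tv' : (T m x : dual_space (F x)) (- t^-1 *: v) != 0.
    by rewrite dual_linearZ mulf_neq0// oppr_eq0 invr_eq0.
  apply: (nextP (m, A m) x (- t^-1 *: v) Tv'); rewrite /=.
  transitivity (- t^-1 *: \sum_(k < m) (T k x : dual_space (F x)) v *: a k).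
    rewrite scaler_sumr; apply: eq_bigr => k _.
    by rewrite aE// dual_linearZ scalerA.
  move/eqP: E; rewrite addr_eq0 => /eqP ->.
  by rewrite scalerN scaleNr opprK scalerA mulVf// scale1r /a /= eqxx.
move: E; rewrite Tm scale0r addr0 => /ih{}ih k.
by rewrite ltnS leq_eqVlt => /predU1P[->|/ih].
Qed.

(** [sigma j] is the locally finite sum of the [T k] weighted by the [j]-th coordinates of the
    [a k]. The values of all [sigma j] at [v] then form the combination treated in
    [generic_coefficients]. *)
Lemma finite_generation : exists sigma : 'I_K -> section (dual_bundle F),
  forall x (v : F x), (forall j, (sigma j x : dual_space (F x)) v = 0) <->
    (forall m, (T m x : dual_space (F x)) v = 0).
Proof.
have [a aP] := generic_coefficients.
have exs j : exists S : section (dual_bundle F), forall x N,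
    (forall k, (N <= k)%N -> (smooth_cst (a k 0 j) *: T k) x = 0) ->
    S x = \sum_(k < N) (smooth_cst (a k 0 j) *: T k) x.
  apply: section_lf_sum => x; have [W [N [oW Wx TW]]] := T_lf x.
  by exists W, N; split=> // y k Wy /(TW _ _ Wy) E; rewrite sectionZE E scaler0.
have [sigma sigmaP] := choice exs; exists sigma => x v.
have sigmaE N : (forall k, (N <= k)%N -> T k x = 0) -> forall j,
    (sigma j x : dual_space (F x)) v =
    (\sum_(k < N) (T k x : dual_space (F x)) v *: a k) 0 j.
  move=> TN j; rewrite (sigmaP j x N) => [|k /TN Tk].
    rewrite dual_sumE summxE; apply: eq_bigr => k _.
    by rewrite sectionZE dual_scaleE mxE mulrC.
  by rewrite sectionZE Tk scaler0.
have [W [N [_ Wx TW]]] := T_lf x.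
have TN k : (N <= k)%N -> T k x = 0 by exact: TW.
split=> [s0 m|T0 j]; last first.
  by rewrite (sigmaE N TN) big1 ?mxE// => k _; rewrite T0 scale0r.
have [mN|/TN ->//] := ltnP m N.
by apply: (aP N) mN; apply/rowP => j; rewrite -(sigmaE N TN) s0 mxE.
Qed.

End GenericCombination.

(** * A finite frame of the annihilator *)

Section Splitting.
Context {R : realType}.

Lemma row_dot_eq0 n (y : 'rV[R]_n) : y *m y^T = 0 -> y = 0.
Proof.
move=> /matrixP/(_ 0 0); rewrite !mxE => s0; apply/rowP => k; rewrite mxE.
have := s0; rewrite (bigD1 k)//= mxE -expr2 => /eqP.
rewrite paddr_eq0 ?sqr_ge0//; last first.
  by apply: sumr_ge0 => l _; rewrite mxE -expr2 sqr_ge0.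
by rewrite sqrf_eq0 => /andP[/eqP].
Qed.

Section Gram.
Variables (d K : nat) (Q : 'M[R]_d) (S : 'M[R]_(d, K)).
Hypotheses (QQ : Q *m Q = Q)
  (SQ : forall r : 'rV_d, r *m S = 0 <-> r *m Q = 0).

(* [Q] is a possibly oblique projection, which [gram_mx] intertwines with
   [S *m S^T *m Q^T *m Q]. *)
Definition gram_mx : 'M[R]_d := (1%:M - Q) + S *m S^T *m Q^T *m Q.

Definition gram_sol : 'M[R]_(K, d) := S^T *m Q^T *m Q *m invmx gram_mx.

(** A row [r] killed by [gram_mx] satisfies [r *m Q = r]. Positivity of the scalar square, used
    twice, gives [r *m S *m S^T *m Q^T = 0] and then [r *m S = 0], so that [SQ] yields [r = 0]. *)
Lemma gram_mx_unit : gram_mx \in unitmx.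
Proof.
rewrite -row_free_unit -kermx_eq0; apply/eqP/row_matrixP => k; rewrite row0.
set r := row k _; have : r *m gram_mx = 0 by rewrite -row_mul mulmx_ker row0.
rewrite /gram_mx mulmxDr => rZ.
have rP : r *m (1%:M - Q) = 0.
  have := congr1 (mulmx^~ (1%:M - Q)) rZ; rewrite /= mul0mx mulmxDl -!mulmxA.
  have QP : Q *m (1%:M - Q) = 0 by rewrite mulmxBr mulmx1 QQ subrr.
  by rewrite QP !mulmx0 addr0 mulmxBr mulmx1 mulmxBl mul1mx QQ subrr subr0.
have rQ : r *m Q = r by move/eqP: rP; rewrite mulmxBr mulmx1 subr_eq0 => /eqP.
move: rZ; rewrite rP add0r !mulmxA => yQ.
have y0 : r *m S *m S^T *m Q^T = 0.
  apply: row_dot_eq0; move: (r *m S *m S^T) yQ => u uQ.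
  by rewrite -mulmxA -trmx_mul uQ trmx0 mulmx0.
have rS : r *m S = 0.
  apply: row_dot_eq0; rewrite trmx_mul mulmxA -{2}rQ trmx_mul mulmxA y0.
  by rewrite mul0mx.
by rewrite -rQ; apply/SQ.
Qed.

Lemma mulmx_projl : Q *m S = S.
Proof.
apply/row_matrixP => k; rewrite !rowE mulmxA; apply/eqP.
rewrite -subr_eq0 -mulmxBl; apply/eqP/SQ.
by rewrite mulmxBl -mulmxA QQ subrr.
Qed.

(** [Q] kills [1%:M - Q] and fixes [S], so multiplying [gram_mx] by [Q] on the left leaves exactly
    [S *m S^T *m Q^T *m Q]. *)
Lemma gram_solP : S *m gram_sol = Q.
Proof.
have QZ : Q *m gram_mx = S *m S^T *m Q^T *m Q.
  by rewrite /gram_mx mulmxDr mulmxBr mulmx1 QQ subrr add0r !mulmxA mulmx_projl.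
by rewrite /gram_sol !mulmxA -QZ mulmxK// gram_mx_unit.
Qed.

End Gram.

Context {M : manifold R} {F : vbundle M} (E : subbundle F).

Record splitting_chart := SplittingChart {
  sc_chart : chart_index M;
  sc_triv : triv_index F;
  sc_dom : set M;
  sc_proj : M -> 'M[R]_(vrank F);
  sc_projP : local_projection E sc_triv sc_dom sc_proj;
  sc_dom_chart : sc_dom `<=` chart_dom sc_chart }.

Definition supported_in (D : splitting_chart) (chi : smooth_fun M) : Prop :=
  exists K : set M, [/\ closed K, K `<=` sc_dom D & forall x, ~ K x -> chi x = 0].

Lemma open_sc_dom D : open (sc_dom D). Proof. by case: (sc_projP D). Qed.

Lemma sc_dom_triv D : sc_dom D `<=` triv_dom (sc_triv D).
Proof. by case: (sc_projP D). Qed.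

Lemma supported_in_eq0 D chi x : supported_in D chi -> ~ sc_dom D x -> chi x = 0.
Proof. by move=> [K [_ KD chi0]] nDx; apply: chi0 => /KD. Qed.

Lemma supported_in_mem D chi x : supported_in D chi -> 0 < chi x -> sc_dom D x.
Proof.
move=> sD cx; apply: contrapT => /(supported_in_eq0 sD) c0.
by rewrite c0 ltxx in cx.
Qed.

Lemma sub_fib_proj D x (v : F x) : sc_dom D x ->
  sub_fib E x v <-> triv (sc_triv D) x v *m sc_proj D x = 0.
Proof. by case: (sc_projP D) => _ _ _ _ EP Dx; exact: EP. Qed.

Lemma exists_splitting_chart x : exists D, sc_dom D x.
Proof.
have [i [U [Q [Ux lp]]]] := exists_local_projection E x.
have oU : open U by case: lp.
have oW : open (U `&` chart_dom (chart_at x)).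
  by apply: openI => //; exact: open_chart_dom.
have lpW := local_projectionW oW (@subIsetl _ _ _) lp.
exists (SplittingChart lpW (@subIsetr _ _ _)).
by split=> //; exact: chart_atP.
Qed.

Lemma splitting_family (x0 : M) :
  exists (phi : nat -> smooth_fun M) (D : nat -> splitting_chart),
  [/\ forall n, supported_in (D n) (phi n), forall n y, 0 <= phi n y,
      locally_finite phi & forall x, exists n, 0 < phi n x].
Proof.
pose good chi := exists D, supported_in D chi.
have [||x|phi [gphi phi0 lphi phix]] := @locally_finite_family _ _ good.
- have [D _] := exists_splitting_chart x0.
  by exists D, set0; split=> //; exact: closed0.
- move=> chi f [D [K [cK KD chi0]]]; exists D, K; split=> // x /chi0.
  by rewrite smooth_funME => ->; rewrite mul0r.
- have [D Dx] := exists_splitting_chart x.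
  have [chi [K [cK KD chi0 chix chiK]]] := bump_fun (@open_sc_dom D) Dx.
  by exists chi; split=> //; exists D, K.
- by have [D DP] := choice gphi; exists phi, D.
Qed.

Variables (phi : nat -> smooth_fun M) (D : nat -> splitting_chart).
Hypotheses (phiD : forall n, supported_in (D n) (phi n))
  (phi_ge0 : forall n y, 0 <= phi n y) (phi_lf : locally_finite phi)
  (phi_gt0 : forall x, exists n, 0 < phi n x).

Local Notation d := (vrank F).
Local Notation K := (mdim M + d).+1.

(** The forms [T m] are the coordinates of the local projections, cut off by the [phi n]. Their
    common kernel is [E], as some [phi n] is positive at each point, and [finite_generation] reduces
    them to finitely many. *)
Lemma defining_forms : exists sigma : 'I_K -> section (dual_bundle F),
    forall x (v : F x), (forall j, (sigma j x : dual_space (F x)) v = 0) <->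
      sub_fib E x v.
Proof.
pose e l : 'cV[R]_d := \col_k (k == l :> nat)%:R.
(* The index [m = n * d.+1 + l] encodes the pair of the chart [n] and the coordinate [l]. The
   divisor is positive even in rank 0, and the remainder [d] gives the zero form. *)
have exT m : exists t : section (dual_bundle F), forall x (v : F x),
    (t x : dual_space (F x)) v = phi (m %/ d.+1)%N x *
      (triv (sc_triv (D (m %/ d.+1)%N)) x v *m
       (sc_proj (D (m %/ d.+1)%N) x *m e (m %% d.+1)%N)) 0 0.
  move: (m %/ d.+1)%N (m %% d.+1)%N => n l.
  have [U [cU UD phi0]] := phiD n.
  have oD := @open_sc_dom (D n); have [_ _ sQ _ _] := sc_projP (D n).
  have sr : smooth_mx (sc_dom (D n)) (fun x => (sc_proj (D n) x *m e l)^T).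
    by apply: smooth_mx_tr => //; apply: smooth_mxM => //; exact: smooth_mx_cst.
  have [t tE] := @cutoff_section _ _ (dual_bundle F) (sc_triv (D n)) _ _ _ _
    oD (@sc_dom_triv (D n)) sr cU UD phi0.
  exists t => x v; rewrite tE dual_scaleE; congr (_ * _).
  rewrite [RHS]mxE; apply: eq_bigr => k _.
  by rewrite mxE mulrC.
have [T TE] := choice exT.
have T0 m x : phi (m %/ d.+1)%N x = 0 -> T m x = 0.
  by move=> p0; apply/val_inj/funext => v; rewrite /= TE p0 mul0r.
have T_lf x : exists W N, [/\ open W, W x &
    forall y k, W y -> (N <= k)%N -> T k y = 0].
  have [W [N [oW Wx WN]]] := phi_lf x; exists W, (N * d.+1)%N; split=> // y k Wy Nk.
  by apply/T0/WN => //; rewrite leq_divRL.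
have T_chart m : exists (c : chart_index M) (i : triv_index F) (U : set M),
   [/\ open U, U `<=` chart_dom c, U `<=` triv_dom i &
      forall x, ~ U x -> T m x = 0].
  pose n := (m %/ d.+1)%N; exists (sc_chart (D n)), (sc_triv (D n)), (sc_dom (D n)).
  split; [exact: open_sc_dom|exact: sc_dom_chart|exact: sc_dom_triv|].
  by move=> x Dx; apply/T0/supported_in_eq0/Dx.
have [sigma sigmaP] := finite_generation T_lf T_chart.
exists sigma => x v; rewrite sigmaP; split=> [T0v|Ev m].
- have [n pn] := phi_gt0 x; have Dx := supported_in_mem (phiD n) pn.
  apply/(sub_fib_proj _ Dx)/rowP => l; rewrite [RHS]mxE.
  have := T0v (n * d.+1 + l)%N; rewrite TE divnMDl// modnMDl.
  have ld : (l < d.+1)%N by rewrite ltnS ltnW.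
  rewrite divn_small// addn0 modn_small// => /eqP.
  rewrite mulf_eq0 gt_eqF//= mulmxA => /eqP <-.
  rewrite [RHS]mxE (bigD1 l)//= [e _ _ _]mxE eqxx mulr1 big1 ?addr0// => k kl.
  by rewrite [e _ _ _]mxE (_ : (k == l :> nat) = false) ?mulr0//; exact/negbTE.
- rewrite TE; set n := (m %/ d.+1)%N.
  have [Dx|/(supported_in_eq0 (phiD n)) ->] := pselect (sc_dom (D n) x).
    by rewrite mulmxA (sub_fib_proj v Dx).1// mul0mx mxE mulr0.
  by rewrite mul0r.
Qed.

(** Applying every [sigma l] turns the claim into equations that are affine in the [w j]. [gram_sol]
    solves them on each chart, and the average of the local solutions with weights [phi n / Phi] is
    again a solution. *)
Lemma dual_frame (sigma : 'I_K -> section (dual_bundle F)) :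
  (forall x (v : F x), (forall j, (sigma j x : dual_space (F x)) v = 0) <->
      sub_fib E x v) ->
  exists w : 'I_K -> section F, forall (a : section F) x,
    sub_fib E x (a x - \sum_j (sigma j x : dual_space (F x)) (a x) *: w j x).
Proof.
move=> sigmaP.
pose S n x : 'M[R]_(d, K) :=
  \matrix_(k, j) (sigma j x : dual_space (F x)) (triv_inv (sc_triv (D n)) x (delta_mx 0 k)).
have SE n x (v : F x) : sc_dom (D n) x -> triv (sc_triv (D n)) x v *m S n x =
    \row_j (sigma j x : dual_space (F x)) v.
  move=> Dx; apply/rowP => j; rewrite !mxE.
  rewrite [in RHS](triv_expand v (sc_dom_triv Dx)) dual_linear.
  by apply: eq_bigr => k _; rewrite mxE.
pose W n x := gram_sol (sc_proj (D n) x) (S n x).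
have SQ n x : sc_dom (D n) x -> forall r : 'rV_d, r *m S n x = 0 <-> r *m sc_proj (D n) x = 0.
  move=> Dx r; have ix := sc_dom_triv Dx.
  rewrite -(triv_invK _ ix r) SE// -(sub_fib_proj _ Dx) -sigmaP.
  split=> [/rowP s0 j|s0]; first by have := s0 j; rewrite !mxE.
  by apply/rowP => j; rewrite !mxE.
have QQ n x : sc_dom (D n) x -> sc_proj (D n) x *m sc_proj (D n) x = sc_proj (D n) x.
  by case: (sc_projP (D n)) => _ _ _ QQ _ /QQ.
have sW n : smooth_mx (sc_dom (D n)) (W n).
  have oD := @open_sc_dom (D n); have [_ _ sQ _ _] := sc_projP (D n).
  have sS : smooth_mx (sc_dom (D n)) (S n).
    move=> k j; have := sectionP (sigma j) (sc_triv (D n)) k; rewrite setTI.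
    move=> /(smooth_inW (@sc_dom_triv (D n))); apply: smooth_in_ext => //.
    by move=> x _; rewrite !mxE.
  have sQT := smooth_mx_tr oD sQ; have sST := smooth_mx_tr oD sS.
  apply: smooth_mxM => //; first by do 2 apply: smooth_mxM => //.
  apply: smooth_invmx => //.
    by move=> x Dx; rewrite -unitfE -unitmxE; apply: gram_mx_unit; [exact: QQ|exact: SQ].
  apply: smooth_mxD => //; first by apply: smooth_mxB => //; exact: smooth_mx_cst.
  by do 3 apply: smooth_mxM => //.
have exs n j : exists s : section F, forall x,
    s x = phi n x *: triv_inv (sc_triv (D n)) x (row j (W n x)).
  have [U [cU UD phi0]] := phiD n.
  apply: (cutoff_section (@open_sc_dom _) (@sc_dom_triv _) _ cU UD phi0).
  move=> k l; apply: smooth_in_ext (sW n j l); first exact: open_sc_dom.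
  by move=> x _; rewrite [RHS]mxE.
have exs' n : exists s : 'I_K -> section F, forall j x,
    s j x = phi n x *: triv_inv (sc_triv (D n)) x (row j (W n x)).
  by have [s sE] := choice (exs n); exists s.
have [s sE] := choice exs'.
have s0 n j x : phi n x = 0 -> s n j x = 0 by move=> p0; rewrite sE p0 scale0r.
have exw j : exists S : section F, forall x N,
    (forall n, (N <= n)%N -> s n j x = 0) -> S x = \sum_(n < N) s n j x.
  apply: section_lf_sum => x; have [V [N [oV Vx VN]]] := phi_lf x.
  by exists V, N; split=> // y n Vy nN; apply/s0/VN.
have [w0 w0E] := choice exw.
have phi_bound x : exists N : nat, forall n, (N <= n)%N -> phi n x = 0.
  by have [V [N [oV Vx VN]]] := phi_lf x; exists N => n; exact: VN.
have [N NP] := choice phi_bound.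
pose Phi x := \sum_(n < N x) phi n x.
have sPhi : smooth_in setT Phi.
  apply: (@smooth_in_lf_sum _ _ _ (fun n x => phi n x)) => //; first exact: openT.
  by move=> n; exact: smooth_funP.
have Phi_gt0 x : 0 < Phi x.
  have [n pn] := phi_gt0 x.
  have nN : (n < N x)%N by rewrite ltnNge; apply/negP => /NP p0; rewrite p0 ltxx in pn.
  by rewrite /Phi (bigD1 (Ordinal nN))//= ltr_pwDl// sumr_ge0.
have sPhiV : (fun x => (Phi x)^-1) \in smooth_pred.
  by rewrite inE; apply: smooth_inV => // [|x _]; [exact: openT|rewrite gt_eqF].
pose w j := SmoothFun sPhiV *: w0 j.
exists w => a x.
(* This is [S *m W *m S = Q *m S = S], applied to the coordinates of [a x]. *)
have local n l : sc_dom (D n) x ->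
    \sum_j (sigma j x : dual_space (F x)) (a x) *
      (sigma l x : dual_space (F x)) (triv_inv (sc_triv (D n)) x (row j (W n x))) =
    (sigma l x : dual_space (F x)) (a x).
  move=> Dx; have ix := sc_dom_triv Dx.
  transitivity ((triv (sc_triv (D n)) x (a x) *m S n x *m W n x *m S n x) 0 l).
    rewrite SE// -mulmxA mxE; apply: eq_bigr => j _; rewrite mxE; congr (_ * _).
    have := SE n x (triv_inv (sc_triv (D n)) x (row j (W n x))) Dx.
    rewrite triv_invK// => /rowP/(_ l); rewrite [RHS]mxE => <-.
    by rewrite -row_mul mxE.
  rewrite -[_ *m S n x *m W n x]mulmxA gram_solP; [|exact: QQ|exact: SQ].
  by rewrite -mulmxA mulmx_projl ?SE ?mxE//; [exact: QQ|exact: SQ].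
apply/sigmaP => l.
rewrite dual_linearD -scaleN1r dual_linearZ mulN1r dual_linear.
have w0x j : w0 j x = \sum_(n < N x) s n j x by apply: w0E => n /NP; exact: s0.
transitivity ((sigma l x : dual_space (F x)) (a x) - (Phi x)^-1 *
    \sum_(n < N x) phi n x * (sigma l x : dual_space (F x)) (a x)); last first.
  by rewrite -mulr_suml mulKf ?subrr// gt_eqF.
congr (_ - _).
transitivity ((Phi x)^-1 * \sum_(n < N x) \sum_j (sigma j x : dual_space (F x)) (a x) *
    (phi n x * (sigma l x : dual_space (F x))
       (triv_inv (sc_triv (D n)) x (row j (W n x))))).
  rewrite exchange_big /= mulr_sumr; apply: eq_bigr => j _.
  rewrite dual_linearZ w0x mulrCA; congr (_ * _).
  have -> : \sum_(n < N x) s n j x =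
      \sum_(n < N x) phi n x *: triv_inv (sc_triv (D n)) x (row j (W n x)).
    by apply: eq_bigr => n _; exact: sE.
  by rewrite dual_linear mulr_sumr.
congr (_ * _); apply: eq_bigr => n _.
have [Dx|/(supported_in_eq0 (phiD n)) p0] := pselect (sc_dom (D n) x); last first.
  by rewrite p0 mul0r big1// => j _; rewrite mul0r mulr0.
by rewrite -(local n l Dx) mulr_sumr; apply: eq_bigr => j _; rewrite mulrCA.
Qed.

End Splitting.

(* [sum_j sigma_j (.) w_j] is a projection of [Gamma(F)] with kernel [Gamma(E)]:
   the finite number of terms is what puts every form vanishing on [E] in the
   ideal generated by the annihilator. *)
Lemma annihilator_frame (R : realType) (M : manifold R) (F : vbundle M)
    (E : subbundle F) :
  exists K (sigma : 'I_K -> section (dual_bundle F)) (w : 'I_K -> section F),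
    (forall j, annihilator E (sigma j)) /\
    forall a, sub_section E (a - \sum_j pairing (sigma j) a *: w j).
Proof.
(* [splitting_family] needs a point to have at least one splitting chart; on an empty manifold the
   empty frame works. *)
have [[x0 _]|nM] := pselect (exists x : M, True); last first.
  exists 0%N, (fun=> 0), (fun=> 0); split=> [[]//|a x].
  by exfalso; apply: nM; exists x.
have [phi [D [phiD phi0 phi_lf phi_gt0]]] := splitting_family E x0.
have [sigma sigmaP] := defining_forms phiD phi_lf phi_gt0.
have [w wP] := dual_frame phiD phi0 phi_lf phi_gt0 sigmaP.
exists _, sigma, w; split=> [j S ES|a x].
  by apply: smooth_fun_ext => x; exact: (sigmaP x (S x)).2 (ES x) j.
have := wP a x; congr (sub_fib E x _); rewrite sectionDE; congr (_ + _).
have sumE (s : 'I__ -> section F) : (\sum_j s j) x = \sum_j s j x.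
  exact: (big_morph (fun t : section F => t x)).
have oppE (s : section F) : (- s) x = - s x.
  by rewrite -scaleN1r sectionZE smooth_funNE smooth_fun1E scaleN1r.
by rewrite oppE sumE.
Qed.

(** * Replacing one argument of a form, and interior products *)

Section Slots.
Context {R : realType} {B : manifold R} {V : vbundle B}.

(** Convertible with the [[eta z with i |-> a]] of [is_form], as the proof of [is_formP] shows. *)
Definition upd (T : Type) q (z : 'I_q -> T) (i : 'I_q) (a : T) : 'I_q -> T :=
  fun k => if k == i then a else z k.

Lemma upd_eq (T : Type) q (z : 'I_q -> T) i a : upd z i a i = a.
Proof. by rewrite /upd eqxx. Qed.

Lemma upd_neq (T : Type) q (z : 'I_q -> T) i a k : k != i -> upd z i a k = z k.
Proof. by rewrite /upd => /negbTE ->. Qed.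

Lemma upd_id (T : Type) q (z : 'I_q -> T) i : upd z i (z i) = z.
Proof. by apply/funext => k; rewrite /upd; case: eqP => [->|]. Qed.

Lemma updK (T : Type) q (z : 'I_q -> T) i a b : upd (upd z i a) i b = upd z i b.
Proof. by apply/funext => k; rewrite /upd; case: eqP. Qed.

Lemma updC (T : Type) q (z : 'I_q -> T) i j a b : i != j ->
  upd (upd z i a) j b = upd (upd z j b) i a.
Proof.
move=> ij; apply/funext => k; rewrite /upd; case: (eqVneq k j) => [->|//].
by rewrite eq_sym (negbTE ij).
Qed.

Lemma upd_fcons0 (T : Type) q (z : 'I_q -> T) a b :
  upd (fcons a z) ord0 b = fcons b z.
Proof.
apply/funext => k; rewrite /upd /fcons; case: unliftP => [j|] ->.
  by rewrite eq_sym (negbTE (neq_lift _ _)).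
by rewrite eqxx.
Qed.

Lemma upd_fconsS (T : Type) q (z : 'I_q -> T) a i b :
  upd (fcons a z) (lift ord0 i) b = fcons a (upd z i b).
Proof.
apply/funext => k; rewrite /upd /fcons; case: unliftP => [j|] ->.
  by rewrite (inj_eq lift_inj).
by rewrite (negbTE (neq_lift _ _)).
Qed.

Lemma fun_ord0 (T : Type) (z t : 'I_0 -> T) : z = t.
Proof. by apply/funext; case. Qed.

Section Linear.
Context {q : nat} {w : premap V q} (wf : is_form w).
Implicit Types (z : 'I_q -> section V).

Lemma form_linear z i f s t :
  w (upd z i (f *: s + t)) = f * w (upd z i s) + w (upd z i t).
Proof. exact: wf.1. Qed.

Lemma form_alt z i j : i != j -> z i = z j -> w z = 0.
Proof. exact: wf.2. Qed.

Lemma formD z i s t : w (upd z i (s + t)) = w (upd z i s) + w (upd z i t).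
Proof. by rewrite -{1}[s]scale1r form_linear mul1r. Qed.

Lemma form0 z i : w (upd z i 0) = 0.
Proof. by apply: (@addrI _ (w (upd z i 0))); rewrite -formD !addr0. Qed.

Lemma formZ z i f s : w (upd z i (f *: s)) = f * w (upd z i s).
Proof. by rewrite -[f *: s]addr0 form_linear form0 addr0. Qed.

End Linear.

Lemma is_formP q (w : premap V q) :
  (forall z i f s t, w (upd z i (f *: s + t)) = f * w (upd z i s) + w (upd z i t)) ->
  (forall z i j, i != j -> z i = z j -> w z = 0) -> is_form w.
Proof. by []. Qed.

Lemma is_form0 q : is_form (fun=> 0 : smooth_fun B) (q := q) (V := V).
Proof. by apply: is_formP => // *; rewrite mulr0 addr0. Qed.

Lemma is_form_lin q (f : smooth_fun B) (w t : premap V q) :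
  is_form w -> is_form t -> is_form (fun z => f * w z + t z).
Proof.
move=> wf tf; apply: is_formP => [z i g s u|z i j ij zij].
  by rewrite !form_linear//; ring.
by rewrite (form_alt wf ij)// (form_alt tf ij)// mulr0 addr0.
Qed.

Lemma is_formB q (w t : premap V q) :
  is_form w -> is_form t -> is_form (fun z => w z - t z).
Proof.
move=> wf tf; have := is_form_lin (-1) tf wf; congr is_form.
by apply/funext => z; rewrite mulN1r addrC.
Qed.

Definition contraction q (X : section V) (w : premap V q.+1) : premap V q :=
  fun z => w (fcons X z).

Lemma is_form_contraction q X (w : premap V q.+1) :
  is_form w -> is_form (contraction X w).
Proof.
move=> wf; apply: is_formP => [z i f s t|z i j ij zij].
  by rewrite /contraction -!upd_fconsS form_linear.
apply: (form_alt wf (i := lift ord0 i) (j := lift ord0 j)).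
  by rewrite (inj_eq lift_inj).
by rewrite !fconsS.
Qed.

(** Additivity and alternation let the first two arguments be exchanged up to sign, so that
    linearity over functions in the first follows from linearity in the second. A repetition of the
    first argument further on is brought to the second place by a transposition. *)
Lemma is_form_fcons q (D : premap V q.+2) :
  (forall X, is_form (fun z => D (fcons X z))) ->
  (forall X Y z, D (fcons (X + Y) z) = D (fcons X z) + D (fcons Y z)) ->
  (forall X z, D (fcons X (fcons X z)) = 0) -> is_form D.
Proof.
move=> Df Dadd Dalt.
have DaddS X Y Z z : D (fcons X (fcons (Y + Z) z)) =
    D (fcons X (fcons Y z)) + D (fcons X (fcons Z z)).
  by have := formD (Df X) (fcons Y z) ord0 Y Z; rewrite !upd_fcons0.
have Dswap X Y z : D (fcons X (fcons Y z)) = - D (fcons Y (fcons X z)).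
  apply/eqP; rewrite -addr_eq0; apply/eqP.
  by have := Dalt (X + Y) z; rewrite Dadd !DaddS !Dalt addr0 add0r.
have Dlin0 (z : 'I_q.+1 -> section V) f S T :
    D (fcons (f *: S + T) z) = f * D (fcons S z) + D (fcons T z).
  rewrite Dadd; congr (_ + _); rewrite -(fcons_eta z) Dswap.
  have := formZ (Df (z ord0)) (fcons S (fun j => z (lift ord0 j))) ord0 f S.
  by rewrite !upd_fcons0 => ->; rewrite [in RHS]Dswap mulrN.
apply: is_formP => [z i f s t|].
  rewrite -(fcons_eta z); case: (unliftP ord0 i) => [i'|] ->.
    by rewrite !upd_fconsS; exact: (form_linear (Df (z ord0))).
  by rewrite !upd_fcons0.
have alt0 X z j : z j = X -> D (fcons X z) = 0.
  move=> zj; have [j0|j0] := eqVneq ord0 j.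
    by rewrite -(fcons_eta z) j0 zj Dalt.
  have := form_swap z (Df X) j0; rewrite -[z \o _]fcons_eta /= tpermL zj Dalt.
  by move/eqP; rewrite eq_sym oppr_eq0 => /eqP.
move=> z i j; rewrite -(fcons_eta z).
case: (unliftP ord0 i) => [i'|] ->; case: (unliftP ord0 j) => [j'|] ->.
- rewrite (inj_eq lift_inj) !fconsS => ij zij.
  exact: (form_alt (Df (z ord0)) ij).
- by rewrite fconsS fcons0 => _; exact: alt0.
- by rewrite fconsS fcons0 => _ /esym; exact: alt0.
- by rewrite eqxx.
Qed.

End Slots.

(** * The exterior derivative of a form *)

Section ExteriorDerivative.
Context {R : realType} {M N : manifold R} (A : gen_lie_algebroid M N).
Local Notation V := (pb_bundle A).
Local Notation h := (gla_h A).
Local Notation act X f := (vf_act (pb_anchor X) f).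
Implicit Types (X Y Z : section V) (f g : smooth_fun M).

Lemma pb_bracketN X Y : pb_bracket X Y = - pb_bracket Y X.
Proof.
apply/eqP; rewrite -addr_eq0; apply/eqP.
have := pb_bracketxx (X + Y).
by rewrite pb_bracketDl !pb_bracketDr !pb_bracketxx addr0 add0r.
Qed.

Lemma actDl X Y f : act (X + Y) f = act X f + act Y f.
Proof. by rewrite pb_anchorD vf_actDl. Qed.

(* Computing [[f X, g Y]] with the Leibniz rule in each argument and using the
   antisymmetry of the bracket. *)
Lemma anchor_defect X Y f g :
  (act (f *: X) g - f * act X g) *: Y = (g * act Y f - act (g *: Y) f) *: X.
Proof.
have E1 : pb_bracket (f *: X) (g *: Y) = (g * f) *: pb_bracket X Y
    - (g * act Y f) *: X + act (f *: X) g *: Y.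
  rewrite pb_bracketZr [pb_bracket (f *: X) Y]pb_bracketN pb_bracketZr.
  by rewrite [pb_bracket Y X]pb_bracketN !scalerN !scalerDr !scalerN !scalerA opprD opprK.
have E2 : pb_bracket (f *: X) (g *: Y) = (g * f) *: pb_bracket X Y
    + (f * act X g) *: Y - act (g *: Y) f *: X.
  rewrite [LHS]pb_bracketN pb_bracketZr [pb_bracket (g *: Y) X]pb_bracketN.
  by rewrite pb_bracketZr !scalerN !scalerDr !scalerA opprD opprK mulrC.
move: E2; rewrite {}E1 -!addrA => /addrI; rewrite !scalerBl.
move: ((g * act Y f) *: X) (act (f *: X) g *: Y) ((f * act X g) *: Y)
  (act (g *: Y) f *: X) => p1 p2 p3 p4 E.
have := congr1 (+%R p1) E; rewrite /= addNKr => ->.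
by rewrite [p3 - p4]addrC addrA addrK.
Qed.

(* By [pb_anchorZ_twist], [d f := act (f X) - f act X] is [(f' - f) act X] where
   [f'] is [f] composed with a diffeomorphism, so that [anchor_defect], used
   twice, gives [(f' - f)^2 (act X g) Y = 0]. *)
Lemma actZl f X g : act (f *: X) g = f * act X g.
Proof.
apply: smooth_fun_ext => x; rewrite smooth_funME.
pose k := dinv h (dinv (diffeo_comp h (gla_eta A)) (h x)).
have tw f' X' g' : act (f' *: X') g' x = f' k * act X' g' x.
  by rewrite !vf_actE pb_anchorZ_twist linearZ.
rewrite tw.
have [i ix] := triv_cover V x.
(* In rank 0 no section [Y] has [Y x <> 0]; but then [X = 0 *: X], and its anchor vanishes. *)
have [d0|d0] := posnP (vrank V).
  have X0 : X = (0 : smooth_fun M) *: X.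
    rewrite scale0r; apply: section_ext => y; have [j jy] := triv_cover V y.
    apply: (can_inj (trivK j jy)); apply/rowP => l.
    by have := leq_trans (ltn_ord l) (eq_leq d0).
  have aX : pb_anchor X x = 0 by rewrite X0 pb_anchorZ_twist scale0r.
  by rewrite !vf_actE aX !linear0 !mulr0.
pose v : V x := triv_inv i x (delta_mx 0 (Ordinal d0)).
have v0 : v <> 0.
  move=> /(congr1 (triv i x)); rewrite triv_invK// linear0 => /rowP/(_ (Ordinal d0)).
  by rewrite !mxE !eqxx => /eqP; rewrite oner_eq0.
have [Y [c [c0 Yx]]] := section_through v.
have Y0 : Y x <> 0.
  by rewrite Yx => /eqP; rewrite scaler_eq0 (negbTE c0) => /eqP.
have D f' X' g' : ((f' k - f' x) * act X' g' x) *: Y x =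
    ((g' x - g' k) * act Y f' x) *: X' x.
  have e1 : (act (f' *: X') g' - f' * act X' g') x = (f' k - f' x) * act X' g' x.
    move: (tw f' X' g'); move: (act _ g') (act _ g') => a b ab.
    by rewrite smooth_funDE smooth_funNE smooth_funME ab mulrBl.
  have e2 : (g' * act Y f' - act (g' *: Y) f') x = (g' x - g' k) * act Y f' x.
    move: (tw g' Y f'); move: (act _ f') (act _ f') => a b ab.
    by rewrite smooth_funDE smooth_funNE smooth_funME ab mulrBl.
  rewrite -e1 -e2; exact: (congr1 (fun s : section V => s x) (anchor_defect X' Y f' g')).
apply/eqP; rewrite -subr_eq0 -mulrBl; apply/eqP.
have D1 := D f (f *: X) g; have D0 := D f X g.
move: D1; rewrite tw sectionZE scalerA [_ * f x]mulrC -[RHS]scalerA -D0 scalerA => /eqP.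
rewrite -subr_eq0 -scalerBl scaler_eq0 (introF eqP Y0) orbF => /eqP E.
have : (f k - f x) ^+ 2 * act X g x = 0 by rewrite -[RHS]E; ring.
move=> /eqP; rewrite mulf_eq0 sqrf_eq0 -mulf_eq0 => /eqP <-; ring.
Qed.

Definition lie_derivative q X (w : premap V q) : premap V q := fun z =>
  act X (w z) - \sum_j w (upd z j (pb_bracket X (z j))).

(** The terms in [act X f] coming from the Leibniz rules of the action and of the bracket cancel.
    When two arguments agree, only the two terms at their positions remain, and they are opposite by
    [form_swap]. *)
Lemma is_form_lie_derivative q X (w : premap V q) :
  is_form w -> is_form (lie_derivative X w).
Proof.
move=> wf; apply: is_formP => [z i f s t|z i j ij zij]; rewrite /lie_derivative.
  rewrite (form_linear wf) vf_actD vf_actM !(bigD1 i (P := xpredT))//= !upd_eq !updK.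
  rewrite pb_bracketDr pb_bracketZr -addrA !(form_linear wf, formD wf).
  have E a : \sum_(j < q | j != i) w (upd (upd z i a) j (pb_bracket X (upd z i a j))) =
             \sum_(j < q | j != i) w (upd (upd z j (pb_bracket X (z j))) i a).
    apply: eq_bigr => j ji; rewrite upd_neq// updC//.
    by rewrite eq_sym.
  rewrite !E; under eq_bigr do rewrite (form_linear wf).
  rewrite big_split /= -mulr_sumr (formZ wf); ring.
rewrite (form_alt wf ij zij) vf_act0 sub0r; apply/eqP; rewrite oppr_eq0; apply/eqP.
rewrite (bigD1 i)// (bigD1 j) 1?eq_sym//= big1 => [|k /andP[ki kj]]; last first.
  by rewrite (form_alt wf ij)// !upd_neq// eq_sym.
rewrite addr0 (_ : upd z j _ = upd z i (pb_bracket X (z i)) \o tperm i j).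
  by rewrite form_swap// subrr.
apply/funext => k; rewrite /upd /= zij.
by case: tpermP => [->|->|/eqP/negbTE-> /eqP/negbTE->//];
  rewrite ?eqxx ?(negbTE ij)// eq_sym (negbTE ij).
Qed.

Lemma diff_hom0 (w : premap V 0) (z : 'I_1 -> section V) (t : 'I_0 -> section V) :
  diff_hom w z = act (z ord0) (w t).
Proof.
rewrite /diff_hom big_ord1 expr0 mul1r [X in _ + X]big_ord1 [X in _ + X]big1 ?addr0.
  by congr (vf_act _ (w _)); exact: fun_ord0.
by move=> [[|//] ?].
Qed.

Lemma cartan0 (w : premap V 0) X z :
  diff_hom w (fcons X z) = lie_derivative X w z.
Proof. by rewrite (diff_hom0 _ _ z) fcons0 /lie_derivative big_ord0 subr0. Qed.

Lemma lift_lift q (i : 'I_q.+1) (k : 'I_q) :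
  lift (lift ord0 i) (lift ord0 k) = lift ord0 (lift i k).
Proof. by apply/val_inj; rewrite /= /bump /= !add1n ltnS addnS. Qed.

Lemma fcons_lift q X (z : 'I_q.+1 -> section V) i :
  (fun k => fcons X z (lift (lift ord0 i) k)) = fcons X (fun k => z (lift i k)).
Proof.
apply/funext => k; case: (unliftP ord0 k) => [j|] ->.
  by rewrite lift_lift !fconsS.
rewrite (_ : lift (lift ord0 i) ord0 = ord0) ?fcons0//; exact/val_inj.
Qed.

Lemma bumpS i k : bump i.+1 k.+1 = (bump i k).+1.
Proof. by rewrite /bump ltnS addnS. Qed.

Lemma diff_hom_args q X Y (z : 'I_q.+1 -> section V) (j : 'I_q.+1) :
  (fun k : 'I_q.+1 => if k == 0%N :> nat then Y
     else fcons X z (inord (bump (lift ord0 j) (bump (ord0 : 'I_q.+2) k.-1)))) =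
  fcons Y (fun k => z (lift j k)).
Proof.
apply/funext => k; case: (unliftP ord0 k) => [l|] ->; last by rewrite fcons0.
rewrite fconsS -[RHS](fconsS X) -(inord_val (lift ord0 (lift j l))) /=.
by rewrite bumpS.
Qed.

(** Neither removed index is 0, so [X] stays and comes just after [Y]; exchanging the two produces
    the sign. *)
Lemma diff_hom_argsS q X Y (z : 'I_q.+1 -> section V) (i j : 'I_q.+1) (w : premap V q.+1) :
  is_form w -> (i < j)%N ->
  w (fun k : 'I_q.+1 => if k == 0%N :> nat then Y
     else fcons X z (inord (bump (lift ord0 j) (bump (lift ord0 i) k.-1)))) =
  - w (fcons X (fun k : 'I_q => if k == 0%N :> nat then Y
     else z (inord (bump j (bump i k.-1))))).
Proof.
case: q z i j w => [z [i i1] [[|j] j1] w //|q z i j w wf ij].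
rewrite -(@form_swap _ _ _ _ _ _ ord0 (lift ord0 ord0) wf)//; congr w.
apply/funext => k /=; case: (unliftP ord0 k) => [l|] ->; last first.
  by rewrite tpermL fconsS.
case: (unliftP ord0 l) => [m|] ->; last first.
  rewrite tpermR fcons0 /= (_ : inord _ = ord0) ?fcons0//.
  by apply/val_inj; rewrite /= inordK.
rewrite tpermD// fconsS /= -[RHS](fconsS X); congr (fcons X z _).
rewrite bumpS bumpS; apply/val_inj.
have ub : (bump j (bump i m) < q.+2)%N.
  by have := ltn_ord m; rewrite /bump; case: leqP; case: leqP => *; lia.
by rewrite /= !inordK.
Qed.

(** Cartan's formula i_X d = L_X - d i_X. In both sums of [diff_hom], the terms involving the index
    0 add up to the Lie derivative and the others to - d i_X. *)
Lemma cartan q (w : premap V q.+1) X (z : 'I_q.+1 -> section V) : is_form w ->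
  diff_hom w (fcons X z) = lie_derivative X w z - diff_hom (contraction X w) z.
Proof.
move=> wf; rewrite {1}/diff_hom big_ord_recl [X in _ + X]big_ord_recl.
rewrite expr0 mul1r fcons0.
have -> : (fun k => fcons X z (lift ord0 k)) = z by apply/funext => k; rewrite fconsS.
rewrite /lie_derivative /diff_hom opprD -!addrA; congr (_ + _).
rewrite addrCA; congr (_ + (_ + _)).
- rewrite big_mkcond big_ord_recl ltnn [LHS]add0r -sumrN; apply: eq_bigr => j _.
  rewrite diff_hom_args fconsS form_fcons_lift//.
  by rewrite [(-1) ^+ _]exprS mulN1r mulNr mulrA -exprD addnn -muln2 mulnC exprM sqrrN expr1n expr1n mul1r.
- rewrite -sumrN; apply: eq_bigr => i _.
  by rewrite fcons_lift fconsS [(-1) ^+ _]exprS mulN1r mulNr.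
- rewrite -sumrN; apply: eq_bigr => i _.
  rewrite big_mkcond big_ord_recl ltn0 [LHS]add0r -sumrN [RHS]big_mkcond; apply: eq_bigr => j _.
  rewrite (_ : (lift ord0 i < lift ord0 j)%N = (i < j)%N)//; case: ifP => // ij.
  rewrite !fconsS diff_hom_argsS// mulrN.
  by rewrite (_ : (lift ord0 i + lift ord0 j = (i + j).+2)%N) ?exprSr ?mulrN1 ?opprK//= /bump /= !add1n addSn addnS.
Qed.

Lemma diff_hom_fun0 q (z : 'I_q.+1 -> section V) :
  diff_hom (fun=> 0 : smooth_fun M) z = 0.
Proof.
rewrite /diff_hom !big1 ?addr0// => [i _|i _]; last by rewrite vf_act0 mulr0.
by rewrite big1// => j _; rewrite mulr0.
Qed.

Lemma diff_homD q (w t : premap V q) z :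
  diff_hom (fun y => w y + t y) z = diff_hom w z + diff_hom t z.
Proof.
rewrite /diff_hom [RHS]addrACA; congr (_ + _).
  by rewrite -big_split /=; apply: eq_bigr => i _; rewrite vf_actD mulrDr.
rewrite -big_split /=; apply: eq_bigr => i _.
by rewrite -big_split; apply: eq_bigr => j _; rewrite mulrDr.
Qed.

(* By induction on the degree: [cartan] gives the statement for all arguments but
   the first. *)
Lemma is_form_diff_hom q (w : premap V q) : is_form w -> is_form (diff_hom w).
Proof.
elim: q w => [|q ih] w wf.
  have E z : diff_hom w z = act (z ord0) (w (fun i => z (lift ord0 i))).
    exact: diff_hom0.
  apply: is_formP => [z i f s t|z i j]; last by rewrite !ord1.
  rewrite !E !ord1 !upd_eq actDl actZl; congr (_ * act _ (w _) + act _ (w _)); exact: fun_ord0.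
apply: is_form_fcons.
- move=> X.
  have -> : (fun z => diff_hom w (fcons X z)) =
    (fun z => lie_derivative X w z - diff_hom (contraction X w) z).
    by apply/funext => z; exact: cartan.
  by apply: is_formB; [exact: is_form_lie_derivative|exact/ih/is_form_contraction].
- move=> X Y z; rewrite !cartan//.
  have -> : contraction (X + Y) w = fun y => contraction X w y + contraction Y w y.
    apply/funext => y; rewrite /contraction.
    by have := formD wf (fcons X y) ord0 X Y; rewrite !upd_fcons0.
  rewrite diff_homD /lie_derivative actDl.
  under eq_bigr do rewrite pb_bracketDl (formD wf).
  rewrite big_split /=; ring.
(* Since [X, X] = 0, (L_X w)(X, z) is (L_X i_X w)(z). Cartan's formula for i_X w cancels it up to d
   i_X i_X w, which is 0. *)
- move=> X z; rewrite cartan//.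
  have lieE : lie_derivative X w (fcons X z) = lie_derivative X (contraction X w) z.
    rewrite /lie_derivative big_ord_recl fcons0 pb_bracketxx (form0 wf) add0r.
    congr (_ - _); apply: eq_bigr => j _.
    by rewrite fconsS upd_fconsS.
  rewrite lieE; case: q z w wf {ih lieE} => [|q] z w wf.
    by rewrite cartan0 subrr.
  rewrite cartan; last exact: is_form_contraction.
  have -> : contraction X (contraction X w) = fun=> 0.
    apply/funext => y; apply: (form_alt wf (i := ord0) (j := lift ord0 ord0)) => //.
    by rewrite fconsS !fcons0.
  by rewrite diff_hom_fun0 subr0 subrr.
Qed.

End ExteriorDerivative.

(** * Ideals of forms *)

Section WedgeForms.
Context {R : realType} {B : manifold R} {V : vbundle B}.

Lemma is_form_sum q (I : Type) (r : seq I) (P : pred I) (F : I -> premap V q) :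
  (forall i, is_form (F i)) -> is_form (fun z => \sum_(i <- r | P i) F i z).
Proof.
move=> Ff; apply: is_formP => [z i f s t|z i j ij zij].
  rewrite mulr_sumr -big_split; apply: eq_bigr => k _ /=.
  exact: (form_linear (Ff k)).
by rewrite big1// => k _; exact: (form_alt (Ff k) ij).
Qed.

(** Linearity holds term by term, as each argument enters exactly one of the two factors. If
    [z i = z j], reindexing by the transposition of [i] and [j] shows that the sum is its own
    opposite. *)
Lemma is_form_wedge_hom q r n (e : (q + r)%N = n) (w : premap V q) (t : premap V r) :
  is_form w -> is_form t -> is_form (wedge_hom e w t).
Proof.
move=> wf tf.
pose l s i : 'I_n := (s : 'S_n) (cast_ord e (lshift r i)).
pose u s j : 'I_n := (s : 'S_n) (cast_ord e (rshift q j)).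
pose G z s := (-1) ^+ (s : 'S_n) * w (fun i => z (l s i)) * t (fun j => z (u s j)).
have lI s : injective (l s) by move=> i j /perm_inj/cast_ord_inj/lshift_inj.
have uI s : injective (u s) by move=> i j /perm_inj/cast_ord_inj/rshift_inj.
have lu s i j : (l s i == u s j) = false.
  by rewrite (inj_eq perm_inj) (inj_eq (@cast_ord_inj _ _ _)) eq_lrshift.
have wE z : wedge_hom e w t z =
    smooth_cst (q`! * r`!)%N%:R^-1 * \sum_s G z s by [].
apply: is_formP => [z i f a b|z i j ij zij]; rewrite !wE.
  rewrite mulrCA -mulrDr; congr (_ * _); rewrite mulr_sumr -big_split.
  apply: eq_bigr => s _ /=.
  have [k ik] : exists k, i = s (cast_ord e k).
    exists (cast_ord (esym e) (s^-1%g i)).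
    by rewrite cast_ordKV permKV.
  rewrite /G {}ik; case: (split_ordP k) => [k' ->|k' ->].
    have E c : (fun m => upd z (l s k') c (l s m)) = upd (fun m => z (l s m)) k' c.
      by apply/funext => m; rewrite /upd (inj_eq (lI s)).
    have E' c : (fun m => upd z (l s k') c (u s m)) = (fun m => z (u s m)).
      by apply/funext => m; rewrite /upd eq_sym lu.
    rewrite -/(l s k') (E (f *: a + b)) (E a) (E b) !E' (form_linear wf).
    by move: (w _) (w _) (t _) => w1 w2 t1; rewrite !mulrDr !mulrDl; congr (_ + _);
      rewrite !mulrA (mulrC f).
  have E c : (fun m => upd z (u s k') c (u s m)) = upd (fun m => z (u s m)) k' c.
    by apply/funext => m; rewrite /upd (inj_eq (uI s)).
  have E' c : (fun m => upd z (u s k') c (l s m)) = (fun m => z (l s m)).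
    by apply/funext => m; rewrite /upd lu.
  rewrite -/(u s k') (E (f *: a + b)) (E a) (E b) !E' (form_linear tf).
  by rewrite mulrDr mulrCA.
rewrite (_ : \sum_s _ = 0) ?mulr0//; apply: smooth_fun2_eq0.
rewrite [LHS](reindex_inj (mulIg (tperm i j))) /= -sumrN; apply: eq_bigr => s _.
have zt m : z (tperm i j m) = z m by case: tpermP => // ->.
rewrite /G odd_permM odd_tperm ij signr_addb expr1 mulrN1 !mulNr.
congr (- (_ * w _ * t _)); apply/funext => m; by rewrite /l /u permM zt.
Qed.

Lemma wedge_hom0l q r n (e : (q + r)%N = n) (t : premap V r) :
  wedge_hom e (fun=> 0 : smooth_fun B) t = fun=> 0.
Proof.
apply/funext => z; rewrite /wedge_hom big1 ?mulr0// => s _.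
by rewrite mulr0 mul0r.
Qed.

Lemma wedge_hom0r q r n (e : (q + r)%N = n) (w : premap V q) :
  wedge_hom e w (fun=> 0 : smooth_fun B) = fun=> 0.
Proof. by apply/funext => z; rewrite /wedge_hom big1 ?mulr0// => s _; rewrite mulr0. Qed.

Lemma Lambda_ext0 : Lambda (@ext0 R B V).
Proof. by split=> [q|]; [exact: is_form0|exists 0%N]. Qed.

Lemma Lambda_add w t : Lambda w -> Lambda t -> Lambda (@ext_add R B V w t).
Proof.
move=> [wf [m wm]] [tf [m' tm]]; split=> [q|].
  have := is_form_lin 1 (wf q) (tf q); congr is_form.
  by apply/funext => z; rewrite mul1r.
exists (maxn m m') => q; rewrite geq_max => /andP[/wm wq /tm tq].
by apply/funext => z; rewrite /ext_add wq tq addr0.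
Qed.

Lemma Lambda_scale f w : Lambda w -> Lambda (@ext_scale R B V f w).
Proof.
move=> [wf [m wm]]; split=> [q|].
  have := is_form_lin f (wf q) (@is_form0 _ _ V q); congr is_form.
  by apply/funext => z; rewrite addr0.
by exists m => q /wm wq; apply/funext => z; rewrite /ext_scale wq mulr0.
Qed.

Lemma Lambda_wedge w t : Lambda w -> Lambda t -> Lambda (@wedge R B V w t).
Proof.
move=> [wf [m wm]] [tf [m' tm]]; split=> [q|].
  by apply: is_form_sum => i; exact: is_form_wedge_hom.
exists (m + m')%N => n mn; apply/funext => z; rewrite /wedge big1// => q _.
have [/wm ->|qm] := leqP m q; first by rewrite wedge_hom0l.
rewrite tm ?wedge_hom0r// leq_subRL; last by rewrite -ltnS.
by rewrite (leq_trans _ mn)// leq_add2r ltnW.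
Qed.

Lemma Lambda_one_form (Om : section (dual_bundle V)) : Lambda (one_form Om).
Proof.
split=> [[|[|q]]|]; [exact: is_form0| |exact: is_form0|by exists 2%N => -[|[|q]]].
apply: is_formP => [z i f s t|z i j]; last by rewrite !ord1.
rewrite /one_form !ord1 !upd_eq; apply: smooth_fun_ext => x.
by rewrite smooth_funDE smooth_funME /= dual_linearD dual_linearZ.
Qed.

Variable E : subbundle V.

(** The ideal J. In degree 0 the condition on [u] is vacuous, so the component of degree 0 is 0. *)
Definition vanishing_ideal : set (graded V) :=
  [set w | Lambda w /\
     forall q u, (forall i, sub_section E (u i)) -> w q u = 0].

Lemma is_ideal_vanishing : is_ideal vanishing_ideal.
Proof.
split.
- by move=> w [].
- by split=> //; exact: Lambda_ext0.
- move=> w t [lw w0] [lt t0]; split=> [|q u Eu]; first exact: Lambda_add.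
  by rewrite /ext_add w0// t0// addr0.
- move=> f w [lw w0]; split=> [|q u Eu]; first exact: Lambda_scale.
  by rewrite /ext_scale w0// mulr0.
- move=> w t [lw w0] lt; split; split=> [|n u Eu]; try exact: Lambda_wedge.
  + rewrite /wedge big1// => q _; rewrite /wedge_hom big1 ?mulr0// => s _.
    by rewrite w0 ?mulr0 ?mul0r.
  + rewrite /wedge big1// => q _; rewrite /wedge_hom big1 ?mulr0// => s _.
    by rewrite [X in _ * X]w0 ?mulr0.
Qed.

Lemma annihilator_sub_vanishing :
  [set one_form Om | Om in annihilator E] `<=` vanishing_ideal.
Proof.
move=> _ [Om EOm <-]; split=> [|[|[|q]] u Eu //]; first exact: Lambda_one_form.
exact: EOm.
Qed.

End WedgeForms.

(** * The annihilator generates the ideal of forms vanishing on the subbundle *)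

Section IdealGeneration.
Context {R : realType} {B : manifold R} {V : vbundle B}.

Lemma smooth_cst_natVK n (f : smooth_fun B) : (0 < n)%N ->
  smooth_cst n%:R^-1 * (f *+ n) = f.
Proof.
move=> n0; apply: smooth_fun_ext => x.
rewrite smooth_funME smooth_fun_mulrnE -[LHS]/(n%:R^-1 * (f x *+ n)).
by rewrite -[f x *+ n]mulr_natl mulKf// pnatr_eq0 -lt0n.
Qed.

Lemma smooth_fun_mulrnI n (f g : smooth_fun B) : (0 < n)%N ->
  f *+ n = g *+ n -> f = g.
Proof.
by move=> n0 fg; rewrite -(smooth_cst_natVK f n0) fg smooth_cst_natVK.
Qed.

(** The sum of [f (s i)] over all [s] and [i] is computed in two ways and divided by [n.+1]. *)
Lemma sum_perm_ord0 n (f : 'I_n.+1 -> smooth_fun B) :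
  \sum_(s : 'S_n.+1) f (s ord0) = (\sum_i f i) *+ n`!.
Proof.
apply: (@smooth_fun_mulrnI n.+1) => //; rewrite -mulrnA mulnC -factS.
have gE i : \sum_(s : 'S_n.+1) f (s i) = \sum_(s : 'S_n.+1) f (s ord0).
  rewrite [LHS](reindex_inj (mulgI (tperm ord0 i))) /=.
  by apply: eq_bigr => s _; rewrite permM tpermR.
transitivity (\sum_(i < n.+1) \sum_(s : 'S_n.+1) f (s i)).
  by rewrite (eq_bigr _ (fun i _ => gE i)) sumr_const card_ord.
rewrite exchange_big /= -(card_Sn n.+1) -sumr_const; apply: eq_bigr => s _.
by rewrite [RHS](reindex_inj (@perm_inj _ s)).
Qed.

Section Frame.
Variables (K : nat) (sigma : 'I_K -> section (dual_bundle V)) (v : 'I_K -> section V).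

Definition frame_proj (a : section V) : section V :=
  \sum_j pairing (sigma j) a *: v j.

Definition contract (X : section V) (w : graded V) : graded V :=
  fun q => contraction X (w q.+1).

(** The derivation induced by [frame_proj]: by [frame_eulerE] it sums the results of projecting one
    argument at a time. *)
Definition frame_euler (w : graded V) : graded V :=
  \big[@ext_add _ _ V/@ext0 _ _ V]_j wedge (one_form (sigma j)) (contract (v j) w).

Arguments frame_euler : clear implicits.
Arguments contract : clear implicits.

(** For each [s], [form_perm] brings the projected argument [s ord0] to the front, where expanding
    it gives the terms of the wedge products. Each [i] is [s ord0] for r! permutations, which the
    normalizing factor compensates. *)
Lemma wedge_hom_contract r n (e : (1 + r)%N = n) (w : graded V) (z : 'I_n -> section V) :
  is_form (w n) ->
  \sum_j wedge_hom e (one_form (sigma j) 1%N) (contraction (v j) (w r.+1)) z =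
  \sum_i w n (upd z i (frame_proj (z i))).
Proof.
case: _ / e z => z wf.
have termE (s : 'S_r.+1) : w r.+1 (upd z (s ord0) (frame_proj (z (s ord0)))) =
    \sum_j (-1) ^+ s * pairing (sigma j) (z (s ord0)) *
      w r.+1 (fcons (v j) (fun k => z (s (lift ord0 k)))).
  have sumE (c : 'I_K -> smooth_fun B) (y : 'I_r.+1 -> section V) :
      w r.+1 (upd y ord0 (\sum_j c j *: v j)) = \sum_j c j * w r.+1 (upd y ord0 (v j)).
    elim/big_rec2: _ => [|j b a _ IH]; first exact: form0.
    by rewrite (form_linear wf) IH.
  pose y a := fcons a (fun k => z (s (lift ord0 k))).
  have -> : upd z (s ord0) (frame_proj (z (s ord0))) = y (frame_proj (z (s ord0))) \o (s^-1)%g.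
    apply/funext => k; rewrite -[k](permKV s) /= permK; move: (s^-1%g k) => m.
    rewrite /upd (inj_eq perm_inj) /y /fcons.
    by case: unliftP => [l|] ->; rewrite ?eqxx// eq_sym (negbTE (neq_lift _ _)).
  rewrite form_perm// odd_permV /y -(upd_fcons0 _ 0) sumE mulr_sumr.
  by apply: eq_bigr => j _; rewrite upd_fcons0 mulrA.
rewrite -[RHS](smooth_cst_natVK _ (fact_gt0 r)) -sum_perm_ord0 (eq_bigr _ (fun s _ => termE s)).
rewrite exchange_big mulr_sumr; apply: eq_bigr => j _ /=.
rewrite /wedge_hom mul1n; congr (_ * _); apply: eq_bigr => s _.
have E0 : s (cast_ord erefl (lshift r ord0)) = s ord0 by congr (s _); exact/val_inj.
rewrite -[X in _ * X * _]/(pairing (sigma j) (z (s (cast_ord erefl (lshift r ord0))))) E0.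
congr (_ * w _ (fcons _ _)); apply/funext => k; congr (z (s _)); exact/val_inj.
Qed.

Lemma frame_eulerE (w : graded V) q (z : 'I_q -> section V) : Lambda w ->
  frame_euler w q z = \sum_i w q (upd z i (frame_proj (z i))).
Proof.
move=> [wf _].
have -> : frame_euler w q z = \sum_j @wedge R B V (one_form (sigma j)) (contract (v j) w) q z.
  exact: (big_morph (fun t : graded V => t q z)).
case: q z => [|p] z.
  rewrite [RHS]big_ord0 big1// => j _; rewrite /wedge big_ord1.
  by rewrite wedge_hom0l.
rewrite -(wedge_hom_contract (r := p.+1 - 1) (subnKC (isT : (1 <= p.+1)%N)))//.
apply: eq_bigr => j _.
rewrite /wedge (bigD1 (Ordinal (isT : (1 < p.+2)%N)))//= big1 ?addr0.
  by rewrite (Prop_irrelevance (subnKC (ltn_ord (Ordinal (isT : (1 < p.+2)%N))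
    : (1 <= p.+1)%N)) (subnKC (isT : (1 <= p.+1)%N))).
move=> [[|[|k]] lk] // _; exact: (congr1 (fun f => f z) (wedge_hom0l _ _)).
Qed.

Lemma Lambda_contract X w : Lambda w -> Lambda (contract X w).
Proof.
move=> [wf [m wm]]; split=> [q|]; first exact: is_form_contraction.
by exists m => q mq; apply/funext => z; rewrite /contract /contraction wm// ltnW.
Qed.

Lemma ideal_frame_euler (I : set (graded V)) w : is_ideal I ->
  (forall j, I (one_form (sigma j))) -> Lambda w -> I (frame_euler w).
Proof.
move=> [_ I0 Iadd _ Iwedge] Isigma lw; rewrite /frame_euler.
elim/big_ind: _ => // j _.
exact: (Iwedge _ _ (Isigma j) (Lambda_contract _ lw)).1.
Qed.

Variables (E : subbundle V)
  (annE : forall j, annihilator E (sigma j))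
  (frameE : forall a, sub_section E (a - frame_proj a)).

Definition transverse q (z : 'I_q -> section V) : nat :=
  #|[pred i | ~~ `[< sub_section E (z i) >]]|.

Definition vanishing_order (k : nat) (w : graded V) : Prop :=
  forall q z, (transverse z <= k)%N -> w q z = 0.

Lemma frame_proj_sub a : sub_section E a -> frame_proj a = 0.
Proof.
move=> Ea; rewrite /frame_proj big1// => j _; rewrite (annE j Ea) scale0r//.
Qed.

(* [frame_euler] counts the arguments transverse to [E]. *)
Lemma frame_euler_eigen (w : graded V) k q (z : 'I_q -> section V) : Lambda w -> vanishing_order k w ->
  (transverse z <= k.+1)%N -> frame_euler w q z = w q z *+ k.+1.
Proof.
move=> lw w0 zk; have [wf _] := lw; rewrite frame_eulerE//.
have termE i : w q (upd z i (frame_proj (z i))) =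
    if i \in [pred i | ~~ `[< sub_section E (z i) >]] then w q z else 0.
  rewrite inE; case: asboolP => [Ez|nEz] /=; first by rewrite frame_proj_sub// (form0 (wf q)).
  (* Replacing [z i] by [P], a section of [E], leaves at most [k] transverse arguments, where [w]
     vanishes; hence projecting [z i] does not change the value. *)
  pose P := z i - frame_proj (z i).
  have -> : frame_proj (z i) = -1 *: P + z i by rewrite scaleN1r opprB subrK.
  rewrite (form_linear (wf q)) upd_id w0 ?mulr0 ?add0r//.
  have iz : i \in [pred i | ~~ `[< sub_section E (z i) >]] by rewrite inE; apply/asboolPn.
  move: zk; rewrite /transverse (cardD1 i) iz ltnS; apply: leq_trans.
  apply: subset_leq_card; apply/fintype.subsetP => l; rewrite !inE /upd.
  by case: (l == i) => //=; rewrite (asboolT (frameE (z i))).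
rewrite (eq_bigr _ (fun i _ => termE i)) -big_mkcond sumr_const -/(transverse z).
have [/w0 ->|kz] := leqP (transverse z) k; first by rewrite !mul0rn.
by congr (_ *+ _); apply/eqP; rewrite eqn_leq zk kz.
Qed.

Lemma vanishing_sub_ideal (I : set (graded V)) : is_ideal I ->
  (forall j, I (one_form (sigma j))) -> vanishing_ideal E `<=` I.
Proof.
move=> idI Isigma; have [IL I0 Iadd Iscale _] := idI.
(* [j] bounds the number of corrections left. The process ends because [w] is 0 in degrees at least
   [m]: below that there are fewer than [m] arguments, so vanishing order [k >= m] forces [w] to be
   0. *)
have step j k m w : Lambda w -> (forall q, (m <= q)%N -> w q = fun=> 0) ->
    (m <= k + j)%N -> vanishing_order k w -> I w.
  elim: j k w => [|j ih] k w lw wm mk wk.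
    suff -> : w = @ext0 _ _ V by [].
    apply: functional_extensionality_dep => q; apply/funext => z.
    have [/wm -> //|qm] := leqP m q; apply: wk.
    rewrite (leq_trans (max_card _))// card_ord.
    by rewrite addn0 in mk; exact: leq_trans (ltnW qm) mk.
  have ID := ideal_frame_euler idI Isigma lw.
  pose c : smooth_fun B := smooth_cst k.+1%:R^-1.
  pose w' := ext_add w (ext_scale (- c) (frame_euler w)).
  have -> : w = ext_add w' (ext_scale c (frame_euler w)).
    apply: functional_extensionality_dep => q; apply/funext => z.
    by rewrite /w' /ext_add /ext_scale mulNr subrK.
  apply: Iadd; last exact: Iscale.
  apply: (ih k.+1).
  - by apply: Lambda_add => //; apply: Lambda_scale; exact: IL.
  - move=> q mq; apply/funext => z; rewrite /w' /ext_add /ext_scale frame_eulerE//.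
    by rewrite wm// big1// mulr0 addr0.
  - by rewrite addSnnS.
  - move=> q z zk; rewrite /w' /ext_add /ext_scale (frame_euler_eigen lw wk zk).
    by rewrite mulNr /c smooth_cst_natVK// subrr.
move=> w [lw w0]; have [_ [m wm]] := lw.
apply: (step m 0%N m) => // q z; rewrite leqn0 => /eqP/card0_eq z0.
by apply: w0 => i; have := z0 i; rewrite !inE => /negbFE/asboolP.
Qed.

End Frame.

Lemma ideal_gen_annihilator (E : subbundle V) :
  ideal_gen [set one_form Om | Om in annihilator E] = vanishing_ideal E.
Proof.
apply/seteqP; split=> [w|w vw I idI SI].
  by apply; [exact: is_ideal_vanishing|exact: annihilator_sub_vanishing].
have [K [sigma [v [annE frameE]]]] := annihilator_frame E.
apply: (vanishing_sub_ideal annE frameE idI) vw => j.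
by apply: SI; exists (sigma j).
Qed.

End IdealGeneration.

(** * Involutivity and stability under the exterior derivative *)

Section Involutivity.
Context {R : realType} {M N : manifold R} (A : gen_lie_algebroid M N).
Local Notation V := (pb_bundle A).

Lemma ext_diff_vanishing (E : subbundle V) w : ids_involutive A E ->
  vanishing_ideal E w -> vanishing_ideal E (ext_diff w).
Proof.
move=> invE [[wf [m wm]] w0]; split; last first.
  move=> [//|q] u Eu /=; rewrite /diff_hom !big1 ?addr0// => i _.
    by rewrite big1// => j ij; rewrite w0 ?mulr0// => k; case: ifP => _ //; exact: invE.
  by rewrite w0 ?vf_act0 ?mulr0.
split; first by case=> [|q]; [exact: is_form0|exact: is_form_diff_hom].
exists m.+1 => -[//|q] mq; apply/funext => z /=.
by rewrite wm//; exact: diff_hom_fun0.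
Qed.

(** In Cartan's formula, both the contraction with [S] and the derivative of [pairing Om T] are
    0. *)
Lemma diff_hom_one_form (Om : section (dual_bundle V)) S T :
  pairing Om S = 0 -> pairing Om T = 0 ->
  diff_hom (one_form Om 1%N) (fcons S (fun _ : 'I_1 => T)) = - pairing Om (pb_bracket S T).
Proof.
move=> OS OT; have [of1 _] := Lambda_one_form Om.
rewrite cartan; last exact: of1.
have -> : contraction S (one_form Om 1%N) = fun=> 0.
  by apply/funext => z; rewrite /contraction /one_form fcons0.
rewrite diff_hom_fun0 subr0 /lie_derivative big_ord1 /one_form upd_eq OT.
by rewrite vf_act0 sub0r.
Qed.

End Involutivity.

Theorem theorem4p3 (R : realType) (M N : manifold R)
    (A : gen_lie_algebroid M N) (E : interior_differential_system A) :
  ids_involutive A E <-> exterior_differential_system A (annihilator_ideal A E).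
Proof.
rewrite /annihilator_ideal ideal_gen_annihilator; split=> [invE|[[_ dI] _] S T ES ET].
  split; last by exists E => k w _ [_ w0] _ u Eu; exact: w0.
  split; first exact: is_ideal_vanishing.
  by move=> w; exact: ext_diff_vanishing.
have [K [sigma [v [annE frameE]]]] := annihilator_frame E.
have Om0 Om : annihilator E Om -> pairing Om (pb_bracket S T) = 0.
  move=> EOm; have [_ d0] := dI _ (annihilator_sub_vanishing (ex_intro2 _ _ Om EOm erefl)).
  have EST i : sub_section E (fcons S (fun _ : 'I_1 => T) i).
    by rewrite /fcons; case: unlift.
  have := d0 2%N _ EST; rewrite -[LHS]/(diff_hom (one_form Om 1%N) _).
  rewrite (diff_hom_one_form (EOm S ES) (EOm T ET)) => /eqP.
  by rewrite oppr_eq0 => /eqP.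
(* All [sigma j] vanish on the bracket, so it equals its component in [E]. *)
have := frameE (pb_bracket S T); rewrite big1 ?subr0// => j _.
by rewrite Om0// scale0r.
Qed.
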